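(* Let $p\in(1,\infty)$. For each $C^1$-regular homotopy class of immersed circles in $\mathbf{R}^2$, stable closed planar $p$-elasticae in that class are unique up to similarity and reparametrization; that is, any two stable closed planar $p$-elasticae belonging to the same class agree up to similarity and reparametrization.
   Context: For a curve with signed curvature $k$ and arclength parameter $s$, the $p$-bending energy is $\mathcal{B}_p[\gamma]:=\int_\gamma|k|^p\,ds$. A planar $p$-elastica is a fixed-length critical point of $\mathcal{B}_p$, i.e. a curve (arclength parametrized, of class $W^{2,p}$) for which there is $\lambda\in\mathbf{R}$ such that the first variation of $\mathcal{B}_p+\lambda\mathcal{L}$ ($\mathcal{L}$ = length) vanishes. A closed planar $p$-elastica of length $L>0$ is regarded as an element of $$\mathcal{A}_{\mathrm{closed}}:=\{\gamma\in W^{2,p}(0,L;\mathbf{R}^2):|\gamma'|\equiv1,\ \gamma(0)=\gamma(L)=P_0,\ \gamma'(0)=\gamma'(L)=V_0\}$$ with $P_0:=\gamma(0)$ and $V_0:=\gamma'(0)$, equipped with the topology induced by the $W^{2,p}$-norm. It is called stable if it is a local minimizer of $\mathcal{B}_p$ in $\mathcal{A}_{\mathrm{closed}}$, i.e. minimizes $\mathcal{B}_p$ in some neighborhood of itself in $\mathcal{A}_{\mathrm{closed}}$. Two closed $C^1$ immersed curves (immersions of the circle into $\mathbf{R}^2$) are in the same $C^1$-regular homotopy class if they can be connected by a homotopy through $C^1$ immersions of the circle that is continuous in the $C^1$ topology. Similarities of the plane are compositions of isometries (including reflections) and scalings. *)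

(* Defs.v *)
From HB Require Import structures.
From mathcomp Require Import all_boot all_order all_algebra.
From mathcomp Require Import all_classical all_reals all_analysis.
Import Order.TTheory GRing.Theory Num.Theory.
Import numFieldNormedType.Exports.

Set Implicit Arguments.
Unset Strict Implicit.
Unset Printing Implicit Defensive.

Local Open Scope classical_set_scope.
Local Open Scope ring_scope.

Notation plane R := 'rV[R]_2.

Section PlaneGeometry.
Context {R : realType}.
Implicit Types u v : plane R.

(* The library norm on row vectors is the sup norm. *)
Definition enorm v : R := Num.sqrt (v 0 0 ^+ 2 + v 0 1 ^+ 2).

Definition det2 u v : R := u 0 0 * v 0 1 - u 0 1 * v 0 0.

Definition plane_isometry (f : plane R -> plane R) : Prop :=
  forall u v, enorm (f u - f v) = enorm (u - v).

Inductive similarity : (plane R -> plane R) -> Prop :=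
| similarity_isometry f : plane_isometry f -> similarity f
| similarity_scaling (c : R) : 0 < c -> similarity (fun v => c *: v)
| similarity_comp f g : similarity f -> similarity g -> similarity (f \o g).

End PlaneGeometry.

Section Sobolev.
Context {R : realType}.

Definition test_function (L : R) (phi : R -> R) : Prop :=
  (forall n t, derivable (derive1n n phi) t 1) /\
  exists a b : R, [/\ 0 < a, b < L & forall t, ~ (a <= t <= b) -> phi t = 0].

Definition weak_derivative (L : R) (f g : R -> R) : Prop :=
  forall phi, test_function L phi ->
    \int[@lebesgue_measure R]_(t in `]0, L[) (f t * derive1 phi t) =
    - \int[@lebesgue_measure R]_(t in `]0, L[) (g t * phi t).

Definition Lp_on (p L : R) (f : R -> R) : Prop :=
  f \_ `]0, L[ \in Lfun (@lebesgue_measure R) p%:E.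

(* An element of W^{2,p}(0,L;R^2), given by its C^1 representative [pos] on
   [0,L], the continuous representative [vel] of its first weak derivative,
   and a representative [acc] of its second weak derivative. Values of [pos]
   and [vel] outside [0,L], and of [acc] outside ]0,L[, are irrelevant
   everywhere below. *)
Record W2p (p L : R) := MkW2p {
  pos : R -> plane R;
  vel : R -> plane R;
  acc : R -> plane R;
  pos_continuous : {within `[0, L], continuous pos};
  vel_continuous : {within `[0, L], continuous vel};
  pos_Lp : forall i, Lp_on p L (fun t => pos t 0 i);
  vel_Lp : forall i, Lp_on p L (fun t => vel t 0 i);
  acc_Lp : forall i, Lp_on p L (fun t => acc t 0 i);
  vel_weak : forall i,
    weak_derivative L (fun t => pos t 0 i) (fun t => vel t 0 i);
  acc_weak : forall i,
    weak_derivative L (fun t => vel t 0 i) (fun t => acc t 0 i) }.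

Definition Lp_norm (p L : R) (f : R -> plane R) : \bar R :=
  Lnorm (@lebesgue_measure R) p%:E
    (EFin \o ((fun t => enorm (f t)) \_ `]0, L[)).

Definition W2p_dist (p L : R) (c d : W2p p L) : \bar R :=
  (Lp_norm p L (fun t => (pos c t - pos d t)%R) +
   Lp_norm p L (fun t => (vel c t - vel d t)%R) +
   Lp_norm p L (fun t => (acc c t - acc d t)%R))%E.

End Sobolev.

Section ElasticEnergy.
Context {R : realType}.

(* Length and p-bending energy of a not necessarily arclength parametrized
   curve with first and second derivatives [v] and [a]; signed curvature is
   det(v,a)/|v|^3 and ds = |v| dt. *)
Definition curve_length (L : R) (v : R -> plane R) : R :=
  \int[@lebesgue_measure R]_(t in `]0, L[) enorm (v t).

Definition signed_curvature (v a : R -> plane R) (t : R) : R :=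
  det2 (v t) (a t) / enorm (v t) ^+ 3.

Definition bending (p L : R) (v a : R -> plane R) : R :=
  \int[@lebesgue_measure R]_(t in `]0, L[)
    (`|signed_curvature v a t| `^ p * enorm (v t)).

Definition C1_closed (p L : R) (c : W2p p L) : Prop :=
  pos c 0 = pos c L /\ vel c 0 = vel c L.

Definition arclength_parametrized (p L : R) (c : W2p p L) : Prop :=
  forall t, 0 <= t <= L -> enorm (vel c t) = 1.

Definition first_variation_vanishes (p L lambda : R) (c : W2p p L) : Prop :=
  forall h : W2p p L, C1_closed h ->
    is_derive (0 : R) (1 : R)
      (fun eps : R =>
         bending p L (fun t => vel c t + eps *: vel h t)
                     (fun t => acc c t + eps *: acc h t)
         + lambda * curve_length L (fun t => vel c t + eps *: vel h t))
      0.

Definition closed_planar_p_elastica (p L : R) (c : W2p p L) : Prop :=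
  [/\ arclength_parametrized c, C1_closed c &
      exists lambda : R, first_variation_vanishes lambda c].

Definition A_closed (p L : R) (P0 V0 : plane R) : set (W2p p L) :=
  [set c | [/\ arclength_parametrized c,
               pos c 0 = P0, pos c L = P0, vel c 0 = V0 & vel c L = V0]].

Definition stable (p L : R) (c : W2p p L) : Prop :=
  exists2 delta : R, 0 < delta &
    forall d : W2p p L, A_closed (pos c 0) (vel c 0) d ->
      (W2p_dist c d < delta%:E)%E ->
      bending p L (vel c) (acc c) <= bending p L (vel d) (acc d).

End ElasticEnergy.

Section ImmersedCircles.
Context {R : realType}.

(* Maps from the circle R/Z are represented by 1-periodic maps on R. *)
Definition C1_immersed_circle (c : R -> plane R) : Prop :=
  [/\ periodic c 1, (forall t, derivable c t 1), continuous (derive1 c) &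
      forall t, derive1 c t != 0].

Definition regularly_homotopic (c0 c1 : R -> plane R) : Prop :=
  exists H : R -> R -> plane R,
    [/\ H 0 = c0, H 1 = c1,
        (forall s, 0 <= s <= 1 -> C1_immersed_circle (H s)) &
        forall s, 0 <= s <= 1 -> forall eps : R, 0 < eps ->
          exists2 delta : R, 0 < delta &
            forall r, 0 <= r <= 1 -> `|r - s| < delta -> forall t,
              enorm (H r t - H s t) < eps /\
              enorm (derive1 (H r) t - derive1 (H s) t) < eps].

Definition circle_map (p L : R) (c : W2p p L) (t : R) : plane R :=
  pos c (L * (t - (Num.floor t)%:~R)).

(* Lifts to R of the C^1 diffeomorphisms of R/Z, of either orientation. *)
Definition circle_diffeo (phi : R -> R) : Prop :=
  [/\ (forall t, derivable phi t 1), continuous (derive1 phi),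
      (forall t, derive1 phi t != 0) &
      (forall t, phi (t + 1) = phi t + 1) \/
      (forall t, phi (t + 1) = phi t - 1)].

Definition agree_up_to_similarity_and_reparametrization
    (c0 c1 : R -> plane R) : Prop :=
  exists (f : plane R -> plane R) (phi : R -> R),
    [/\ similarity f, circle_diffeo phi & forall t, c1 (phi t) = f (c0 t)].

End ImmersedCircles.

(* Main.v *)
Require Import Defs.
From HB Require Import structures.
From mathcomp Require Import all_boot all_order all_algebra.
From mathcomp Require Import all_classical all_reals all_analysis.
From mathcomp Require Import measurable_realfun ring lra.
Import Order.TTheory GRing.Theory Num.Theory.
Import numFieldNormedType.Exports.
Set Implicit Arguments.
Unset Strict Implicit.
Unset Printing Implicit Defensive.
Local Open Scope classical_set_scope.
Local Open Scope ring_scope.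

(* Testing the first variation with fields whose second derivative is piecewise
   constant yields a continuous curvature k and the integrated Euler-Lagrange
   equations: p |k|^(p-2) k is an affine function of the position, and
   (p - 1) |k|^p = lam + <C, gamma'> for a constant vector C.
   If C = 0, the curve is a multiply covered circle, determined up to
   similarity by its rotation number.  Otherwise closedness forces the tangent
   to avoid the direction - C, so the rotation number is zero.  In that case
   the half-angle of the tangent solves a universal equation after a time
   change, the closing condition determines the modulus, and two such curves
   have the same tangent up to an affine time change r t + s0.  If the tangent
   has a period T shorter than the length, the curve is not stable: a small
   fold around a zero of k can be cut out and the translated fold, one period
   later, run through at half speed, which keeps the curve closed and replaces
   energy 2 e by 2^(1 - p) e.  Hence r = 1.  Finally the rotation number is
   invariant under regular homotopy, since a C^1-small change of the curve
   changes the tangent angle by a periodic function. *)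

From mathcomp Require Import ring lra.

Section Calculus.
Context {R : realType}.
Implicit Types (f g : R -> R) (x a b : R).

Lemma is_derive_add f g x a b : is_derive x 1 f a -> is_derive x 1 g b ->
  is_derive x 1 (fun t => f t + g t) (a + b).
Proof. exact: is_deriveD. Qed.

Lemma is_derive_sub f g x a b : is_derive x 1 f a -> is_derive x 1 g b ->
  is_derive x 1 (fun t => f t - g t) (a - b).
Proof. exact: is_deriveB. Qed.

Lemma is_derive_opp f x a : is_derive x 1 f a ->
  is_derive x 1 (fun t => - f t) (- a).
Proof. exact: is_deriveN. Qed.

Lemma is_derive_mul f g x a b : is_derive x 1 f a -> is_derive x 1 g b ->
  is_derive x 1 (fun t => f t * g t) (a * g x + f x * b).
Proof.
move=> fa gb; apply: (is_derive_eq (is_deriveM fa gb)).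
by rewrite /GRing.scale /= addrC mulrC.
Qed.

Lemma is_derive_const (c : R) (x : R) : is_derive x 1 (fun _ : R => c) 0.
Proof. exact: is_derive_cst. Qed.

Lemma is_derive_cmul (c : R) f x a : is_derive x 1 f a ->
  is_derive x 1 (fun t => c * f t) (c * a).
Proof.
move=> fa; apply: (is_derive_eq (is_derive_mul (is_derive_const c x) fa)).
by rewrite mul0r add0r.
Qed.

Lemma is_derive_pow n f x a : is_derive x 1 f a ->
  is_derive x 1 (fun t => f t ^+ n) (n%:R * f x ^+ n.-1 * a).
Proof.
move=> fa; elim: n => [|n IH].
  by rewrite mul0r mul0r; exact: is_derive_const.
rewrite (_ : (fun t => f t ^+ n.+1) = fun t => f t * f t ^+ n); last first.
  by apply/funext => t; rewrite exprS.
apply: (is_derive_eq (is_derive_mul fa IH)).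
by case: n {IH} => [|n] /=; rewrite ?exprS -?[in RHS]natr1; ring.
Qed.

Lemma is_derive_comp f g x a b : is_derive (g x) 1 f a -> is_derive x 1 g b ->
  is_derive x 1 (fun t => f (g t)) (a * b).
Proof. exact: is_derive1_comp. Qed.

Lemma is_derive_inv f x a : f x != 0 -> is_derive x 1 f a ->
  is_derive x 1 (fun t => (f t)^-1) (- a / f x ^+ 2).
Proof.
move=> fx fa; apply: (is_derive_eq (is_deriveV fx fa)).
by rewrite /GRing.scale /= mulrC mulrN mulNr.
Qed.

Lemma is_derive_div f g x a b : g x != 0 ->
  is_derive x 1 f a -> is_derive x 1 g b ->
  is_derive x 1 (fun t => f t / g t) ((a * g x - f x * b) / g x ^+ 2).
Proof.
move=> gx fa gb; apply: (is_derive_eq (is_derive_mul fa (is_derive_inv gx gb))).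
by field.
Qed.

Lemma is_derive_affine (a b x : R) : is_derive x 1 (fun t => a * t + b) a.
Proof.
apply: (is_derive_eq (is_derive_add (is_derive_cmul a (is_derive_id x 1))
                                    (is_derive_const b x))).
by rewrite mulr1 addr0.
Qed.

Lemma is_derive_cont f x a : is_derive x 1 f a -> {for x, continuous f}.
Proof. by move=> [fa _]; apply/differentiable_continuous/derivable1_diffP. Qed.

Lemma near_eq_is_derive f g x a : {near x, f =1 g} ->
  is_derive x 1 f a -> is_derive x 1 g a.
Proof. exact: derive.near_eq_is_derive. Qed.

Lemma MVT_is_derive f (df : R -> R) a b : a < b ->
  (forall x, a < x < b -> is_derive x 1 f (df x)) ->
  {within `[a, b], continuous f} ->
  exists2 c, a < c < b & f b - f a = df c * (b - a).
Proof.
move=> ab fd fc; have fd' x : x \in `]a, b[ -> is_derive x 1 f (df x).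
  by rewrite in_itv; exact: fd.
have [c] := MVT ab fd' fc.
by rewrite in_itv /= => ? ?; exists c.
Qed.

Lemma is_derive_within f (df : R -> R) a b :
  (forall x, a <= x <= b -> is_derive x 1 f (df x)) ->
  {within `[a, b], continuous f}.
Proof.
move=> fd; apply: continuous_in_subspaceT => x.
by rewrite inE /= in_itv /= => /fd /is_derive_cont.
Qed.

Lemma MVT_is_derive_cc f (df : R -> R) a b : a < b ->
  (forall x, a <= x <= b -> is_derive x 1 f (df x)) ->
  exists2 c, a < c < b & f b - f a = df c * (b - a).
Proof.
move=> ab fd; apply: MVT_is_derive ab _ (is_derive_within fd).
by move=> x /andP[ax xb]; apply: fd; rewrite !ltW.
Qed.

Lemma is_derive_le f (df : R -> R) a b : a <= b ->
  (forall x, a <= x <= b -> is_derive x 1 f (df x)) ->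
  (forall x, a <= x <= b -> 0 <= df x) -> f a <= f b.
Proof.
rewrite le_eqVlt => /predU1P[-> //|ab fd df0].
have [c /andP[ac cb]] := MVT_is_derive_cc ab fd.
move=> e; rewrite -subr_ge0 e mulr_ge0 ?df0 ?(ltW ac) ?(ltW cb) //.
by rewrite subr_ge0 ltW.
Qed.

Lemma is_derive_lt f (df : R -> R) a b : a < b ->
  (forall x, a <= x <= b -> is_derive x 1 f (df x)) ->
  (forall x, a <= x <= b -> 0 < df x) -> f a < f b.
Proof.
move=> ab fd df0.
have [c /andP[ac cb]] := MVT_is_derive_cc ab fd.
move=> e; rewrite -subr_gt0 e mulr_gt0 ?df0 ?(ltW ac) ?(ltW cb) //.
by rewrite subr_gt0.
Qed.

Lemma is_derive_extend f g (n e : R) : 0 < e ->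
  (forall t, `|t - n| < e -> t != n -> is_derive t 1 f (g t)) ->
  {for n, continuous f} -> {for n, continuous g} -> is_derive n 1 f (g n).
Proof.
move=> e0 fd fc gc.
have key : (fun h => h^-1 *: (f (h + n) - f n)) @ 0^' --> g n.
  apply/cvgrPdist_lt => eps eps0.
  have /cvgrPdist_lt /(_ _ eps0) := gc.
  move=> /nbhs_ballP [d /= d0 gd].
  near=> h.
  have h0 : h != 0 by near: h; exact: nbhs_dnbhs_neq.
  have hd : `|h| < Num.min d e.
    near: h; apply: dnbhs0_lt; by rewrite lt_min d0.
  move: hd; rewrite lt_min => /andP[hd he].
  have fdh x : `|x - n| < `|h| -> x != n -> is_derive x 1 f (g x).
    by move=> xh xn; apply: fd => //; exact: lt_trans xh he.
  have fch : forall x, `|x - n| <= `|h| -> {for x, continuous f}.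
    move=> x xh; have [->//|xn] := eqVneq x n.
    by apply: (is_derive_cont (fd x _ xn)); exact: le_lt_trans xh he.
  have [c cn ce] : exists2 c, `|c - n| < `|h| & f (h + n) - f n = g c * h.
    have [hp|hn|/eqP] := ltgtP 0 h; last by rewrite eq_sym (negbTE h0).
    - have [|||c /andP[c1 c2] E] := @MVT_is_derive f g n (h + n).
      + by rewrite ltrDr.
      + move=> x /andP[x1 x2]; apply: fdh; last by rewrite gt_eqF.
        by rewrite !gtr0_norm ?subr_gt0 // ltrBlDr.
      + apply: continuous_in_subspaceT => x; rewrite inE /= in_itv /= => /andP[x1 x2].
        by apply: fch; rewrite (gtr0_norm hp) ger0_norm ?subr_ge0 // lerBlDr.
      exists c; last by rewrite E addrK.
      by rewrite !gtr0_norm ?subr_gt0 // ltrBlDr.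
    - have [|||c /andP[c1 c2] E] := @MVT_is_derive f g (h + n) n.
      + by rewrite gtrDr.
      + move=> x /andP[x1 x2]; apply: fdh; last by rewrite lt_eqF.
        by rewrite !ltr0_norm ?subr_lt0 // ltrN2 ltrBrDr.
      + apply: continuous_in_subspaceT => x; rewrite inE /= in_itv /= => /andP[x1 x2].
        by apply: fch; rewrite (ltr0_norm hn) ler0_norm ?subr_le0 // lerN2 lerBrDr.
      exists c; first by rewrite !ltr0_norm ?subr_lt0 // ltrN2 ltrBrDr.
      by rewrite -opprB E; ring.
  rewrite ce /GRing.scale /= mulrCA mulVf // mulr1.
  by apply: (gd c); rewrite /ball /= distrC (lt_trans cn hd).
split.
  rewrite /derivable; apply/cvg_ex; exists (g n).
  by under eq_fun do rewrite scaler1.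
rewrite /derive; apply/cvg_lim => //.
by under eq_fun do rewrite scaler1.
Unshelve. all: by end_near. Qed.

Lemma gronwall0 (D dD : R -> R) (C a b : R) : a <= b ->
  (forall t, a <= t <= b -> is_derive t 1 D (dD t)) ->
  (forall t, a <= t <= b -> `|dD t| <= C * `|D t|) ->
  (D a = 0 -> D b = 0) /\ (D b = 0 -> D a = 0).
Proof.
move=> ab Dd DC.
have D2 (s : R) t : a <= t <= b ->
    is_derive t 1 (fun r => D r ^+ 2 * expR (s * r))
      ((2 * D t * dD t + s * D t ^+ 2) * expR (s * t)).
  move=> tab; have Dt := Dd t tab.
  apply: (is_derive_eq (is_derive_mul (is_derive_mul Dt Dt)
    (is_derive_comp (is_derive_expR _) (is_derive_cmul s (is_derive_id t 1))))).
  by rewrite mulr1; ring.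
have bnd t : a <= t <= b -> `|2 * D t * dD t| <= 2 * C * D t ^+ 2.
  move=> tab; rewrite !normrM ger0_norm // -[D t ^+ 2]ger0_norm ?sqr_ge0 //.
  rewrite normrX -!mulrA ler_pM2l // expr2 [leRHS]mulrCA.
  by apply: ler_wpM2l => //; exact: DC.
split=> D0.
- have := @is_derive_le (fun r => - (D r ^+ 2 * expR (- (2 * C) * r)))
    (fun t => - ((2 * D t * dD t + - (2 * C) * D t ^+ 2) * expR (- (2 * C) * t)))
    a b ab (fun t h => is_derive_opp (D2 _ t h)).
  rewrite D0 expr0n mul0r oppr0 => H.
  have /H : forall x, a <= x <= b ->
      0 <= - ((2 * D x * dD x + - (2 * C) * D x ^+ 2) * expR (- (2 * C) * x)).
    move=> t tab; rewrite -mulNr mulr_ge0 ?expR_ge0 // opprD mulNr opprK.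
    by rewrite addrC subr_ge0 (le_trans (ler_norm _)) // bnd.
  rewrite oppr_ge0 pmulr_lle0 ?expR_gt0 // => D20.
  by apply/eqP; rewrite -sqrf_eq0 eq_le D20 sqr_ge0.
- have := @is_derive_le (fun r => D r ^+ 2 * expR (2 * C * r))
    (fun t => (2 * D t * dD t + 2 * C * D t ^+ 2) * expR (2 * C * t))
    a b ab (D2 _).
  rewrite D0 expr0n mul0r => H.
  have /H : forall x, a <= x <= b ->
      0 <= (2 * D x * dD x + 2 * C * D x ^+ 2) * expR (2 * C * x).
    move=> t tab; rewrite mulr_ge0 ?expR_ge0 //.
    by have := bnd t tab; rewrite ler_norml => /andP[+ _]; lra.
  rewrite pmulr_lle0 ?expR_gt0 // => D20.
  by apply/eqP; rewrite -sqrf_eq0 eq_le D20 sqr_ge0.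
Qed.

Definition sgp (r x : R) : R := Num.sg x * `|x| `^ r.

Lemma sgp0 (r : R) : sgp r 0 = 0.
Proof. by rewrite /sgp sgr0 mul0r. Qed.

Lemma sgpN (r x : R) : sgp r (- x) = - sgp r x.
Proof. by rewrite /sgp sgrN normrN mulNr. Qed.

Lemma gt0_sgp (r x : R) : 0 < x -> sgp r x = x `^ r.
Proof. by move=> x0; rewrite /sgp gtr0_sg // mul1r gtr0_norm. Qed.

Lemma sgp1 (x : R) : sgp 1 x = x.
Proof. by rewrite /sgp powRr1 // -numEsg. Qed.

Lemma normr_sgp (r x : R) : 0 < r -> `|sgp r x| = `|x| `^ r.
Proof.
move=> r0; have [->|x0] := eqVneq x 0.
  by rewrite sgp0 normr0 powR0 // gt_eqF.
by rewrite /sgp normrM normr_sg x0 mul1r ger0_norm // powR_ge0.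
Qed.

Lemma sgr_sgp (r x : R) : Num.sg (sgp r x) = Num.sg x.
Proof.
have [->|x0] := eqVneq x 0; first by rewrite sgp0.
by rewrite /sgp sgrM sgr_id [X in _ * X]gtr0_sg ?mulr1 // powR_gt0 // normr_gt0.
Qed.

Lemma sgp_sgp (r s x : R) : 0 < s -> sgp r (sgp s x) = sgp (s * r) x.
Proof.
move=> s0; rewrite {1}/sgp sgr_sgp normr_sgp // /sgp.
by rewrite powRrM.
Qed.

Lemma sgpK (r : R) : 0 < r -> cancel (sgp r) (sgp r^-1).
Proof. by move=> r0 x; rewrite sgp_sgp // divff ?gt_eqF // sgp1. Qed.

Lemma sgpVK (r : R) : 0 < r -> cancel (sgp r^-1) (sgp r).
Proof. by move=> r0 x; rewrite sgp_sgp ?invr_gt0 // mulVf ?gt_eqF // sgp1. Qed.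

Lemma mulr_sgp (r x : R) : 0 < r -> x * sgp r x = `|x| `^ (r + 1).
Proof.
move=> r0; have [->|x0] := eqVneq x 0.
  by rewrite mul0r normr0 powR0 // gt_eqF // ltr_wpDr.
rewrite /sgp mulrA [x * _]mulrC -normrEsg powRD; last first.
  by rewrite normr_eq0 x0 implybT.
by rewrite mulrC powRr1.
Qed.

Lemma is_derive_normp_pos (p x : R) : 0 < x ->
  is_derive x 1 (fun t => `|t| `^ p) (p * x `^ (p - 1)).
Proof.
move=> x0; apply: (near_eq_is_derive _ (is_derive1_powR p x0)).
by near=> t; rewrite gtr0_norm //; near: t; exact: lt_nbhsr.
Unshelve. all: by end_near. Qed.

Lemma continuous_normp (p x : R) : 0 < p -> {for x, continuous (fun t => `|t| `^ p)}.
Proof.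
move=> p0; have [x0|x0|->] := ltgtP x 0.
- have Nx : 0 < - x by rewrite oppr_gt0.
  have := is_derive_comp (is_derive_normp_pos p Nx)
                         (is_derive_opp (is_derive_id x 1)).
  move=> /is_derive_cont.
  by rewrite (_ : (fun t => `|- t| `^ p) = fun t => `|t| `^ p) //; apply/funext => t; rewrite normrN.
- exact: is_derive_cont (is_derive_normp_pos p x0).
- apply/cvgrPdist_lt => e e0; apply/nbhs_ballP.
  exists (e `^ p^-1); first exact: powR_gt0.
  move=> t; rewrite /ball /= sub0r normrN => te.
  rewrite normr0 powR0 ?gt_eqF // sub0r normrN ger0_norm ?powR_ge0 //.
  rewrite -[ltRHS](powRr1 (ltW e0)) -(mulVf (lt0r_neq0 p0)) powRrM.
  by apply: gt0_ltr_powR; rewrite ?nnegrE ?powR_ge0.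
Qed.

Lemma is_derive_sgp_pos (r x : R) : 0 < x ->
  is_derive x 1 (sgp r) (r * x `^ (r - 1)).
Proof.
move=> x0; apply: (near_eq_is_derive _ (is_derive1_powR r x0)).
by near=> t; rewrite gt0_sgp //; near: t; exact: lt_nbhsr.
Unshelve. all: by end_near. Qed.

Lemma continuous_sgp (r x : R) : 0 < r -> {for x, continuous (sgp r)}.
Proof.
move=> r0; have [x0|x0|->] := ltgtP x 0.
- have Nx : 0 < - x by rewrite oppr_gt0.
  have := is_derive_opp (is_derive_comp (is_derive_sgp_pos r Nx)
                           (is_derive_opp (is_derive_id x 1))).
  move=> /is_derive_cont; rewrite (_ : (fun t => - sgp r (- t)) = sgp r) //.
  by apply/funext => t; rewrite sgpN opprK.
- exact: is_derive_cont (is_derive_sgp_pos r x0).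
- apply/cvgrPdist_lt => e e0.
  have /cvgrPdist_lt /(_ e e0) := continuous_normp (x := 0) r0.
  apply: filterS => t; rewrite normr0 powR0 ?gt_eqF // sgp0 !sub0r !normrN.
  by rewrite normr_sgp // ger0_norm ?powR_ge0.
Qed.

Lemma is_derive_normp (p x : R) : 1 < p ->
  is_derive x 1 (fun t => `|t| `^ p) (p * sgp (p - 1) x).
Proof.
move=> p1; have p10 : 0 < p - 1 by rewrite subr_gt0.
have pos (y : R) : 0 < y -> is_derive y 1 (fun t => `|t| `^ p) (p * sgp (p - 1) y).
  by move=> y0; rewrite gt0_sgp //; exact: is_derive_normp_pos.
have neq (y : R) : y != 0 -> is_derive y 1 (fun t => `|t| `^ p) (p * sgp (p - 1) y).
  case: ltgtP => // [y0 _|/pos//].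
  have Ny : 0 < - y by rewrite oppr_gt0.
  have := is_derive_comp (pos _ Ny) (is_derive_opp (is_derive_id y 1)).
  rewrite sgpN mulrN1 mulrN opprK.
  by rewrite (_ : (fun t => `|- t| `^ p) = fun t => `|t| `^ p) //; apply/funext => t; rewrite normrN.
have [->|/neq//] := eqVneq x 0.
apply: (is_derive_extend (f := fun t => `|t| `^ p)
  (g := fun t => p * sgp (p - 1) t) (n := 0) (e := 1)) => //.
- by apply: continuous_normp; rewrite (lt_trans ltr01).
- by apply: cvgM; [exact: cvg_cst|exact: continuous_sgp].
Qed.

Lemma ltr_sgp (r : R) : 0 < r -> {mono sgp r : x y / x < y}.
Proof.
move=> r0; have incr : {homo sgp r : x y / x < y}.
  move=> x y xy; have [x0|x0] := leP 0 x.
    rewrite [ltRHS]gt0_sgp ?(le_lt_trans x0) //.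
    have [x00|xN0] := eqVneq x 0; first by rewrite x00 sgp0 powR_gt0 // -x00.
    have {}x0 : 0 < x by rewrite lt_neqAle eq_sym xN0.
    by rewrite gt0_sgp // gt0_ltr_powR // nnegrE ltW // (lt_trans x0).
  have sx : sgp r x < 0 by rewrite -sgr_lt0 sgr_sgp sgr_lt0.
  have [y0|y0] := leP 0 y.
    by rewrite (lt_le_trans sx) // -sgr_ge0 sgr_sgp sgr_ge0.
  rewrite -ltrN2 -!sgpN !gt0_sgp ?oppr_gt0 //.
  by rewrite gt0_ltr_powR // ?nnegrE ?oppr_ge0 ?ltrN2 // ltW.
exact: leW_mono (le_mono incr).
Qed.

Lemma continuous_add f g : continuous f -> continuous g ->
  continuous (fun x => f x + g x).
Proof. by move=> fc gc x; exact: cvgD (fc x) (gc x). Qed.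

Lemma continuous_sub f g : continuous f -> continuous g ->
  continuous (fun x => f x - g x).
Proof. by move=> fc gc x; exact: cvgB (fc x) (gc x). Qed.

Lemma continuous_mul f g : continuous f -> continuous g ->
  continuous (fun x => f x * g x).
Proof. by move=> fc gc x; exact: cvgM (fc x) (gc x). Qed.

Lemma continuous_compose f g : continuous f -> continuous g ->
  continuous (fun x => g (f x)).
Proof. by move=> fc gc x; apply: continuous_comp; [exact: fc|exact: gc]. Qed.

Lemma continuous_const (k : R) : continuous (fun _ : R => k).
Proof. by move=> x; exact: cvg_cst. Qed.

Lemma is_derive_continuous f (df : R -> R) :
  (forall x, is_derive x 1 f (df x)) -> continuous f.
Proof. by move=> fd x; exact: is_derive_cont (fd x). Qed.

End Calculus.

Section Integration.
Context {R : realType}.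
Notation mu := (@lebesgue_measure R).
Implicit Types (f g F G : R -> R) (a b c : R).

Definition itg a b f : Prop := mu.-integrable `[a, b] (EFin \o f).
Definition iab a b f : R := \int[mu]_(x in `[a, b]) f x.

Lemma within_add (A : set R) f g : {within A, continuous f} ->
  {within A, continuous g} -> {within A, continuous (fun x => f x + g x)}.
Proof. by move=> fc gc x; exact: cvgD (fc x) (gc x). Qed.

Lemma within_sub (A : set R) f g : {within A, continuous f} ->
  {within A, continuous g} -> {within A, continuous (fun x => f x - g x)}.
Proof. by move=> fc gc x; exact: cvgB (fc x) (gc x). Qed.

Lemma within_mul (A : set R) f g : {within A, continuous f} ->
  {within A, continuous g} -> {within A, continuous (fun x => f x * g x)}.
Proof. by move=> fc gc x; exact: cvgM (fc x) (gc x). Qed.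

Lemma within_const (A : set R) (k : R) : {within A, continuous (fun _ : R => k)}.
Proof. by move=> x; exact: cvg_cst. Qed.

Lemma within_comp (A : set R) f g : {within A, continuous f} -> continuous g ->
  {within A, continuous (fun x => g (f x))}.
Proof. by move=> fc gc x; apply: continuous_comp; [exact: fc|exact: gc]. Qed.

Lemma itg_oo a b f : itg a b f <-> mu.-integrable `]a, b[ (EFin \o f).
Proof.
split=> [H|]; first by apply: (integrableS _ _ _ H) => //; exact: subset_itv_oo_cc.
move=> /integrableP[mf fi]; apply/integrableP; split.
  by move: mf => /measurable_EFinP/measurable_fun_itv_cc/measurable_EFinP.
rewrite (integral_itv_bndoo true false) //.
exact: measurableT_comp.
Qed.

Lemma iab_oo a b f : itg a b f -> \int[mu]_(x in `]a, b[) f x = iab a b f.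
Proof.
move=> /itg_oo /measurable_int mf.
by rewrite /iab /Rintegral (integral_itv_bndoo true false).
Qed.

Lemma itgS a b c d f : a <= c -> d <= b -> itg a b f -> itg c d f.
Proof.
move=> ac db; apply: integrableS => //.
by apply: subset_itv; rewrite bnd_simp.
Qed.

Lemma itg_ext a b f g : {in `[a, b], f =1 g} -> itg a b f -> itg a b g.
Proof.
move=> fg; apply: eq_integrable => // x; rewrite inE /= => xab.
by rewrite /= fg.
Qed.

Lemma itgD a b f g : itg a b f -> itg a b g -> itg a b (fun x => f x + g x).
Proof. by move=> fi gi; have /= := integrableD _ fi gi; apply. Qed.

Lemma itgB a b f g : itg a b f -> itg a b g -> itg a b (fun x => f x - g x).
Proof. by move=> fi gi; have /= := integrableB _ fi gi; apply. Qed.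

Lemma itgZ a b f (k : R) : itg a b f -> itg a b (fun x => k * f x).
Proof. by move=> fi; have /= := integrableZl _ k fi; apply. Qed.

Lemma itg_continuous a b f : {within `[a, b], continuous f} -> itg a b f.
Proof.
by move=> fc; apply: continuous_compact_integrable => //; exact: segment_compact.
Qed.

Lemma continuous_itg a b f : continuous f -> itg a b f.
Proof. by move=> fc; apply/itg_continuous/continuous_subspaceT. Qed.

Lemma measurable_itg a b f : itg a b f -> measurable_fun `[a, b] f.
Proof. by move=> /measurable_int /measurable_EFinP. Qed.

Lemma itg_le a b f g : measurable_fun `[a, b] f ->
  (forall x, a <= x <= b -> `|f x| <= g x) -> itg a b g -> itg a b f.
Proof.
move=> mf fg gi; apply: (le_integrable _ _ _ gi) => //.
  exact/measurable_EFinP.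
move=> x /=; rewrite in_itv /= => xab; rewrite lee_fin.
by apply: (le_trans (fg x xab)); exact: ler_norm.
Qed.

Lemma itg_bounded a b f (M : R) : measurable_fun `[a, b] f ->
  (forall x, a <= x <= b -> `|f x| <= M) -> itg a b f.
Proof.
move=> mf fM; apply: (itg_le mf fM).
exact/continuous_itg/cst_continuous.
Qed.

Lemma itgM_bounded a b f g (M : R) : itg a b f -> measurable_fun `[a, b] g ->
  (forall x, a <= x <= b -> `|g x| <= M) -> itg a b (fun x => f x * g x).
Proof.
move=> fi mg gM; apply: (itg_le (g := fun x => `|M| * `|f x|)).
- by apply: measurable_funM => //; exact: measurable_itg.
- move=> x xab; rewrite normrM mulrC; apply: ler_wpM2r => //.
  by rewrite (le_trans (gM x xab)) // ler_norm.
- by apply: itgZ; exact: (integrable_norm fi).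
Qed.

Lemma continuous_bounded a b f : {within `[a, b], continuous f} ->
  exists M, forall x, a <= x <= b -> `|f x| <= M.
Proof.
move=> fc; have [ab|ab] := leP a b; last first.
  exists 0 => x /andP[ax xb]; move: ab; rewrite ltNge.
  by rewrite (le_trans ax xb).
have fnc : {within `[a, b], continuous (fun x => `|f x|)}.
  by move=> x; apply: continuous_comp; [exact: fc|exact: norm_continuous].
have [c _ H] := EVT_max ab fnc.
by exists `|f c| => x xab; apply: H; rewrite in_itv.
Qed.

Lemma itgM_continuous a b f g : itg a b f -> {within `[a, b], continuous g} ->
  itg a b (fun x => f x * g x).
Proof.
move=> fi gc; have [M gM] := continuous_bounded gc.
apply: itgM_bounded fi _ gM; exact: measurable_itg (itg_continuous gc).
Qed.

Lemma iabD a b f g : itg a b f -> itg a b g ->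
  iab a b (fun x => f x + g x) = iab a b f + iab a b g.
Proof. by move=> fi gi; rewrite /iab RintegralD. Qed.

Lemma iabB a b f g : itg a b f -> itg a b g ->
  iab a b (fun x => f x - g x) = iab a b f - iab a b g.
Proof. by move=> fi gi; rewrite /iab RintegralB. Qed.

Lemma iabZ a b f (k : R) : itg a b f ->
  iab a b (fun x => k * f x) = k * iab a b f.
Proof. by move=> fi; rewrite /iab RintegralZl. Qed.

Lemma eq_iab a b f g : (forall x, a <= x <= b -> f x = g x) ->
  iab a b f = iab a b g.
Proof. by move=> fg; apply: eq_Rintegral => x; rewrite inE /= in_itv => /fg. Qed.

Lemma eq_iab_oo a b f g : itg a b f -> (forall x, a < x < b -> f x = g x) ->
  itg a b g /\ iab a b f = iab a b g.
Proof.
move=> fi fg; have gi : itg a b g.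
  apply/itg_oo; move/itg_oo: fi; apply: eq_integrable => // x.
  by rewrite inE /= in_itv /= => /fg ->.
split=> //; rewrite -!iab_oo //; apply: eq_Rintegral => x.
by rewrite inE /= in_itv /= => /fg.
Qed.

Lemma iab_const a b (k : R) : a <= b -> iab a b (fun=> k) = k * (b - a).
Proof.
move=> ab; rewrite /iab Rintegral_cst //=.
have /= -> := @lebesgue_measure_itv R `[a, b]; rewrite lte_fin.
by move: ab; rewrite le_eqVlt => /predU1P[->|->//]; rewrite ltxx subrr.
Qed.

Lemma iab_point a f : iab a a f = 0.
Proof. by rewrite /iab set_itv1 Rintegral_set1. Qed.

Lemma iab_split a b c f : a <= b -> b <= c -> itg a c f ->
  iab a c f = iab a b f + iab b c f.
Proof.
move=> ab bc fi; rewrite /iab.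
have H : mu.-integrable [set` Interval (BRight b) (BRight c)] (EFin \o f).
  apply: (integrableS _ _ _ (itgS ab (lexx c) fi)) => //.
  by apply: subset_itvr; rewrite bnd_simp.
rewrite -[X in _ + X](Rintegral_itv_obnd_cbnd H).
by rewrite -(@Rintegral_itvB _ f _ _ b fi) ?bnd_simp // addrC subrK.
Qed.

Lemma le_iab a b f g : itg a b f -> itg a b g ->
  (forall x, a <= x <= b -> f x <= g x) -> iab a b f <= iab a b g.
Proof.
by move=> fi gi fg; apply: le_Rintegral.
Qed.

Lemma le_norm_iab a b f : itg a b f -> `|iab a b f| <= iab a b (fun x => `|f x|).
Proof. by move=> fi; apply: le_normr_Rintegral. Qed.

Lemma iab_bound a b f (M : R) : a <= b -> itg a b f ->
  (forall x, a <= x <= b -> `|f x| <= M) -> `|iab a b f| <= M * (b - a).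
Proof.
move=> ab fi fM; apply: (le_trans (le_norm_iab fi)).
rewrite -iab_const //; apply: le_iab => //; first exact: (integrable_norm fi).
exact/continuous_itg/cst_continuous.
Qed.

Lemma ftc a b f F : a <= b -> {within `[a, b], continuous f} ->
  {within `[a, b], continuous F} ->
  (forall x, a < x < b -> is_derive x 1 F (f x)) -> iab a b f = F b - F a.
Proof.
rewrite le_eqVlt => /predU1P[->|ab fc Fc Fd].
  by rewrite iab_point subrr.
have dF : derivable_oo_LRcontinuous F a b.
  have [_ Fa Fb] := (continuous_within_itvP F ab).1 Fc; split => //.
  by move=> x; rewrite in_itv /= => /Fd [].
rewrite /iab /Rintegral (@continuous_FTC2 _ f F) // => x.
by rewrite in_itv /= => /Fd [_ <-]; rewrite derive1E.
Qed.

Lemma prim_continuous a b f : a <= b -> itg a b f ->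
  {within `[a, b], continuous (fun x => iab a x f)}.
Proof. exact: parameterized_integral_continuous. Qed.

Lemma prim_derive a b x f : a < x < b -> {within `[a, b], continuous f} ->
  is_derive x 1 (fun x => iab a x f) (f x).
Proof.
move=> /andP[ax xb] fc.
have xc : {for x, continuous f}.
  apply: (within_continuous_continuous (lt_trans ax xb) fc).
  by rewrite in_itv /= ax.
have [d1 d2] := @continuous_FTC1_closed _ f a x b xb (itg_continuous fc) ax xc.
by apply: DeriveDef; [exact: d1|rewrite -derive1E; exact: d2].
Qed.

Lemma mem_segment a b (x : R) : (x \in `[a, b]%classic) = (a <= x <= b).
Proof. by apply/idP/idP; rewrite inE /= in_itv. Qed.

Lemma integrable_triangle f g : mu.-integrable setT (EFin \o f) ->
  mu.-integrable setT (EFin \o g) ->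
  (mu \x mu)%E.-integrable setT
    (fun z : R * R => (f z.1 * (g z.2 * (if z.1 <= z.2 then 1 else 0)))%:E).
Proof.
move=> fi gi.
have mf : measurable_fun setT f by move: fi => /measurable_int /measurable_EFinP.
have mg : measurable_fun setT g by move: gi => /measurable_int /measurable_EFinP.
have mh : measurable_fun setT
    (fun z : R * R => f z.1 * (g z.2 * (if z.1 <= z.2 then 1 else 0))).
  apply: measurable_funM; first exact: (measurableT_comp mf measurable_fst).
  apply: measurable_funM; first exact: (measurableT_comp mg measurable_snd).
  apply: measurable_fun_ifT => //.
  by apply: measurable_fun_ler; [exact: measurable_fst|exact: measurable_snd].
apply/integrable12ltyP; first exact/measurable_EFinP.
have mh' : measurable_fun setT
    (fun z : R * R => `|(f z.1 * (g z.2 * (if z.1 <= z.2 then 1 else 0)))%:E|%E).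
  by apply: measurableT_comp => //; exact/measurable_EFinP.
pose C := (\int[mu]_y `|g y|%:E)%E.
have Cfin : (C < +oo)%E by move/integrableP: gi => [].
have C0 : (0 <= C)%E by apply: integral_ge0 => y _; rewrite lee_fin.
apply: (@le_lt_trans _ _ (\int[mu]_x (`|f x|%:E * C))%E).
  apply: ge0_le_integral => //.
  - by move=> x _; apply: integral_ge0.
  - exact: (@measurable_fun_fubini_tonelli_F _ _ _ _ R mu _ mh').
  - apply: emeasurable_funM => //.
    by apply/measurable_EFinP; exact: measurableT_comp.
  - move=> x _; rewrite -ge0_integralZl //; last first.
      by apply/measurable_EFinP; exact: measurableT_comp.
    apply: ge0_le_integral => //.
    + apply: (measurableT_comp mh'); exact: pair1_measurable.
    + apply: emeasurable_funM => //.
      by apply/measurable_EFinP; exact: measurableT_comp.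
    + move=> y _ /=; rewrite -EFinM lee_fin !normrM ler_wpM2l //.
      by case: ifP; rewrite ?normr1 ?mulr1 // normr0 mulr0.
rewrite ge0_integralZr //; last first.
  by apply/measurable_EFinP; exact: measurableT_comp.
move/integrableP: fi => [_ fi].
by rewrite lte_mul_pinfty // ?ge0_fin_numE // integral_ge0.
Qed.

(* Fubini for [f r * g s] over the triangle [r <= s]. *)
Lemma prim_parts a b f g : a <= b -> itg a b f -> itg a b g ->
  iab a b (fun t => iab a t f * g t) + iab a b (fun t => f t * iab a t g) =
  iab a b f * iab a b g.
Proof.
move=> ab fi gi.
pose f0 := f \_ `[a, b]; pose g0 := g \_ `[a, b].
have f0i : mu.-integrable setT (EFin \o f0).
  by rewrite /f0 -restrict_EFin; apply/integrable_restrict => //=; rewrite setTI.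
have g0i : mu.-integrable setT (EFin \o g0).
  by rewrite /g0 -restrict_EFin; apply/integrable_restrict => //=; rewrite setTI.
have := Fubini (integrable_triangle f0i g0i).
set lhs := (LHS in (LHS = _ -> _)); set rhs := (RHS in (_ = RHS -> _)).
have Gc := prim_continuous ab gi; have Fc := prim_continuous ab fi.
have itgE c d h : itg c d h -> (\int[mu]_(y in `[c, d]) (h y)%:E)%E = (iab c d h)%:E.
  by move=> hi; rewrite /iab /Rintegral fineK //; exact: integrable_fin_num.
have fGi : itg a b (fun t => f t * iab t b g).
  apply: (itg_ext (f := fun t => f t * (iab a b g - iab a t g))).
    move=> t; rewrite in_itv /= => /andP[at_ tb].
    by rewrite (iab_split at_ tb gi) addrC addKr.
  by apply: itgM_continuous => //; apply: within_sub => //; exact: within_const.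
have gFi : itg a b (fun t => iab a t f * g t).
  by apply: (itg_ext _ (itgM_continuous gi Fc)) => t _; rewrite mulrC.
have -> : lhs = (iab a b (fun t => f t * iab t b g))%:E.
  rewrite -itgE // integral_mkcond; apply: eq_integral => x _ /=.
  rewrite patchE; case: ifPn => [|xab]; last first.
    by under eq_integral do rewrite /f0 patchE (negbTE xab) mul0r; rewrite integral0.
  rewrite inE /= in_itv /= => /andP[ax xb].
  rewrite -iabZ; last exact: itgS gi.
  rewrite -itgE; last by apply: itgZ; exact: itgS gi.
  rewrite [RHS]integral_mkcond; apply: eq_integral => y _ /=.
  rewrite patchE /f0 /g0 !patchE !mem_segment ax xb /=.
  have [xy|_] := boolP (x <= y); last by rewrite !mulr0.
  by rewrite (le_trans ax xy) mulr1; case: ifP => // _; rewrite mulr0.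
have -> : rhs = (iab a b (fun t => iab a t f * g t))%:E.
  rewrite -itgE // integral_mkcond; apply: eq_integral => y _ /=.
  rewrite patchE; case: ifPn => [|yab]; last first.
    by under eq_integral do rewrite /g0 patchE (negbTE yab) mul0r mulr0; rewrite integral0.
  rewrite inE /= in_itv /= => /andP[ay yb].
  rewrite mulrC -iabZ; last exact: itgS fi.
  rewrite -itgE; last by apply: itgZ; exact: itgS fi.
  rewrite [RHS]integral_mkcond; apply: eq_integral => x _ /=.
  rewrite patchE /f0 /g0 !patchE !mem_segment ay yb /=.
  have [xy|_] := boolP (x <= y); last by rewrite andbF !mulr0.
  by rewrite (le_trans xy yb) !andbT mulr1; case: ifP => _; rewrite ?mul0r // mulrC.
move=> [<-].
rewrite -iabD //; last exact: itgM_continuous.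
rewrite mulrC -iabZ //; apply: eq_iab => t /andP[at_ tb].
by rewrite -mulrDr addrC -(iab_split at_ tb gi) mulrC.
Qed.

End Integration.

Section AlmostEverywhere.
Context {R : realType}.
Notation mu := (@lebesgue_measure R).
Implicit Types (f g F G : R -> R) (a b c t s x y : R).

Lemma near_itvoo a b (x : R) : a < x < b -> \forall t \near x, a < t < b.
Proof.
move=> /andP[ax xb].
near=> t; apply/andP; split; near: t; [exact: lt_nbhsr|exact: lt_nbhsl].
Unshelve. all: by end_near. Qed.

Lemma prim_derive_ae a b f : a <= b -> itg a b f ->
  {ae mu, forall x, a < x < b -> is_derive x 1 (fun t => iab a t f) (f x)}.
Proof.
move=> ab fi; pose f0 := f \_ `[a, b].
have f0i : mu.-integrable setT (EFin \o f0).
  by rewrite /f0 -restrict_EFin; apply/integrable_restrict => //=; rewrite setTI.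
have := @FTC1 R f0 (BLeft a).
case.
- by move=> y; apply: (integrableS _ _ _ f0i).
- exact: (open_integrable_locally openT f0i).
move=> N [mN N0 subN]; exists N; split => // x /= H.
apply: subN => /= H'; apply: H => /andP[ax xb].
have axE : (a%:E < x%:E)%E by rewrite lte_fin.
have [d1 d2] := H' axE.
have near_eq : \forall t \near x,
    \int[mu]_(s in `[a, t]) f0 s = iab a t f.
  have axb : a < x < b by rewrite ax.
  apply: filterS (near_itvoo axb) => t /andP[at_ tb].
  apply: eq_Rintegral => s; rewrite inE /= in_itv /= => /andP[as_ st].
  by rewrite /f0 patchE mem_segment as_ (le_trans st) // ltW.
have fx : f0 x = f x by rewrite /f0 patchE mem_segment !ltW.
apply: (near_eq_is_derive near_eq); rewrite -fx -d2.
by apply: DeriveDef; [exact: d1|rewrite derive1E].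
Qed.

Lemma prim_eq0_ae a b f : a <= b -> itg a b f ->
  (forall t, a <= t <= b -> iab a t f = 0) ->
  {ae mu, forall x, a < x < b -> f x = 0}.
Proof.
move=> ab fi F0; move: (prim_derive_ae ab fi).
apply: filterS; first exact: (ae_filter_ringOfSetsType mu).
move=> x H axb.
have near0 : \forall t \near x, iab a t f = 0.
  by apply: filterS (near_itvoo axb) => t /andP[at_ tb]; apply: F0; rewrite !ltW.
have [_ <-] := near_eq_is_derive near0 (H axb).
by have [_ ->] := is_derive_const 0 x.
Qed.

Lemma ae_eq_iab a b f g : itg a b f -> itg a b g ->
  {ae mu, forall x, a < x < b -> f x = g x} -> iab a b f = iab a b g.
Proof.
move=> fi gi fg; rewrite -!iab_oo // /Rintegral; congr fine.
apply: ae_eq_integral => //.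
- by apply: measurable_int; apply/itg_oo.
- by apply: measurable_int; apply/itg_oo.
- move: fg; apply: filterS; first exact: (ae_filter_ringOfSetsType mu).
  by move=> x H /=; rewrite in_itv /= => /H ->.
Qed.

End AlmostEverywhere.

Section Smooth.
Context {R : realType}.
Notation mu := (@lebesgue_measure R).
Implicit Types (f g F G : R -> R) (a b c t s x y : R).

Fixpoint Ck (k : nat) f : Prop :=
  if k is k'.+1 then
    exists2 df : R -> R, (forall t : R, is_derive t 1 f (df t)) & Ck k' df
  else True.

Lemma CkW k f : Ck k.+1 f -> Ck k f.
Proof.
elim: k f => // k IH f [df fd dfk]; exists df => //; exact: IH.
Qed.

Lemma CkD k f g : Ck k f -> Ck k g -> Ck k (fun t => f t + g t).
Proof.
elim: k f g => // k IH f g [df fd fk] [dg gd gk].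
by exists (fun t => df t + dg t); [move=> t; exact: is_derive_add|exact: IH].
Qed.

Lemma CkZ k f c : Ck k f -> Ck k (fun t => c * f t).
Proof.
elim: k f => // k IH f [df fd fk].
by exists (fun t => c * df t); [move=> t; exact: is_derive_cmul|exact: IH].
Qed.

Lemma CkM k f g : Ck k f -> Ck k g -> Ck k (fun t => f t * g t).
Proof.
elim: k f g => // k IH f g fk1 gk1.
have [df fd fk] := fk1; have [dg gd gk] := gk1.
exists (fun t => df t * g t + f t * dg t).
  by move=> t; exact: is_derive_mul.
by apply: CkD; apply: IH => //; exact: CkW.
Qed.

Lemma Ck_affine k f a b : Ck k f -> Ck k (fun t => f (a * t + b)).
Proof.
elim: k f => // k IH f [df fd fk].
exists (fun t => a * df (a * t + b)); last exact/CkZ/IH.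
by move=> t; rewrite mulrC; apply: (is_derive_comp (fd _) (is_derive_affine a b t)).
Qed.

Lemma Ck_derivable f : (forall k, Ck k f) -> forall n (t : R), derivable (derive1n n f) t 1.
Proof.
move=> fk n; have {fk} := fk n.+1.
elim: n f => [|n IH] f [df fd dfk] t; first by rewrite derive1n0; case: (fd t).
rewrite derive1Sn (_ : f^`()%classic = df); first exact: IH.
by apply/funext => s; rewrite derive1E; case: (fd s).
Qed.

Definition flat_exp (n : nat) (t : R) : R :=
  if 0 < t then t ^- n * expR (- t^-1) else 0.

Lemma flat_exp_le n t : 0 < t -> `|flat_exp n t| <= n.+1`!%:R * t.
Proof.
move=> t0; rewrite /flat_exp t0 expRN ger0_norm; last first.
  by rewrite mulr_ge0 ?invr_ge0 ?exprn_ge0 ?expR_ge0 ?ltW.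
rewrite ler_pdivrMr ?expR_gt0 //.
have ti0 : 0 <= t^-1 by rewrite invr_ge0 ltW.
have H : t^-1 ^+ n.+1 <= n.+1`!%:R * expR t^-1.
  have := expR_ge1Dxn n ti0 => H.
  rewrite -ler_pdivrMl ?ltr0n ?fact_gt0 // mulrC.
  by apply: le_trans H; rewrite lerDr.
rewrite mulrAC -[leLHS]mulr1 -[X in _ * X](mulVf (lt0r_neq0 t0)) mulrA.
by apply: ler_wpM2r; [exact: ltW|rewrite -exprVn -exprSr].
Qed.

Lemma is_derive_flat_exp n (t : R) :
  is_derive t 1 (flat_exp n) (flat_exp n.+2 t - n%:R * flat_exp n.+1 t).
Proof.
have pos (s : R) : 0 < s ->
    is_derive s 1 (flat_exp n) (flat_exp n.+2 s - n%:R * flat_exp n.+1 s).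
  move=> s0; have sN0 : s != 0 by rewrite gt_eqF.
  have near_eq : \forall x \near s, x ^- n * expR (- x^-1) = flat_exp n x.
    have : 0 < s < s + 1 by rewrite s0 ltrDl ltr01.
    by move=> /near_itvoo; apply: filterS => x /andP[x0 _]; rewrite /flat_exp x0.
  apply: (near_eq_is_derive near_eq).
  have D1 : is_derive s 1 (fun x : R => x ^+ n) (n%:R * s ^+ n.-1).
    by apply: (is_derive_eq (is_derive_pow n (is_derive_id s 1))); rewrite mulr1.
  have D2 := @is_derive_inv R (fun x => x ^+ n) s _ (expf_neq0 n sN0) D1.
  have D3 := is_derive_comp (is_derive_expR _)
    (is_derive_opp (is_derive_inv sN0 (is_derive_id s 1))).
  apply: (is_derive_eq (is_derive_mul D2 D3)).
  rewrite /flat_exp s0; case: n {near_eq D1 D2} => [|n] /=.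
    by rewrite !expr0 !expr2; field.
  by rewrite !exprS; field; rewrite expf_neq0.
have neg (s : R) : s < 0 ->
    is_derive s 1 (flat_exp n) (flat_exp n.+2 s - n%:R * flat_exp n.+1 s).
  move=> s0; have near_eq : \forall x \near s, 0 = flat_exp n x.
    have : s - 1 < s < 0 by rewrite s0 andbT gtrBl ltr01.
    move=> /near_itvoo; apply: filterS => x /andP[_ x0].
    by rewrite /flat_exp ltNge ltW.
  apply: (near_eq_is_derive near_eq).
  rewrite /flat_exp ltNge ltW //= mulr0 subr0; exact: is_derive_const.
have cont0 m : {for 0, continuous (flat_exp m)}.
  have f0 : flat_exp m 0 = 0 by rewrite /flat_exp ltxx.
  apply/cvgrPdist_lt => e e0; apply/nbhs_ballP.
  exists (e / m.+1`!%:R); first by rewrite /= divr_gt0 ?ltr0n ?fact_gt0.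
  move=> x; rewrite /ball /= sub0r normrN f0 sub0r normrN => xe.
  have [x0|x0] := ltP 0 x; last by rewrite /flat_exp [0 < x]ltNge x0 normr0.
  apply: (le_lt_trans (flat_exp_le m x0)).
  move: xe; rewrite gtr0_norm // ltr_pdivlMr ?ltr0n ?fact_gt0 //.
  by rewrite mulrC.
have [->|tN0] := eqVneq t 0; last by move: tN0; case: ltgtP => // [/neg|/pos].
apply: (is_derive_extend (f := flat_exp n) (e := 1)
  (g := fun t => flat_exp n.+2 t - n%:R * flat_exp n.+1 t)) => //.
  by move=> s _; case: ltgtP => // [/neg|/pos].
by apply: cvgB; [exact: cont0|apply: cvgM; [exact: cvg_cst|exact: cont0]].
Qed.

Lemma Ck_flat_exp k n : Ck k (flat_exp n).
Proof.
elim: k n => // k IH n; exists (fun t => flat_exp n.+2 t + (- n%:R) * flat_exp n.+1 t).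
  by move=> t; rewrite mulNr; exact: is_derive_flat_exp.
by apply: CkD => //; exact: CkZ.
Qed.

Definition bump (t : R) : R := flat_exp 0 t * flat_exp 0 (1 - t).

Lemma Ck_bump k : Ck k bump.
Proof.
apply: CkM; first exact: Ck_flat_exp.
have := Ck_affine (-1) 1 (Ck_flat_exp k 0).
by under [X in Ck _ X -> _]eq_fun do rewrite mulN1r addrC.
Qed.

Lemma bump_gt0 t : 0 < t < 1 -> 0 < bump t.
Proof.
move=> /andP[t0 t1]; rewrite /bump /flat_exp t0 subr_gt0 t1 !expr0 !invr1 !mul1r.
by rewrite mulr_gt0 ?expR_gt0.
Qed.

Lemma bump_ge0 t : 0 <= bump t.
Proof.
by rewrite /bump /flat_exp mulr_ge0 //; case: ifP => // _;
  rewrite expr0 invr1 mul1r expR_ge0.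
Qed.

Lemma bump_out t : ~~ (0 < t < 1) -> bump t = 0.
Proof.
rewrite negb_and -!leNgt /bump /flat_exp => /orP[] H.
  by rewrite ltNge H mul0r.
by rewrite [0 < 1 - t]subr_gt0 [t < 1]ltNge H mulr0.
Qed.

Lemma continuous_bump : continuous bump.
Proof. by move=> t; have [df /(_ t)/is_derive_cont] := Ck_bump 1. Qed.

Definition bump_prim t := iab (-1) t bump.

Lemma bump_prim_neg t : t <= 0 -> bump_prim t = 0.
Proof.
move=> t0; rewrite /bump_prim (@eq_iab _ _ _ _ (fun=> 0)).
  by rewrite /iab Rintegral_cst // mul0r.
move=> x /andP[_ xt]; apply: bump_out.
by rewrite negb_and -leNgt (le_trans xt t0).
Qed.

Lemma is_derive_bump_prim t : is_derive t 1 bump_prim (bump t).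
Proof.
have [t0|t0] := ltP t 0.
  have near_eq : \forall x \near t, 0 = bump_prim x.
    have : t - 1 < t < 0 by rewrite t0 andbT gtrBl ltr01.
    by move=> /near_itvoo; apply: filterS => x /andP[_ x0]; rewrite bump_prim_neg ?ltW.
  apply: (near_eq_is_derive near_eq); rewrite bump_out ?ltNge ?(ltW t0) //.
  exact: is_derive_const.
apply: (@prim_derive _ (-1) (t + 1)); last exact/continuous_subspaceT/continuous_bump.
by rewrite ltrDl ltr01 andbT (lt_le_trans _ t0) // ltrN10.
Qed.

Lemma bump_prim_le x y : x <= y -> bump_prim x <= bump_prim y.
Proof.
by move=> xy; apply: is_derive_le xy (fun t _ => is_derive_bump_prim t) _ => t _; exact: bump_ge0.
Qed.

Lemma bump_prim1_gt0 : 0 < bump_prim 1.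
Proof.
have H : bump_prim (1/4) < bump_prim (1/2).
  apply: (is_derive_lt (df := bump)) => [|t _|t /andP[t1 t2]].
  - lra.
  - exact: is_derive_bump_prim.
  - by apply: bump_gt0; lra.
have H0 : bump_prim 0 <= bump_prim (1/4) by apply: bump_prim_le; lra.
have H1 : bump_prim (1/2) <= bump_prim 1 by apply: bump_prim_le; lra.
by rewrite bump_prim_neg // in H0; lra.
Qed.

Lemma bump_prim_1 t : 1 <= t -> bump_prim t = bump_prim 1.
Proof.
move=> t1; have := @gronwall0 R (fun x => bump_prim x - bump_prim 1) bump 0 1 t t1.
case.
- by move=> x _; apply: (is_derive_eq (is_derive_sub (is_derive_bump_prim x)
    (is_derive_const (bump_prim 1) x))); rewrite subr0.
- move=> x /andP[x1 _]; rewrite bump_out ?normr0 ?mul0r //.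
  by rewrite negb_and -!leNgt x1 orbT.
by move=> /(_ (subrr _)) /eqP; rewrite subr_eq0 => /eqP.
Qed.

Definition step (t : R) : R := (bump_prim 1)^-1 * bump_prim t.
Definition dstep (t : R) : R := (bump_prim 1)^-1 * bump t.

Lemma is_derive_step t : is_derive t 1 step (dstep t).
Proof. exact: is_derive_cmul (is_derive_bump_prim t). Qed.

Lemma step_neg t : t <= 0 -> step t = 0.
Proof. by move=> t0; rewrite /step [bump_prim t]bump_prim_neg // mulr0. Qed.

Lemma step_ge1 t : 1 <= t -> step t = 1.
Proof. by move=> t1; rewrite /step [bump_prim t]bump_prim_1 // mulVf // gt_eqF // bump_prim1_gt0. Qed.

Lemma dstep_ge0 t : 0 <= dstep t.
Proof. by rewrite mulr_ge0 ?bump_ge0 // invr_ge0 ltW // bump_prim1_gt0. Qed.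

Lemma dstep_out t : ~~ (0 < t < 1) -> dstep t = 0.
Proof. by move=> /bump_out; rewrite /dstep => ->; rewrite mulr0. Qed.

Lemma Ck_step k : Ck k step.
Proof.
case: k => // k; exists dstep; first exact: is_derive_step.
exact/CkZ/Ck_bump.
Qed.

Lemma continuous_dstep : continuous dstep.
Proof. by move=> t; apply: cvgM; [exact: cvg_cst|exact: continuous_bump]. Qed.

Lemma step_mass (L a e : R) (H : R -> R) (w : R) : 0 < e -> 0 <= a -> a + e <= L ->
  {within `[0, L], continuous H} ->
  (forall t, a <= t <= a + e -> `|H t - H a| <= w) ->
  `|iab 0 L (fun t => H t * (e^-1 * dstep (e^-1 * t + (- (e^-1 * a))))) - H a| <= w.
Proof.
move=> e0 a0 aeL Hc Hw.
have L0 : 0 <= L by rewrite (le_trans _ aeL) // addr_ge0 // ltW.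
set dphi := fun t => e^-1 * dstep (e^-1 * t + (- (e^-1 * a))).
have Dphi t : is_derive t 1 (fun t => step (e^-1 * t + (- (e^-1 * a)))) (dphi t).
  apply: (is_derive_eq (is_derive_comp (is_derive_step _)
    (is_derive_affine e^-1 (- (e^-1 * a)) t))).
  by rewrite mulrC.
have cphi : continuous dphi.
  apply: continuous_mul; first exact: continuous_const.
  apply: continuous_compose continuous_dstep.
  exact: is_derive_continuous (is_derive_affine _ _).
have phi_ge0 t : 0 <= dphi t by rewrite mulr_ge0 ?dstep_ge0 // invr_ge0 ltW.
have argE t : e^-1 * t + - (e^-1 * a) = (t - a) / e by field; rewrite gt_eqF.
have phi_out t : ~~ (a <= t <= a + e) -> dphi t = 0.
  move=> H1; rewrite /dphi dstep_out ?mulr0 // argE.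
  apply: contra H1 => /andP[].
  rewrite pmulr_lgt0 ?invr_gt0 // ltr_pdivrMr // mul1r; lra.
have idphi : itg 0 L dphi by exact: continuous_itg.
have mass1 : iab 0 L dphi = 1.
  rewrite (@ftc _ 0 L dphi (fun t => step (e^-1 * t + (- (e^-1 * a))))) //.
  - rewrite !argE step_ge1 ?step_neg ?subr0 //.
      by rewrite pmulr_lle0 ?invr_gt0 // sub0r oppr_le0.
    by rewrite ler_pdivlMr // mul1r; lra.
  - exact: continuous_subspaceT.
  - apply: continuous_subspaceT => t; exact: is_derive_cont (Dphi t).
have ic : itg 0 L (fun t => (H t - H a) * dphi t).
  apply: itgM_continuous; last exact: continuous_subspaceT.
  apply: itgB; first exact: itg_continuous.
  exact/continuous_itg/cst_continuous.
have -> : iab 0 L (fun t => H t * dphi t) - H a =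
          iab 0 L (fun t => (H t - H a) * dphi t).
  rewrite -[X in _ - X]mulr1 -[in LHS]mass1 -iabZ //.
  rewrite -iabB; last exact: itgZ.
    by apply: eq_iab => t _; rewrite mulrBl.
  by apply: itgM_continuous; [exact: itg_continuous|exact: continuous_subspaceT].
apply: (le_trans (le_norm_iab ic)); rewrite -[w]mulr1 -mass1 -iabZ //.
apply: le_iab; [exact: integrable_norm ic|exact: itgZ|].
move=> t _; rewrite normrM (ger0_norm (phi_ge0 t)).
have [tin|/phi_out ->] := boolP (a <= t <= a + e); last by rewrite !mulr0.
by apply: ler_wpM2r => //; exact: Hw.
Qed.

Lemma du_bois_reymond (L : R) (H : R -> R) : {within `[0, L], continuous H} ->
  (forall phi, test_function L phi -> iab 0 L (fun t => H t * derive1 phi t) = 0) ->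
  forall a b, 0 < a -> a < b -> b < L -> H a = H b.
Proof.
move=> Hc Hphi a b a0 ab bL; apply/eqP; rewrite -subr_eq0 -normr_le0.
apply/ler_addgt0Pl => w w0; rewrite addr0.
have Hca x : 0 < x -> x < L ->
    exists2 e : R, 0 < e & forall t, x <= t <= x + e -> `|H t - H x| <= w / 2.
  move=> x0 xL; have xc : {for x, continuous H}.
    apply: (within_continuous_continuous (lt_trans x0 xL) Hc).
    by rewrite in_itv /= x0.
  have w2 : 0 < w / 2 by rewrite divr_gt0.
  have /cvgrPdist_le /(_ _ w2) /nbhs_ballP [d /= d0 Hd] := xc.
  exists (d / 2); first by rewrite divr_gt0.
  move=> t /andP[xt tx]; rewrite distrC; apply: Hd; rewrite /ball /= ltr_norml.
  by apply/andP; split; lra.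
have b0 : 0 < b by exact: lt_trans ab.
have [e1 e10 H1] := Hca a a0 (lt_trans ab bL).
have [e2 e20 H2] := Hca b b0 bL.
pose e := Num.min (Num.min e1 e2) ((L - b) / 2).
have e0 : 0 < e by rewrite !lt_min e10 e20 divr_gt0 ?subr_gt0.
have [ee1 ee2 eLb] : [/\ e <= e1, e <= e2 & e <= (L - b) / 2].
  by split; rewrite /e !ge_min ?lexx ?orbT.
have {}H1 t : a <= t <= a + e -> `|H t - H a| <= w / 2.
  by move=> /andP[at_ ta]; apply: H1; rewrite at_; lra.
have {}H2 t : b <= t <= b + e -> `|H t - H b| <= w / 2.
  by move=> /andP[at_ ta]; apply: H2; rewrite at_; lra.
have aeL : a + e <= L by lra.
have beL : b + e <= L by lra.
have Ma := step_mass e0 (ltW a0) aeL Hc H1.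
have Mb := step_mass e0 (ltW b0) beL Hc H2.
pose st (x : R) t := step (e^-1 * t + - (e^-1 * x)).
pose dst (x : R) t := e^-1 * dstep (e^-1 * t + - (e^-1 * x)).
have Dst x t : is_derive t 1 (st x) (dst x t).
  apply: (is_derive_eq (is_derive_comp (is_derive_step _)
    (is_derive_affine e^-1 (- (e^-1 * x)) t))).
  by rewrite mulrC.
have cdst x : continuous (dst x).
  apply: continuous_mul; first exact: continuous_const.
  apply: continuous_compose continuous_dstep.
  exact: is_derive_continuous (is_derive_affine _ _).
pose phi t := st a t - st b t.
have Dphi t : is_derive t 1 phi (dst a t - dst b t) by exact: is_derive_sub.
have argE x t : e^-1 * t + - (e^-1 * x) = (t - x) / e by field; rewrite gt_eqF.
have tphi : test_function L phi.
  split.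
    apply: Ck_derivable => k; rewrite /phi /st.
    have := CkD (Ck_affine e^-1 (- (e^-1 * a)) (Ck_step k))
      (CkZ (-1) (Ck_affine e^-1 (- (e^-1 * b)) (Ck_step k))).
    by under [X in Ck _ X -> _]eq_fun do rewrite mulN1r.
  exists a, (b + e); split => //; first by lra.
  move=> t tout; rewrite /phi /st !argE.
  have [ta|at_] := ltP t a.
    by rewrite !step_neg ?subrr // pmulr_lle0 ?invr_gt0 // subr_le0 ltW // (lt_trans ta).
  have tbe : b + e < t by rewrite ltNge; apply/negP => tbe; apply: tout; rewrite at_.
  by rewrite !step_ge1 ?subrr // ler_pdivlMr // mul1r; lra.
have := Hphi phi tphi.
have -> : derive1 phi = fun t => dst a t - dst b t.
  by apply/funext => t; rewrite derive1E; case: (Dphi t).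
rewrite (@eq_iab _ _ _ _ (fun t => H t * dst a t - H t * dst b t)); last first.
  by move=> t _; rewrite mulrBr.
have Hi x : itg 0 L (fun t => H t * dst x t).
  by apply: itgM_continuous; [exact: itg_continuous|exact/continuous_subspaceT].
rewrite iabB // => /eqP; rewrite subr_eq0 => /eqP E.
move: Ma Mb; rewrite -/(dst a) -/(dst b) E.
set I := iab _ _ _ => Ma Mb.
have -> : H a - H b = (I - H b) - (I - H a) by ring.
by apply: (le_trans (ler_normB _ _)); rewrite [leRHS](splitr w) lerD.
Qed.

Lemma test_function_continuous (L : R) phi : test_function L phi ->
  continuous phi /\ continuous (derive1 phi).
Proof.
move=> [phid _]; have D n t : is_derive t 1 (derive1n n phi) (derive1n n.+1 phi t).
  by apply: DeriveDef; [exact: phid|rewrite derive1nS derive1E].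
by split=> t; [exact: is_derive_cont (D 0%N t)|exact: is_derive_cont (D 1%N t)].
Qed.

Lemma test_function_prim (L : R) phi : test_function L phi ->
  [/\ phi 0 = 0, phi L = 0 & forall t, 0 <= t -> iab 0 t (derive1 phi) = phi t].
Proof.
move=> tphi; have [cphi cdphi] := test_function_continuous tphi.
have [phid [a [b [a0 bL phi0]]]] := tphi.
have p0 : phi 0 = 0 by apply: phi0 => /andP[]; rewrite leNgt a0.
split=> //; first by apply: phi0 => /andP[_]; rewrite leNgt bL.
have D x : is_derive x 1 phi (derive1 phi x).
  by apply: DeriveDef; [exact: (phid 0%N)|rewrite derive1E].
move=> t t0; have := ftc t0 (continuous_subspaceT cdphi) (continuous_subspaceT cphi)
  (fun x _ => D x).
by rewrite p0 subr0.
Qed.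

Lemma weak_derivative_parts (L : R) f g phi : 0 <= L ->
  {within `[0, L], continuous f} -> itg 0 L g -> test_function L phi ->
  (\int[mu]_(t in `]0, L[) (f t * derive1 phi t) = iab 0 L (fun t => f t * derive1 phi t))
  /\ (\int[mu]_(t in `]0, L[) (g t * phi t) = iab 0 L (fun t => g t * phi t)).
Proof.
move=> L0 fc gi tphi; have [cphi cdphi] := test_function_continuous tphi.
split; apply: iab_oo; apply: itgM_continuous => //; try exact: continuous_subspaceT.
exact: itg_continuous.
Qed.

Lemma prim_weak_derivative (L : R) F f (c : R) : 0 <= L -> itg 0 L f ->
  (forall t, 0 <= t <= L -> F t = c + iab 0 t f) -> weak_derivative L F f.
Proof.
move=> L0 fi FE phi tphi.
have [cphi cdphi] := test_function_continuous tphi.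
have [phi0 phiL phiE] := test_function_prim tphi.
have Pc := prim_continuous L0 fi.
have Fc : {within `[0, L], continuous (fun t => c + iab 0 t f)}.
  by apply: within_add => //; exact: within_const.
have idphi : itg 0 L (derive1 phi) by exact: continuous_itg.
have [E1 E2] := weak_derivative_parts L0 Fc fi tphi.
transitivity (\int[mu]_(t in `]0, L[) ((c + iab 0 t f) * derive1 phi t)).
  apply: eq_Rintegral => x; rewrite inE /= in_itv /= => /andP[x0 xL].
  by rewrite FE // !ltW.
rewrite E1 E2 (@eq_iab _ _ _ _ (fun t => c * derive1 phi t + iab 0 t f * derive1 phi t)); last first.
  by move=> t _; rewrite mulrDl.
have i1 : itg 0 L (fun t => iab 0 t f * derive1 phi t).
  by apply: itgM_continuous; [exact: itg_continuous|exact: continuous_subspaceT].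
rewrite iabD ?iabZ //; last exact: itgZ.
rewrite phiE // phiL mulr0 add0r; apply/eqP; rewrite -addr_eq0; apply/eqP.
have := prim_parts L0 fi idphi; rewrite (phiE L L0) phiL mulr0; apply: etrans.
by congr (_ + _); apply: eq_iab => t /andP[t0 _]; rewrite phiE.
Qed.

Lemma weak_derivative_prim (L : R) F f : 0 < L -> {within `[0, L], continuous F} ->
  itg 0 L f -> weak_derivative L F f ->
  forall t, 0 <= t <= L -> F t = F 0 + iab 0 t f.
Proof.
move=> L0 Fc fi wF.
have Pc := prim_continuous (ltW L0) fi.
pose H t := F t - iab 0 t f.
have Hc : {within `[0, L], continuous H} by exact: within_sub.
have Hdbr phi : test_function L phi -> iab 0 L (fun t => H t * derive1 phi t) = 0.
  move=> tphi; have [cphi cdphi] := test_function_continuous tphi.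
  have wP := @prim_weak_derivative L (fun t => iab 0 t f) f 0 (ltW L0) fi _ phi tphi.
  have [E1 E2] := weak_derivative_parts (ltW L0) Fc fi tphi.
  have [E3 _] := weak_derivative_parts (ltW L0) Pc fi tphi.
  have := wF phi tphi; rewrite E1 E2 => E4.
  have : iab 0 L (fun t => iab 0 t f * derive1 phi t) = - iab 0 L (fun t => f t * phi t).
    by rewrite -E3 -E2; apply: wP => t _; rewrite add0r.
  rewrite -E4 => E5; rewrite (@eq_iab _ _ _ _
    (fun t => F t * derive1 phi t - iab 0 t f * derive1 phi t)); last first.
    by move=> t _; rewrite mulrBl.
  rewrite iabB ?E5 ?subrr //; apply: itgM_continuous; try exact: continuous_subspaceT.
    exact: itg_continuous.
  exact: itg_continuous.
have Hoo := du_bois_reymond Hc Hdbr.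
have [Hin H0 HL] := (continuous_within_itvP H L0).1 Hc.
have mid : 0 < L / 2 < L by lra.
have Hmid t : 0 < t < L -> H t = H (L / 2).
  move=> /andP[t0 tL]; have /andP[m0 mL] := mid.
  by case: (ltgtP t (L / 2)) => [tm|mt|->//]; [apply: Hoo|apply/esym; apply: Hoo].
have H0E : H 0 = H (L / 2).
  suff Hm : H x @[x --> 0^'+] --> H (L / 2).
    by rewrite -(cvg_lim (@Rhausdorff R) H0) (cvg_lim (@Rhausdorff R) Hm).
  apply: cvg_near_cst; near=> t; apply: Hmid; apply/andP; split.
    by near: t; exact: nbhs_right_gt.
  by near: t; exact: nbhs_right_lt.
have HLE : H L = H (L / 2).
  suff Hm : H x @[x --> L^'-] --> H (L / 2).
    by rewrite -(cvg_lim (@Rhausdorff R) HL) (cvg_lim (@Rhausdorff R) Hm).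
  apply: cvg_near_cst; near=> t; apply: Hmid; apply/andP; split.
    by near: t; exact: nbhs_left_gt.
  by near: t; exact: nbhs_left_lt.
move=> t /andP[t0 tL].
have HtE : H t = H (L / 2).
  move: t0; rewrite le_eqVlt => /predU1P[<-//|t0].
  move: tL; rewrite le_eqVlt => /predU1P[->//|tL].
  by apply: Hmid; rewrite t0.
have : H t = H 0 by rewrite HtE H0E.
rewrite /H iab_point subr0 => <-; by rewrite subrK.
Unshelve. all: by end_near. Qed.

End Smooth.

Section PointwiseVariation.
Context {R : realType}.
Variables (p u v a b eta zeta e0 e1 M : R).
Hypotheses (p1 : 1 < p) (uv1 : u ^+ 2 + v ^+ 2 = 1).
Hypotheses (e0le : `|e0| <= 1) (e1le : `|e1| <= 1).
Hypotheses (M1 : 1 <= M) (etaM : `|eta| <= M) (zetaM : `|zeta| <= M).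

Definition var_u (s : R) := u + s * (eta * e0).
Definition var_v (s : R) := v + s * (eta * e1).
Definition var_a (s : R) := a + s * (zeta * e0).
Definition var_b (s : R) := b + s * (zeta * e1).
Definition var_det (s : R) := var_u s * var_b s - var_v s * var_a s.
Definition var_ddet : R := eta * (e0 * b - e1 * a) + zeta * (u * e1 - v * e0).
Definition var_speed (s : R) := Num.sqrt (var_u s ^+ 2 + var_v s ^+ 2).
Definition var_dspeed (s : R) :=
  (var_u s * (eta * e0) + var_v s * (eta * e1)) / var_speed s.
Definition var_curv (s : R) := var_det s / var_speed s ^+ 3.
Definition var_dcurv (s : R) :=
  (var_ddet * var_speed s - 3 * var_det s * var_dspeed s) / var_speed s ^+ 4.
Definition var_bending (s : R) := `|var_curv s| `^ p * var_speed s.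
Definition var_dbending (s : R) :=
  p * sgp (p - 1) (var_curv s) * var_dcurv s * var_speed s +
  `|var_curv s| `^ p * var_dspeed s.

Lemma var_detE s : var_det s = u * b - v * a + s * var_ddet.
Proof. by rewrite /var_det /var_ddet /var_u /var_v /var_a /var_b; ring. Qed.

Lemma is_derive_speed s : 0 < var_u s ^+ 2 + var_v s ^+ 2 ->
  is_derive s 1 var_speed (var_dspeed s).
Proof.
move=> n0; have Du : is_derive s 1 var_u (eta * e0).
  apply: (is_derive_eq (is_derive_add (is_derive_const u s)
    (is_derive_mul (is_derive_id s 1) (is_derive_const (eta * e0) s)))).
  by ring.
have Dv : is_derive s 1 var_v (eta * e1).
  apply: (is_derive_eq (is_derive_add (is_derive_const v s)
    (is_derive_mul (is_derive_id s 1) (is_derive_const (eta * e1) s)))).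
  by ring.
have Ds := is_derive_add (is_derive_pow 2 Du) (is_derive_pow 2 Dv).
apply: (is_derive_eq (@is_derive_comp R Num.sqrt
  (fun t => var_u t ^+ 2 + var_v t ^+ 2) s _ _ (is_derive1_sqrt n0) Ds)).
by rewrite /var_dspeed /var_speed; field; rewrite gt_eqF // sqrtr_gt0.
Qed.

Lemma is_derive_var_bending s : 0 < var_u s ^+ 2 + var_v s ^+ 2 ->
  is_derive s 1 var_bending (var_dbending s).
Proof.
move=> n0; have nN0 : var_speed s != 0 by rewrite gt_eqF // sqrtr_gt0.
have Dn := is_derive_speed n0.
have Dd : is_derive s 1 var_det var_ddet.
  rewrite (_ : var_det = fun s => u * b - v * a + s * var_ddet); last first.
    by apply/funext => r; rewrite var_detE.
  apply: (is_derive_eq (is_derive_add (is_derive_const _ s)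
    (is_derive_mul (is_derive_id s 1) (is_derive_const var_ddet s)))).
  by ring.
have Dq : is_derive s 1 var_curv (var_dcurv s).
  have n3 : var_speed s ^+ 3 != 0 by rewrite expf_neq0.
  apply: (is_derive_eq (@is_derive_div R var_det (fun t => var_speed t ^+ 3) s _ _
    n3 Dd (is_derive_pow 3 Dn))).
  by rewrite /var_dcurv; field.
exact: (is_derive_mul (is_derive_comp (is_derive_normp _ p1) Dq) Dn).
Qed.

Hypothesis (s : R).
Hypothesis (sM : `|s| * M <= 1 / 8).

Lemma uv_le1 : `|u| <= 1 /\ `|v| <= 1.
Proof.
have u0 := sqr_ge0 u; have v0 := sqr_ge0 v.
split; rewrite -(@expr_le1 _ 2) // -normrX ger0_norm //.
all: by rewrite -uv1 ?lerDl ?lerDr.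
Qed.

Lemma var_pert_le (e : R) : `|e| <= 1 -> `|s * (eta * e)| <= 1 / 8.
Proof.
move=> e1'; rewrite !normrM; apply: le_trans sM; apply: ler_wpM2l => //.
by rewrite -[leRHS]mulr1 ler_pM.
Qed.

Lemma var_speed_bounds : 1 / 2 <= var_speed s <= 2.
Proof.
have [u1 v1] := uv_le1.
have := var_pert_le e0le; have := var_pert_le e1le.
rewrite /var_speed /var_u /var_v.
set x := s * (eta * e0); set y := s * (eta * e1).
rewrite !ler_norml in u1 v1 *; move=> /andP[y1 y2] /andP[x1 x2].
move/andP: u1 => [u1 u2]; move/andP: v1 => [v1 v2].
have H : 1 / 4 <= (u + x) ^+ 2 + (v + y) ^+ 2 <= 4.
  have -> : (u + x) ^+ 2 + (v + y) ^+ 2 =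
            (u ^+ 2 + v ^+ 2) + 2 * (u * x) + 2 * (v * y) + x ^+ 2 + y ^+ 2 by ring.
  rewrite uv1.
  have ux : `|u * x| <= 1 / 8.
    by rewrite normrM -[leRHS]mul1r ler_pM // ler_norml ?u1 ?x1.
  have vy : `|v * y| <= 1 / 8.
    by rewrite normrM -[leRHS]mul1r ler_pM // ler_norml ?v1 ?y1.
  have xx : `|x ^+ 2| <= 1 / 8.
    rewrite expr2 normrM -[leRHS]mul1r ler_pM // ler_norml ?x1 //.
    by apply/andP; split; lra.
  have yy : `|y ^+ 2| <= 1 / 8.
    rewrite expr2 normrM -[leRHS]mul1r ler_pM // ler_norml ?y1 //.
    by apply/andP; split; lra.
  rewrite ger0_norm ?sqr_ge0 // in xx; rewrite ger0_norm ?sqr_ge0 // in yy.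
  have x20 := sqr_ge0 x; have y20 := sqr_ge0 y.
  move: ux vy; rewrite !ler_norml => /andP[? ?] /andP[? ?].
  by apply/andP; split; lra.
move/andP: H => [H1 H2]; apply/andP; split.
  rewrite -[leLHS]ger0_norm ?divr_ge0 // -sqrtr_sqr ler_wsqrtr //.
  by apply: le_trans H1; rewrite le_eqVlt; apply/orP; left; apply/eqP; field.
rewrite -[leRHS]ger0_norm // -sqrtr_sqr ler_wsqrtr //.
by apply: (le_trans H2); rewrite le_eqVlt; apply/orP; left; apply/eqP; ring.
Qed.

Lemma var_speed2_gt0 : 0 < var_u s ^+ 2 + var_v s ^+ 2.
Proof. by rewrite -sqrtr_gt0; have /andP[H _] := var_speed_bounds; apply: lt_le_trans H; lra. Qed.

Let A : R := `|a| + `|b| + 2.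

Lemma var_ddet_le : `|var_ddet| <= M * A.
Proof.
have [u1 v1] := uv_le1; rewrite /var_ddet /A.
have h1 : `|e0 * b - e1 * a| <= `|a| + `|b|.
  rewrite (le_trans (ler_normB _ _)) // !normrM addrC lerD //.
    by rewrite -[leRHS]mul1r ler_wpM2r.
  by rewrite -[leRHS]mul1r ler_wpM2r.
have h2 : `|u * e1 - v * e0| <= 2.
  rewrite (le_trans (ler_normB _ _)) // !normrM -[leRHS]/(1 + 1) lerD //.
    by rewrite -[leRHS]mulr1 ler_pM.
  by rewrite -[leRHS]mulr1 ler_pM.
by rewrite [leRHS]mulrDr (le_trans (ler_normD _ _)) // !normrM lerD // ler_pM.
Qed.

Lemma var_det_le : `|var_det s| <= 2 * A.
Proof.
have [u1 v1] := uv_le1; rewrite var_detE mulr_natl mulr2n.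
rewrite (le_trans (ler_normD _ _)) // lerD //.
  rewrite /A (le_trans (ler_normB _ _)) // !normrM.
  have : `|u| * `|b| <= `|b| by rewrite -[leRHS]mul1r ler_wpM2r.
  have : `|v| * `|a| <= `|a| by rewrite -[leRHS]mul1r ler_wpM2r.
  lra.
rewrite normrM; apply: le_trans (_ : `|s| * (M * A) <= _).
  by apply: ler_wpM2l => //; exact: var_ddet_le.
rewrite mulrA; have A0 : 0 <= A by rewrite !addr_ge0.
by rewrite -[leRHS]mul1r ler_wpM2r // (le_trans sM) //; lra.
Qed.

Lemma var_dspeed_le : `|var_dspeed s| <= 8 * M.
Proof.
have [u1 v1] := uv_le1; have /andP[n1 n2] := var_speed_bounds.
have n0 : 0 < var_speed s by apply: lt_le_trans n1; lra.
rewrite /var_dspeed normrM normrV ?unitfE ?gt_eqF // (gtr0_norm n0).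
rewrite ler_pdivrMr //; apply: le_trans (_ : 4 * M <= _); last first.
  have : 0 < M by exact: lt_le_trans M1.
  nra.
have U2 (x y e : R) : `|x| <= 1 -> `|e| <= 1 -> `|y| <= 1 / 8 ->
    `|(x + y) * (eta * e)| <= 2 * M.
  move=> x1 e1' y8; rewrite normrM ler_pM //.
    by rewrite (le_trans (ler_normD _ _)) //; lra.
  by rewrite normrM -[leRHS]mulr1 ler_pM.
have h0 := U2 u (s * (eta * e0)) e0 u1 e0le (var_pert_le e0le).
have h1 := U2 v (s * (eta * e1)) e1 v1 e1le (var_pert_le e1le).
rewrite (le_trans (ler_normD _ _)) // /var_u /var_v; lra.
Qed.

Lemma var_curv_le : `|var_curv s| <= 16 * A.
Proof.
have /andP[n1 n2] := var_speed_bounds.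
have n0 : 0 < var_speed s by apply: lt_le_trans n1; lra.
rewrite /var_curv normrM normrV ?unitfE ?expf_neq0 ?gt_eqF //.
rewrite (gtr0_norm (exprn_gt0 3 n0)) ler_pdivrMr ?exprn_gt0 //.
apply: (le_trans var_det_le).
have : (1 / 2 : R) ^+ 3 <= var_speed s ^+ 3.
  by rewrite lerXn2r // nnegrE ?divr_ge0 // ltW.
have A0 : 0 <= A by rewrite !addr_ge0.
rewrite !exprS expr0; nra.
Qed.

Lemma var_dcurv_le : `|var_dcurv s| <= 50 * 16 * M * A.
Proof.
have /andP[n1 n2] := var_speed_bounds.
have n0 : 0 < var_speed s by apply: lt_le_trans n1; lra.
have A0 : 0 <= A by rewrite !addr_ge0.
rewrite /var_dcurv normrM normrV ?unitfE ?expf_neq0 ?gt_eqF //.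
rewrite (gtr0_norm (exprn_gt0 4 n0)) ler_pdivrMr ?exprn_gt0 //.
apply: le_trans (_ : 50 * M * A <= _).
  rewrite (le_trans (ler_normB _ _)) // [`|var_ddet * _|]normrM.
  rewrite [`|3 * _ * _|]normrM [`|3 * _|]normrM (gtr0_norm n0) (@ger0_norm _ 3) //.
  have h1 : `|var_ddet| * var_speed s <= M * A * 2.
    by apply: ler_pM => //; [exact: ltW|exact: var_ddet_le].
  have h2 : 3 * `|var_det s| * `|var_dspeed s| <= 3 * (2 * A) * (8 * M).
    rewrite ler_pM ?mulr_ge0 //; last exact: var_dspeed_le.
    by rewrite ler_pM2l //; exact: var_det_le.
  have -> : 50 * M * A = M * A * 2 + 3 * (2 * A) * (8 * M) by ring.
  exact: lerD.
have h4 : (1 / 2 : R) ^+ 4 <= var_speed s ^+ 4.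
  by rewrite lerXn2r // nnegrE ?divr_ge0 // ltW.
have MA : 0 <= M * A by rewrite mulr_ge0 // (le_trans ler01).
apply: le_trans (_ : 50 * 16 * M * A * (1 / 2) ^+ 4 <= _).
  by rewrite le_eqVlt; apply/orP; left; apply/eqP; field.
have K0 : 0 <= 50 * 16 * M * A.
  by rewrite -(mulrA _ M A); apply: mulr_ge0 => //; exact: mulr_ge0.
exact: ler_wpM2l.
Qed.

Let C : R := (16 * A) `^ p.

Lemma var_curvp_le : `|var_curv s| `^ p <= C.
Proof.
have A0 : 0 <= A by rewrite !addr_ge0.
apply: ge0_ler_powR; rewrite ?nnegrE ?mulr_ge0 //; last exact: var_curv_le.
by rewrite ltW // (lt_trans ltr01).
Qed.

Lemma var_bending_le : `|var_bending s| <= 2 * C.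
Proof.
have /andP[n1 n2] := var_speed_bounds.
have n0 : 0 < var_speed s by apply: lt_le_trans n1; lra.
rewrite /var_bending normrM (ger0_norm (powR_ge0 _ _)) (gtr0_norm n0) mulrC.
by apply: ler_pM; [exact: ltW|exact: powR_ge0|exact: n2|exact: var_curvp_le].
Qed.

Lemma var_dbending_le : `|var_dbending s| <= (p * 2 * 50 * M + 8 * M) * C.
Proof.
have /andP[n1 n2] := var_speed_bounds.
have n0 : 0 < var_speed s by apply: lt_le_trans n1; lra.
have A1 : 0 < 16 * A by rewrite mulr_gt0 // ltr_wpDl // addr_ge0.
have p0 : 0 < p by rewrite (lt_trans ltr01).
have p10 : 0 < p - 1 by rewrite subr_gt0.
rewrite mulrDl (le_trans (ler_normD _ _)) // lerD //; last first.
  rewrite normrM mulrC (ger0_norm (powR_ge0 _ _)) ler_pM ?powR_ge0 //.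
    exact: var_dspeed_le.
  exact: var_curvp_le.
rewrite [`|_ * var_speed s|]normrM [`|_ * var_dcurv s|]normrM [`|p * _|]normrM.
rewrite (gtr0_norm p0) (gtr0_norm n0) normr_sgp //.
have h1 : `|var_curv s| `^ (p - 1) <= (16 * A) `^ (p - 1).
  apply: ge0_ler_powR; rewrite ?nnegrE ?(ltW p10) ?(ltW A1) //; exact: var_curv_le.
have CE : C = (16 * A) `^ (p - 1) * (16 * A).
  by rewrite mulrC /C mulr_powRB1 // ltW.
apply: le_trans (_ : p * (16 * A) `^ (p - 1) * (50 * 16 * M * A) * 2 <= _).
  apply: ler_pM; rewrite ?mulr_ge0 ?powR_ge0 // ?(ltW p0) ?(ltW n0) //.
  apply: ler_pM; rewrite ?mulr_ge0 ?powR_ge0 // ?(ltW p0) //.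
    by rewrite ler_pM2l.
  exact: var_dcurv_le.
by rewrite CE le_eqVlt; apply/orP; left; apply/eqP; ring.
Qed.

End PointwiseVariation.

Section FirstVariation.
Context {R : realType}.
Notation mu := (@lebesgue_measure R).
Implicit Types (s t : R).

Lemma itg_const (c d k : R) : itg c d (fun=> k).
Proof. exact/continuous_itg/cst_continuous. Qed.

Lemma is_derive_under_integral (L e : R) (f df : R -> R -> R) (G : R -> R) :
  0 < e ->
  (forall s, `|s| < e -> itg 0 L (f s)) ->
  (forall s t, `|s| < e -> 0 < t < L -> is_derive s 1 (fun r => f r t) (df s t)) ->
  (forall t, 0 <= G t) -> itg 0 L G ->
  (forall s t, `|s| < e -> 0 < t < L -> `|df s t| <= G t) ->
  is_derive (0 : R) 1 (fun s => \int[mu]_(t in `]0, L[) f s t)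
    (\int[mu]_(t in `]0, L[) df 0 t).
Proof.
move=> e0 fi fd G0 Gi dfG.
have Ie s : s \in `]- e, e[ -> `|s| < e by rewrite in_itv /= ltr_norml.
have dfE s t : `|s| < e -> 0 < t < L -> partial1of2 f s t = df s t.
  by move=> se tL; rewrite partial1of2E; case: (fd s t se tL).
have := @cvg_differentiation_under_integral R _ _ mu f `]0, L[ _ 0 (- e) e _ _ _ G G0.
move=> /(_ (measurable_itv _)) H.
have {H} /= H : h^-1 *: ((\int[mu]_(t in `]0, L[) f (h + 0) t) -
    \int[mu]_(t in `]0, L[) f 0 t) @[h --> 0^'] -->
    \int[mu]_(t in `]0, L[) partial1of2 f 0 t.
  apply: H.
  - by rewrite /= in_itv /= oppr_lt0 e0.
  - by move=> s /Ie /fi /itg_oo.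
  - by move=> s t /Ie se; rewrite /= in_itv => tL; case: (fd s t se tL).
  - exact/itg_oo.
  - move=> s t /Ie se; rewrite /= in_itv => tL.
    by rewrite dfE //; exact: dfG.
have E : \int[mu]_(t in `]0, L[) partial1of2 f 0 t = \int[mu]_(t in `]0, L[) df 0 t.
  apply: eq_Rintegral => t; rewrite inE /= in_itv /= => tL.
  by rewrite dfE // normr0.
rewrite E in H.
apply: DeriveDef.
  rewrite /derivable; apply/cvg_ex; exists (\int[mu]_(t in `]0, L[) df 0 t).
  by under eq_fun do rewrite scaler1.
rewrite /derive; apply/cvg_lim => //.
by under eq_fun do rewrite scaler1.
Qed.

Variables (p L M : R) (u v a b eta zeta : R -> R) (e0 e1 lam : R).
Hypotheses (p1 : 1 < p) (L0 : 0 < L) (M1 : 1 <= M).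
Hypotheses (uc : {within `[0, L], continuous u})
  (vc : {within `[0, L], continuous v})
  (etac : {within `[0, L], continuous eta}).
Hypotheses (am : measurable_fun `[0, L] a) (bm : measurable_fun `[0, L] b)
  (zetam : measurable_fun `[0, L] zeta).
Hypotheses (ap : itg 0 L (fun t => `|a t| `^ p))
  (bp : itg 0 L (fun t => `|b t| `^ p)).
Hypotheses (uv1 : forall t, 0 <= t <= L -> u t ^+ 2 + v t ^+ 2 = 1).
Hypotheses (etaM : forall t, 0 <= t <= L -> `|eta t| <= M)
  (zetaM : forall t, 0 <= t <= L -> `|zeta t| <= M).
Hypotheses (e0le : `|e0| <= 1) (e1le : `|e1| <= 1).

Let A t : R := 16 * (`|a t| + `|b t| + 2).

Lemma itg_majorant : itg 0 L (fun t => A t `^ p).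
Proof.
have p0 : 0 <= p by rewrite ltW // (lt_trans ltr01).
have mA : measurable_fun `[0, L] (fun t => A t `^ p).
  apply: (measurableT_comp (measurable_powR _)).
  apply: measurable_funM => //; apply: measurable_funD => //.
  by apply: measurable_funD; exact: measurableT_comp.
apply: (itg_le mA (g := fun t => 48 `^ p * (`|a t| `^ p + `|b t| `^ p + 2 `^ p))).
  move=> t _; rewrite ger0_norm ?powR_ge0 //.
  pose m : R := Num.max (Num.max `|a t| `|b t|) 2.
  have [ma mb m2] : [/\ `|a t| <= m, `|b t| <= m & 2 <= m].
    by split; rewrite /m !le_max ?lexx ?orbT.
  have m0 : 0 <= m by rewrite (le_trans _ m2).
  apply: le_trans (_ : (48 * m) `^ p <= _).
    apply: ge0_ler_powR => //; rewrite ?nnegrE ?mulr_ge0 //.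
    by rewrite /A; lra.
  rewrite powRM // ler_wpM2l ?powR_ge0 // /m /Num.max.
  have H1 := powR_ge0 `|a t| p; have H2 := powR_ge0 `|b t| p.
  have H3 := powR_ge0 (2 : R) p.
  by case: ifP => _; [|case: ifP => _]; lra.
apply: itgZ; apply: itgD; first exact: itgD.
exact: itg_const.
Qed.

Let vb t s := var_bending p (u t) (v t) (a t) (b t) (eta t) (zeta t) e0 e1 s.
Let vdb t s := var_dbending p (u t) (v t) (a t) (b t) (eta t) (zeta t) e0 e1 s.
Let vs t s : R := var_speed (u t) (v t) (eta t) e0 e1 s.
Let vds t s := var_dspeed (u t) (v t) (eta t) e0 e1 s.

Let small s : `|s| < 1 / (8 * M) -> `|s| * M <= 1 / 8.
Proof.
have M0 : 0 < M by exact: lt_le_trans M1.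
rewrite ltr_pdivlMr ?mulr_gt0 // => /ltW H.
by rewrite ler_pdivlMr // -mulrA [M * 8]mulrC.
Qed.

Lemma within_var_speed s : {within `[0, L], continuous (fun t => vs t s)}.
Proof.
apply: (@within_comp _ _ (fun t => var_u (u t) (eta t) e0 s ^+ 2 +
  var_v (v t) (eta t) e1 s ^+ 2) Num.sqrt); last exact: sqrt_continuous.
have H (w : R -> R) (e : R) : {within `[0, L], continuous w} ->
    {within `[0, L], continuous (fun t => (w t + s * (eta t * e)) ^+ 2)}.
  move=> wc.
  have : {within `[0, L], continuous (fun t => w t + s * (eta t * e))}.
    apply: within_add => //; apply: within_mul; first exact: within_const.
    by apply: within_mul => //; exact: within_const.
  by move=> H; exact: within_mul.
by apply: within_add; exact: H.
Qed.

Lemma measurable_var_bending s : `|s| * M <= 1 / 8 ->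
  measurable_fun `[0, L] (fun t => vb t s).
Proof.
move=> sM; have mcont (f : R -> R) : {within `[0, L], continuous f} ->
    measurable_fun `[0, L] f.
  by move=> fc; exact: measurable_itg (itg_continuous fc).
have mvs := mcont _ (within_var_speed (s := s)).
have mis : measurable_fun `[0, L] (fun t => (vs t s ^+ 3)^-1).
  rewrite (_ : (fun t => _) = fun t => (vs t s ^+ 3) `^ (-1)); last first.
    by apply/funext => t; rewrite powR_inv1 // exprn_ge0 // sqrtr_ge0.
  apply: (measurableT_comp (measurable_powR _)).
  by rewrite (_ : (fun t => vs t s ^+ 3) = fun t => vs t s * (vs t s * vs t s)) //;
    apply: measurable_funM => //; apply: measurable_funM.
apply: measurable_funM => //; apply: (measurableT_comp (measurable_powR _)).
apply: measurableT_comp => //; apply: measurable_funM => //.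
have mu' := mcont _ uc; have mv' := mcont _ vc; have me := mcont _ etac.
by apply: measurable_funB; apply: measurable_funM; apply: measurable_funD => //;
  apply: measurable_funM => //; apply: measurable_funM.
Qed.

Lemma itg_var_bending s : `|s| < 1 / (8 * M) -> itg 0 L (fun t => vb t s).
Proof.
move=> /small sM; apply: itg_le (measurable_var_bending sM) _ (itgZ 2 itg_majorant).
move=> t tL; exact: (var_bending_le _ _ p1 (uv1 tL) e0le e1le (etaM tL) (zetaM tL) sM).
Qed.

Lemma first_variation_derive :
  is_derive (0 : R) 1 (fun s => \int[mu]_(t in `]0, L[) vb t s +
                          lam * \int[mu]_(t in `]0, L[) vs t s)
    (\int[mu]_(t in `]0, L[) vdb t 0 + lam * \int[mu]_(t in `]0, L[) vds t 0).
Proof.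
have M0 : 0 < M by exact: lt_le_trans M1.
have e_gt0 : 0 < 1 / (8 * M) by rewrite divr_gt0 // mulr_gt0.
have inL t : 0 < t < L -> 0 <= t <= L by move=> /andP[/ltW -> /ltW ->].
apply: is_derive_add; last apply: is_derive_cmul.
- apply: (is_derive_under_integral (e := 1 / (8 * M)) (f := fun s t => vb t s)
    (df := fun s t => vdb t s) (G := fun t => (p * 2 * 50 * M + 8 * M) * A t `^ p)) => //.
  + exact: itg_var_bending.
  + move=> s t /small sM /inL tL; apply: is_derive_var_bending => //.
    exact: (var_speed2_gt0 (uv1 tL) e0le e1le (etaM tL) sM).
  + move=> t; rewrite mulr_ge0 ?powR_ge0 // addr_ge0 ?mulr_ge0 ?(ltW M0) //.
    by rewrite ltW // (lt_trans ltr01).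
  + exact/itgZ/itg_majorant.
  + move=> s t /small sM /inL tL.
    exact: (var_dbending_le _ _ p1 (uv1 tL) e0le e1le M1 (etaM tL) (zetaM tL) sM).
- apply: (is_derive_under_integral (e := 1 / (8 * M)) (f := fun s t => vs t s)
    (df := fun s t => vds t s) (G := fun t => 8 * M)) => //.
  + by move=> s _; exact/itg_continuous/within_var_speed.
  + move=> s t /small sM /inL tL; apply: is_derive_speed => //.
    exact: (var_speed2_gt0 (uv1 tL) e0le e1le (etaM tL) sM).
  + by move=> t; rewrite mulr_ge0 // ltW.
  + exact: itg_const.
  + move=> s t /small sM /inL tL.
    exact: (var_dspeed_le (uv1 tL) e0le e1le M1 (etaM tL) sM).
Qed.

End FirstVariation.

Section SobolevCurves.
Context {R : realType}.
Notation mu := (@lebesgue_measure R).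
Implicit Types (s t : R) (f : R -> R).

Definition vec2 (x y : R) : plane R :=
  x *: delta_mx 0 0 + y *: delta_mx 0 1.

Lemma vec2_0 x y : vec2 x y 0 0 = x.
Proof. by rewrite !mxE /= mulr1 mulr0 addr0. Qed.

Lemma vec2_1 x y : vec2 x y 0 1 = y.
Proof. by rewrite !mxE /= mulr1 mulr0 add0r. Qed.

Lemma plane_eq (x y : plane R) : x 0 0 = y 0 0 -> x 0 1 = y 0 1 -> x = y.
Proof.
move=> h0 h1; apply/matrixP => i j; rewrite !ord1.
case: j => [[|[|//]]] j2.
- by rewrite (_ : Ordinal j2 = 0) //; exact: val_inj.
- by rewrite (_ : Ordinal j2 = 1) //; exact: val_inj.
Qed.

Lemma within_vec2 (A : set R) f (g : R -> R) :
  {within A, continuous f} -> {within A, continuous g} ->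
  {within A, continuous (fun t => vec2 (f t) (g t))}.
Proof.
by move=> fc gc t; apply: cvgD; apply: cvgZr_tmp; [exact: fc|exact: gc].
Qed.

Lemma within_coord (A : set R) (f : R -> plane R) i :
  {within A, continuous f} -> {within A, continuous (fun t => f t 0 i)}.
Proof.
move=> fc t.
exact: (cvg_comp f (fun M : plane R => M 0 i) (fc t) (@coord_continuous R 1 2 0 i (f t))).
Qed.

Lemma Lp_on_measurable (p L : R) f : Lp_on p L f -> measurable_fun `[0, L] f.
Proof.
rewrite /Lp_on inE => /andP[/[!inE] /= mf _].
apply: (measurable_fun_itv_cc (b0 := false) (b1 := true)).
have := measurable_funS measurableT (@subsetT _ `]0, L[) mf.
apply: eq_measurable_fun => x xin; by rewrite patchE xin.
Qed.

Lemma Lp_on_pow (p L : R) f : 1 <= p -> Lp_on p L f ->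
  itg 0 L (fun t => `|f t| `^ p).
Proof.
move=> p1 fp; apply/itg_oo.
have := Lfun_integrable p1 fp => H.
have {}H : mu.-integrable `]0, L[ (fun x => (`|(f \_ `]0, L[) x| `^ p)%:E).
  by apply: (integrableS _ _ _ H).
apply: eq_integrable H => // x xin /=; by rewrite patchE xin.
Qed.

Lemma powR_ge_id (p x : R) : 1 <= p -> 0 <= x -> x <= 1 + x `^ p.
Proof.
move=> p1 x0; have [x1|x1] := leP x 1.
  by rewrite (le_trans x1) // lerDl powR_ge0.
by rewrite (le_trans (le1r_powR (ltW x1) p1)) // lerDr.
Qed.

Lemma Lp_on_itg (p L : R) f : 1 <= p -> Lp_on p L f -> itg 0 L f.
Proof.
move=> p1 fp; apply: (itg_le (g := fun t => 1 + `|f t| `^ p)).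
- exact: Lp_on_measurable fp.
- by move=> t _; exact: powR_ge_id.
- by apply: itgD; [exact: itg_const|exact: Lp_on_pow].
Qed.

Lemma Lnorm_bounded (p L M : R) f : 0 < p -> 0 <= L -> 0 <= M ->
  measurable_fun `[0, L] f -> {ae mu, forall t, 0 < t < L -> `|f t| <= M} ->
  ('N[mu]_p%:E [(EFin \o (f \_ `]0, L[))%R] <= (M * L `^ p^-1)%:E)%E.
Proof.
move=> p0 L0 M0 mf fM.
have mf' : measurable_fun `]0, L[ f.
  by apply: (measurable_funS _ _ mf) => //; exact: subset_itv_oo_cc.
rewrite unlock /Lnorm.
have -> : (M * L `^ p^-1)%:E = (((M `^ p * L)%:E) `^ p^-1)%E.
  rewrite poweR_EFin powRM ?powR_ge0 // -powRrM mulfV ?gt_eqF // powRr1 //.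
apply: gt0_ler_poweR; rewrite ?invr_ge0 ?(ltW p0) //.
- by rewrite in_itv /= leey andbT; apply: integral_ge0.
- by rewrite in_itv /= leey andbT lee_fin mulr_ge0 ?powR_ge0.
have -> : (\int[mu]_x (`|(EFin \o (f \_ `]0%R, L[)) x| `^ p) =
           \int[mu]_(x in `]0%R, L[) (`|f x| `^ p)%:E)%E.
  rewrite [RHS]integral_mkcond; apply: eq_integral => x _ /=.
  rewrite !patchE; case: ifP => // _.
  by rewrite normr0 powR0 // gt_eqF.
apply: (@le_trans _ _ (\int[mu]_(x in `]0%R, L[) (cst (M `^ p)%:E) x)%E).
  apply: ae_ge0_le_integral => //.
  - apply/measurable_EFinP; apply: (measurableT_comp (measurable_powR _)).
    exact: measurableT_comp.
  - by move=> x _; rewrite lee_fin powR_ge0.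
  move: fM; apply: filterS; first exact: (ae_filter_ringOfSetsType mu).
  move=> x fM; rewrite /= in_itv /= => xL; rewrite lee_fin.
  by apply: ge0_ler_powR; rewrite ?nnegrE ?(ltW p0) //; exact: fM.
rewrite integral_cst //=.
have /= -> := @lebesgue_measure_itv R `]0, L[; rewrite lte_fin.
move: L0; rewrite le_eqVlt => /predU1P[<-|->]; first by rewrite ltxx mule0 mulr0.
by rewrite -EFinD subr0 -EFinM.
Qed.

Lemma Lp_on_bounded (p L M : R) f : 0 < p -> 0 <= L -> measurable_fun `[0, L] f ->
  (forall t, 0 <= t <= L -> `|f t| <= M) -> Lp_on p L f.
Proof.
move=> p0 L0 mf fM; rewrite /Lp_on inE; apply/andP; split; rewrite inE /=.
  have mf' : measurable_fun `]0, L[ f.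
    by apply: (measurable_funS _ _ mf) => //; exact: subset_itv_oo_cc.
  exact/(measurable_restrictT _ _).1.
rewrite /finite_norm.
apply: (@le_lt_trans _ _ (`|M| * L `^ p^-1)%:E); last exact: ltry.
apply: Lnorm_bounded => //; apply: aeW => t /andP[t0 tL]; apply: le_trans (ler_norm M).
by apply: fM; rewrite !ltW.
Qed.

Lemma exists_W2p (p L M : R) (A B : R -> R) (x0 y0 u0 v0 : R) :
  0 < p -> 0 <= L -> measurable_fun `[0, L] A -> measurable_fun `[0, L] B ->
  (forall t, 0 <= t <= L -> `|A t| <= M) ->
  (forall t, 0 <= t <= L -> `|B t| <= M) ->
  let U t := u0 + iab 0 t A in let V t := v0 + iab 0 t B in
  exists h : W2p p L,
    [/\ pos h = fun t => vec2 (x0 + iab 0 t U) (y0 + iab 0 t V),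
        vel h = (fun t => vec2 (U t) (V t)) & acc h = fun t => vec2 (A t) (B t)].
Proof.
move=> p0 L0 mA mB AM BM U V.
have Ai := itg_bounded mA AM; have Bi := itg_bounded mB BM.
have Uc : {within `[0, L], continuous U}.
  by apply: within_add; [exact: within_const|exact: prim_continuous].
have Vc : {within `[0, L], continuous V}.
  by apply: within_add; [exact: within_const|exact: prim_continuous].
have Ui := itg_continuous Uc; have Vi := itg_continuous Vc.
pose X t := x0 + iab 0 t U; pose Y t := y0 + iab 0 t V.
have Xc : {within `[0, L], continuous X}.
  by apply: within_add; [exact: within_const|exact: prim_continuous].
have Yc : {within `[0, L], continuous Y}.
  by apply: within_add; [exact: within_const|exact: prim_continuous].
have Lpc f : {within `[0, L], continuous f} -> Lp_on p L f.
  move=> fc; have [K fK] := continuous_bounded fc.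
  exact: Lp_on_bounded (measurable_itg (itg_continuous fc)) fK.
have vecP (Q : (R -> R) -> Prop) f g (i : 'I_2) : Q f -> Q g ->
    Q (fun t => vec2 (f t) (g t) 0 i).
  move=> Qf Qg; case: i => [[|[|//]]] i2.
    rewrite (_ : Ordinal i2 = 0); last exact: val_inj.
    by under eq_fun do rewrite vec2_0.
  rewrite (_ : Ordinal i2 = 1); last exact: val_inj.
  by under eq_fun do rewrite vec2_1.
have vecP2 (Q : (R -> R) -> (R -> R) -> Prop) f g f' g' (i : 'I_2) : Q f f' -> Q g g' ->
    Q (fun t => vec2 (f t) (g t) 0 i) (fun t => vec2 (f' t) (g' t) 0 i).
  move=> Qf Qg; case: i => [[|[|//]]] i2.
    rewrite (_ : Ordinal i2 = 0); last exact: val_inj.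
    by under eq_fun do rewrite vec2_0; under [X in Q _ X]eq_fun do rewrite vec2_0.
  rewrite (_ : Ordinal i2 = 1); last exact: val_inj.
  by under eq_fun do rewrite vec2_1; under [X in Q _ X]eq_fun do rewrite vec2_1.
have h1 := within_vec2 Xc Yc.
have h2 := within_vec2 Uc Vc.
have h3 i := vecP (Lp_on p L) X Y i (Lpc X Xc) (Lpc Y Yc).
have h4 i := vecP (Lp_on p L) U V i (Lpc U Uc) (Lpc V Vc).
have h5 i := vecP (Lp_on p L) A B i (Lp_on_bounded p0 L0 mA AM) (Lp_on_bounded p0 L0 mB BM).
have h6 i := vecP2 (weak_derivative L) X Y U V i
  (prim_weak_derivative L0 Ui (fun t _ => erefl (X t)))
  (prim_weak_derivative L0 Vi (fun t _ => erefl (Y t))).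
have h7 i := vecP2 (weak_derivative L) U V A B i
  (prim_weak_derivative L0 Ai (fun t _ => erefl (U t)))
  (prim_weak_derivative L0 Bi (fun t _ => erefl (V t))).
by exists (MkW2p h1 h2 h3 h4 h5 h6 h7).
Qed.

Section W2pFacts.
Variables (p L : R) (c : W2p p L).
Hypotheses (p1 : 1 < p) (L0 : 0 < L).

Let p1' : 1 <= p. Proof. exact: ltW. Qed.

Lemma vel_itg i : itg 0 L (fun t => vel c t 0 i).
Proof. exact/itg_continuous/within_coord/vel_continuous. Qed.

Lemma acc_itg i : itg 0 L (fun t => acc c t 0 i).
Proof. by apply: (Lp_on_itg p1'); exact: acc_Lp. Qed.

Lemma acc_pow_itg i : itg 0 L (fun t => `|acc c t 0 i| `^ p).
Proof. by apply: Lp_on_pow => //; exact: acc_Lp. Qed.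

Lemma pos_prim i t : 0 <= t <= L ->
  pos c t 0 i = pos c 0 0 i + iab 0 t (fun s => vel c s 0 i).
Proof.
apply: (weak_derivative_prim L0 _ (vel_itg i) (@vel_weak _ _ _ c i)).
exact/within_coord/pos_continuous.
Qed.

Lemma vel_prim i t : 0 <= t <= L ->
  vel c t 0 i = vel c 0 0 i + iab 0 t (fun s => acc c s 0 i).
Proof.
apply: (weak_derivative_prim L0 _ (acc_itg i) (@acc_weak _ _ _ c i)).
exact/within_coord/vel_continuous.
Qed.

Lemma vel_derive_ae i :
  {ae mu, forall t, 0 < t < L -> is_derive t 1 (fun t => vel c t 0 i) (acc c t 0 i)}.
Proof.
move: (prim_derive_ae (ltW L0) (acc_itg i)).
apply: filterS; first exact: (ae_filter_ringOfSetsType mu).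
move=> t H tL.
have near_eq : \forall s \near t,
    vel c 0 0 i + iab 0 s (fun r => acc c r 0 i) = vel c s 0 i.
  by apply: filterS (near_itvoo tL) => s /andP[s0 sL]; rewrite [RHS]vel_prim // !ltW.
apply: (near_eq_is_derive near_eq).
apply: (is_derive_eq (is_derive_add (is_derive_const (vel c 0 0 i) t) (H tL))).
by rewrite add0r.
Qed.

Hypothesis arcl : arclength_parametrized c.

Lemma vel_unit t : 0 <= t <= L -> vel c t 0 0 ^+ 2 + vel c t 0 1 ^+ 2 = 1.
Proof.
move=> tL; have /eqP := arcl tL; rewrite /enorm => /eqP H.
by rewrite -[LHS]sqr_sqrtr ?H ?expr1n // addr_ge0 // sqr_ge0.
Qed.

Lemma vel_acc_ortho_ae : {ae mu, forall t, 0 < t < L ->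
  vel c t 0 0 * acc c t 0 0 + vel c t 0 1 * acc c t 0 1 = 0}.
Proof.
move: (vel_derive_ae 0) (vel_derive_ae 1).
apply: filterS2; first exact: (ae_filter_ringOfSetsType mu).
move=> t H0 H1 tL; have D0 := H0 tL; have D1 := H1 tL.
have near_eq : \forall s \near t, vel c s 0 0 ^+ 2 + vel c s 0 1 ^+ 2 = 1.
  by apply: filterS (near_itvoo tL) => s /andP[s0 sL]; rewrite vel_unit // !ltW.
have [_ E1] := near_eq_is_derive near_eq
  (is_derive_add (is_derive_pow 2 D0) (is_derive_pow 2 D1)).
have [_ E2] := is_derive_const 1 t.
move: E1; rewrite E2 /= !expr1 => E1.
apply: (mulfI (lt0r_neq0 (@ltr0Sn R 1))); rewrite mulr0 [RHS]E1; ring.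
Qed.

End W2pFacts.

End SobolevCurves.

Section SecondOrderDBR.
Context {R : realType}.
Notation mu := (@lebesgue_measure R).
Implicit Types (s t x y : R) (f : R -> R).

Definition upto (y s : R) : R := if s <= y then 1 else 0.

Lemma measurable_upto (D : set R) y : measurable_fun D (upto y).
Proof.
apply: (@measurable_funS _ _ _ _ setT) => //.
by apply: measurable_fun_ifT => //; apply: measurable_fun_ler.
Qed.

Lemma upto_le1 y s : `|upto y s| <= 1.
Proof. by rewrite /upto; case: ifP; rewrite ?normr1 ?normr0. Qed.

Lemma iab_upto (L y : R) f : 0 <= y <= L -> itg 0 L f ->
  iab 0 L (fun s => f s * upto y s) = iab 0 y f.
Proof.
move=> /andP[y0 yL] fi.
have ui : itg 0 L (fun s => f s * upto y s).
  apply: (itgM_bounded (g := upto y) (M := 1) fi) => [|s _]; last exact: upto_le1.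
  exact: measurable_upto.
rewrite (iab_split y0 yL ui) -[RHS]addr0; congr (_ + _).
  by apply: eq_iab => s /andP[_ sy]; rewrite /upto sy mulr1.
have z s : y < s < L -> 0 = f s * upto y s.
  by move=> /andP[ys _]; rewrite /upto leNgt ys mulr0.
have [_ <-] := eq_iab_oo (itg_const y L 0) z.
by rewrite iab_const // mul0r.
Qed.

Lemma iab_id (y : R) : 0 <= y -> iab 0 y (fun s => s) = y ^+ 2 / 2.
Proof.
move=> y0; have D (s : R) : is_derive s 1 (fun s : R => s ^+ 2 / 2) s.
  apply: (is_derive_eq (is_derive_mul (is_derive_pow 2 (is_derive_id s 1))
    (is_derive_const 2^-1 s))).
  by rewrite /= expr1; field.
rewrite (ftc y0 _ _ (fun s _ => D s)) ?expr0n /= ?mul0r ?subr0 //.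
  by apply: continuous_subspaceT => s; exact: cvg_id.
exact/continuous_subspaceT/(is_derive_continuous D).
Qed.

Lemma dbr_second (L : R) (A B : R -> R) : 0 < L -> itg 0 L A -> itg 0 L B ->
  (forall (zeta : R -> R) (M : R), measurable_fun `[0, L] zeta ->
    (forall t, 0 <= t <= L -> `|zeta t| <= M) ->
    iab 0 L zeta = 0 -> iab 0 L (fun t => iab 0 t zeta) = 0 ->
    iab 0 L (fun t => A t * zeta t) + iab 0 L (fun t => B t * iab 0 t zeta) = 0) ->
  exists c d : R, {ae mu, forall t, 0 < t < L -> A t = iab 0 t B + (c + d * t)}.
Proof.
move=> L0 Ai Bi H; have L0' := ltW L0; have LN0 := lt0r_neq0 L0.
pose f t := A t - iab 0 t B.
have Bc := prim_continuous L0' Bi.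
have fi : itg 0 L f by apply: itgB => //; exact: itg_continuous.
pose m := L / 2.
have mL : 0 <= m <= L by rewrite /m; apply/andP; split; lra.
have LL : 0 <= L <= L by rewrite L0' lexx.
have key x : 0 <= x <= L ->
    let al := 4 * (x ^+ 2 - L * x) / L ^+ 2 in
    let be := - (x + al * L / 2) / L in
    iab 0 x f + al * iab 0 m f + be * iab 0 L f = 0.
  move=> xL al be; have /andP[x0 xL'] := xL.
  pose zeta s := upto x s + al * upto m s + be * upto L s.
  have mz : measurable_fun `[0, L] zeta.
    apply: measurable_funD; [apply: measurable_funD|];
      by [exact: measurable_upto|apply: measurable_funM => //; exact: measurable_upto].
  have zM t : `|zeta t| <= 1 + `|al| + `|be|.
    rewrite (le_trans (ler_normD _ _)) // lerD //.
      rewrite (le_trans (ler_normD _ _)) // lerD ?upto_le1 //.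
      by rewrite normrM -[leRHS]mulr1 ler_wpM2l // upto_le1.
    by rewrite normrM -[leRHS]mulr1 ler_wpM2l // upto_le1.
  have zi := itg_bounded mz (fun t _ => zM t).
  have dec (g : R -> R) : itg 0 L g ->
      iab 0 L (fun s => g s * zeta s) = iab 0 x g + al * iab 0 m g + be * iab 0 L g.
    move=> gi; have gu y : itg 0 L (fun s => g s * upto y s).
      apply: (itgM_bounded (g := upto y) (M := 1) gi) => [|s _]; last exact: upto_le1.
      exact: measurable_upto.
    rewrite -(iab_upto xL gi) -(iab_upto mL gi) -(iab_upto LL gi) -!iabZ // -!iabD //;
      try exact: itgZ; last by apply: itgD => //; exact: itgZ.
    by apply: eq_iab => s _; rewrite /zeta; ring.
  have z1 : iab 0 L zeta = 0.
    transitivity (iab 0 L (fun s => 1 * zeta s)); first by apply: eq_iab => s _; rewrite mul1r.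
    rewrite dec; last exact: itg_const.
    rewrite !iab_const ?(andP mL).1 // !mul1r !subr0 /be /m.
    by field.
  have z2 : iab 0 L (fun t => iab 0 t zeta) = 0.
    have := prim_parts L0' zi (itg_const 0 L 1); rewrite z1 mul0r => /eqP.
    rewrite addr_eq0 => /eqP E.
    transitivity (iab 0 L (fun t => iab 0 t zeta * 1)); first by apply: eq_iab => s _; rewrite mulr1.
    rewrite E; apply/eqP; rewrite oppr_eq0; apply/eqP.
    transitivity (iab 0 L (fun s => s * zeta s)).
      by apply: eq_iab => s /andP[s0 _]; rewrite iab_const // mul1r subr0 mulrC.
    rewrite dec; last by apply: continuous_itg => s; exact: cvg_id.
    rewrite !iab_id ?(andP mL).1 // /be /al /m; by field.
  have := H zeta _ mz (fun t _ => zM t) z1 z2.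
  have := prim_parts L0' Bi zi; rewrite z1 mulr0 => E1 E2.
  have Azi : itg 0 L (fun t => A t * zeta t) by apply: itgM_bounded Ai mz (fun t _ => zM t).
  have Pzi : itg 0 L (fun t => iab 0 t B * zeta t).
    by apply: itgM_bounded mz (fun t _ => zM t); exact: itg_continuous.
  rewrite -dec // (@eq_iab _ _ _ _ (fun t => A t * zeta t - iab 0 t B * zeta t)); last first.
    by move=> t _; rewrite /f mulrBl.
  rewrite iabB //; apply/eqP; rewrite subr_eq0; apply/eqP.
  move/eqP: E2; rewrite addr_eq0 => /eqP ->.
  by move/eqP: E1; rewrite addr_eq0 => /eqP ->.
pose g := 4 * (iab 0 L f / 2 - iab 0 m f) / L ^+ 2.
pose c := iab 0 L f / L - g * L; pose d := 2 * g.
exists c, d.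
have linc : continuous (fun t : R => c + d * t).
  by apply: (is_derive_continuous (df := fun=> d)) => t;
    under eq_fun do rewrite addrC; exact: is_derive_affine.
have li : itg 0 L (fun t => c + d * t) by exact: continuous_itg.
have gi : itg 0 L (fun t => f t - (c + d * t)) by exact: itgB.
have F0 x : 0 <= x <= L -> iab 0 x (fun t => f t - (c + d * t)) = 0.
  move=> xL; have /andP[x0 xL'] := xL; have E := key x xL.
  have fix' : itg 0 x f by apply: itgS fi.
  have id' : itg 0 x (fun s => s) by apply: continuous_itg => s; exact: cvg_id.
  rewrite iabB //; last exact: continuous_itg.
  rewrite (iabD (itg_const 0 x c) (itgZ d id')).
  rewrite iab_const // subr0 iabZ // iab_id //.
  move: E => /=; rewrite /c /d /g.
  set F1 := iab 0 m f; set F2 := iab 0 L f; set F := iab 0 x f => E.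
  have -> : F = - (4 * (x ^+ 2 - L * x) / L ^+ 2 * F1 +
     - (x + 4 * (x ^+ 2 - L * x) / L ^+ 2 * L / 2) / L * F2).
    by apply/eqP; rewrite -addr_eq0 addrA E.
  by field.
move: (prim_eq0_ae L0' gi F0).
apply: filterS; first exact: (ae_filter_ringOfSetsType mu).
move=> t E tL; have /eqP := E tL; rewrite /f subr_eq0 => /eqP <-.
by rewrite addrC subrK.
Qed.

End SecondOrderDBR.

Section ContinuousRepresentatives.
Context {R : realType}.
Notation mu := (@lebesgue_measure R).
Implicit Types (s t x y : R) (f F : R -> R).

Lemma is_derive_prim_within (L : R) F f (F0 : R) : {within `[0, L], continuous f} ->
  (forall t, 0 <= t <= L -> F t = F0 + iab 0 t f) ->
  forall t, 0 < t < L -> is_derive t 1 F (f t).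
Proof.
move=> fc FE t tL; have near_eq : \forall s \near t, F0 + iab 0 s f = F s.
  by apply: filterS (near_itvoo tL) => s /andP[s0 sL]; rewrite FE // !ltW.
apply: (near_eq_is_derive near_eq).
apply: (is_derive_eq (is_derive_add (is_derive_const F0 t) (prim_derive tL fc))).
by rewrite add0r.
Qed.

Lemma continuous_ae_eq0 (L : R) f : 0 <= L -> {within `[0, L], continuous f} ->
  {ae mu, forall t, 0 < t < L -> f t = 0} -> forall t, 0 < t < L -> f t = 0.
Proof.
move=> L0 fc f0 t tL.
have F0 s : 0 <= s <= L -> 0 = 0 + iab 0 s f.
  move=> /andP[s0 sL]; rewrite add0r.
  transitivity (iab 0 s (fun=> 0 : R)); first by rewrite iab_const // mul0r.
  apply: ae_eq_iab; [exact: itg_const|exact: itgS (itg_continuous fc)|].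
  move: f0; apply: filterS; first exact: (ae_filter_ringOfSetsType mu).
  by move=> x H /andP[x0 xs]; rewrite H // x0 (lt_le_trans xs).
have [_ <-] := is_derive_prim_within fc F0 tL.
by have [_ ->] := is_derive_const (0 : R) t.
Qed.

Lemma within_derive0_const (L : R) f : {within `[0, L], continuous f} ->
  (forall t, 0 < t < L -> is_derive t 1 f 0) ->
  forall t, 0 <= t <= L -> f t = f 0.
Proof.
move=> fc fd t /andP[t0 tL].
have fct : {within `[0, t], continuous f}.
  by apply: continuous_subspaceW fc; apply: subset_itvl; rewrite bnd_simp.
have fdt x : x \in `]0, t[ -> is_derive x 1 f 0.
  by rewrite in_itv /= => /andP[x0 xt]; apply: fd; rewrite x0 (lt_le_trans xt).
have [z _] := @MVT_segment R f (fun=> 0) 0 t t0 fdt fct.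
by rewrite mul0r => /eqP; rewrite subr_eq0 => /eqP.
Qed.

End ContinuousRepresentatives.

Section EulerLagrange.
Context {R : realType}.
Notation mu := (@lebesgue_measure R).
Implicit Types (s t : R) (f : R -> R).
Variables (p L lam : R) (c : W2p p L).
Hypotheses (p1 : 1 < p) (L0 : 0 < L).
Hypotheses (arcl : arclength_parametrized c) (fv : first_variation_vanishes lam c).

Let u t : R := vel c t 0 0.
Let v t : R := vel c t 0 1.
Let a t : R := acc c t 0 0.
Let b t : R := acc c t 0 1.
Let k t := u t * b t - v t * a t.
Let w t := sgp (p - 1) (k t).

Let p0 : 0 < p. Proof. exact: lt_trans p1. Qed.
Let p10 : 0 < p - 1. Proof. by rewrite subr_gt0. Qed.

Let uc : {within `[0, L], continuous u}.
Proof. exact/within_coord/vel_continuous. Qed.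

Let vc : {within `[0, L], continuous v}.
Proof. exact/within_coord/vel_continuous. Qed.

Let ai : itg 0 L a. Proof. exact: acc_itg. Qed.
Let bi : itg 0 L b. Proof. exact: acc_itg. Qed.

Let uv1 t : 0 <= t <= L -> u t ^+ 2 + v t ^+ 2 = 1.
Proof. exact: vel_unit. Qed.

Let ki : itg 0 L k.
Proof.
apply: itgB.
  by apply: (itg_ext _ (itgM_continuous bi uc)) => t _; rewrite mulrC.
by apply: (itg_ext _ (itgM_continuous ai vc)) => t _; rewrite mulrC.
Qed.

Let km := measurable_itg ki.

Let acc_ae : {ae mu, forall t, 0 < t < L ->
  a t = - k t * v t /\ b t = k t * u t}.
Proof.
move: (vel_acc_ortho_ae p1 L0 arcl).
apply: filterS; first exact: (ae_filter_ringOfSetsType mu).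
move=> t H tL; have {}H := H tL.
have uv : u t ^+ 2 + v t ^+ 2 = 1 by apply: uv1; case/andP: tL => /ltW -> /ltW ->.
rewrite -/(u t) -/(v t) -/(a t) -/(b t) in H.
have ua : u t * a t = - (v t * b t) by apply/eqP; rewrite -addr_eq0 H.
split; rewrite /k.
  transitivity ((u t ^+ 2 + v t ^+ 2) * a t); first by rewrite uv mul1r.
  have -> : (u t ^+ 2 + v t ^+ 2) * a t = u t * (u t * a t) + v t ^+ 2 * a t by ring.
  by rewrite ua; ring.
transitivity ((u t ^+ 2 + v t ^+ 2) * b t); first by rewrite uv mul1r.
have -> : (u t ^+ 2 + v t ^+ 2) * b t = u t ^+ 2 * b t - v t * (- (v t * b t)) by ring.
by rewrite -ua; ring.
Qed.

Let kpi : itg 0 L (fun t => `|k t| `^ p).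
Proof.
apply: (itg_le _ _ (itg_majorant p1 (measurable_itg ai) (measurable_itg bi)
  (acc_pow_itg c p1 0) (acc_pow_itg c p1 1))).
  apply: (measurableT_comp (measurable_powR _)); exact: measurableT_comp.
move=> t tL; rewrite ger0_norm ?powR_ge0 //.
apply: ge0_ler_powR; rewrite ?nnegrE ?(ltW p0) ?mulr_ge0 ?addr_ge0 //.
have [u1 v1] := uv_le1 (uv1 tL).
have : `|k t| <= `|a t| + `|b t|.
  rewrite (le_trans (ler_normB _ _)) // !normrM addrC.
  by rewrite lerD // -[leRHS]mul1r ler_wpM2r.
have := normr_ge0 (a t); have := normr_ge0 (b t); rewrite -/(a t) -/(b t); lra.
Qed.

Let wi : itg 0 L w.
Proof.
apply: (itg_le (g := fun t => 1 + `|k t| `^ p)).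
- apply: measurableT_comp => //; apply: continuous_measurable_fun => t.
  exact: continuous_sgp.
- move=> t _; rewrite normr_sgp //; have [k1|k1] := leP `|k t| 1.
    rewrite (le_trans (y := 1)) ?lerDl ?powR_ge0 //.
    have E1 : 1 `^ (p - 1) = 1 :> R by rewrite powR1.
    rewrite -[leRHS]E1; apply: ge0_ler_powR; rewrite ?nnegrE ?(ltW p10) //.
  by rewrite ler_wpDl // ler_powR ?(ltW k1) // gerBl.
- by apply: itgD; [exact: itg_const|exact: kpi].
Qed.

Let Amom e0 e1 t : R := p * (w t * (u t * e1 - v t * e0)).
Let Bmom e0 e1 t : R := ((1 - 2 * p) * `|k t| `^ p + lam) * (e0 * u t + e1 * v t).

Let dirc e0 e1 : {within `[0, L], continuous (fun t => u t * e1 - v t * e0 : R)}.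
Proof.
by apply: within_sub; apply: within_mul => //; exact: within_const.
Qed.

Let dirc2 e0 e1 : {within `[0, L], continuous (fun t => e0 * u t + e1 * v t : R)}.
Proof.
by apply: within_add; apply: within_mul => //; exact: within_const.
Qed.

Let Ai e0 e1 : itg 0 L (Amom e0 e1).
Proof. by apply: itgZ; exact: itgM_continuous. Qed.

Let Bi e0 e1 : itg 0 L (Bmom e0 e1).
Proof.
apply: itgM_continuous => //; apply: itgD; last exact: itg_const.
exact: itgZ.
Qed.

Lemma euler_lagrange_weak (e0 e1 M : R) (zeta : R -> R) :
  `|e0| <= 1 -> `|e1| <= 1 -> measurable_fun `[0, L] zeta ->
  (forall t, 0 <= t <= L -> `|zeta t| <= M) ->
  iab 0 L zeta = 0 -> iab 0 L (fun t => iab 0 t zeta) = 0 ->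
  iab 0 L (fun t => Amom e0 e1 t * zeta t) +
  iab 0 L (fun t => Bmom e0 e1 t * iab 0 t zeta) = 0.
Proof.
move=> e01 e11 mz zM z0 ez0; pose eta t : R := iab 0 t zeta.
have zi := itg_bounded mz zM.
have etac : {within `[0, L], continuous eta} by exact: prim_continuous (ltW L0) zi.
have etai := itg_continuous etac.
have [Me etaMe] := continuous_bounded etac.
pose M' : R := Num.max 1 (Num.max M Me).
have M1 : 1 <= M' by rewrite le_max lexx.
have zM' t : 0 <= t <= L -> `|zeta t| <= M'.
  by move=> /zM; rewrite !le_max => ->; rewrite orbT.
have etaM' t : 0 <= t <= L -> `|eta t| <= M'.
  by move=> /etaMe; rewrite !le_max => ->; rewrite !orbT.
have zeM e : `|e| <= 1 -> forall t, 0 <= t <= L -> `|e * zeta t| <= M'.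
  by move=> e1' t /zM' tM; rewrite normrM -[leRHS]mul1r ler_pM.
have mze e : measurable_fun `[0, L] (fun t => e * zeta t) by exact: measurable_funM.
have [h [hpos hvel hacc]] := exists_W2p 0 0 0 0 p0 (ltW L0) (mze e0) (mze e1)
  (zeM e0 e01) (zeM e1 e11).
have prE e t : 0 <= t <= L -> 0 + iab 0 t (fun s => e * zeta s) = eta t * e.
  move=> /andP[t0 tL]; rewrite add0r iabZ ?(mulrC e) //.
  exact: itgS zi.
have hC1 : C1_closed h.
  have prE2 e : iab 0 L (fun t => 0 + iab 0 t (fun s => e * zeta s)) = 0.
    transitivity (iab 0 L (fun t => e * eta t)).
      by apply: eq_iab => t /prE ->; rewrite mulrC.
    by rewrite iabZ // ez0 mulr0.
  have LL : 0 <= L <= L by rewrite ltW //=.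
  have L00 : (0 : R) <= 0 <= L by apply/andP; split=> //; exact: ltW.
  split.
    by rewrite hpos; apply: plane_eq; rewrite ?vec2_0 ?vec2_1 !prE2 !iab_point.
  rewrite hvel; apply: plane_eq; rewrite ?vec2_0 ?vec2_1 !prE //.
    by rewrite /eta z0 iab_point.
  by rewrite /eta z0 iab_point.
have := first_variation_derive lam p1 M1 uc vc etac (measurable_itg ai)
  (measurable_itg bi) mz (acc_pow_itg c p1 0) (acc_pow_itg c p1 1) uv1 etaM' zM' e01 e11.
have entry t s : 0 < t < L ->
   [/\ (vel c t + s *: vel h t) 0 0 = u t + s * (eta t * e0),
       (vel c t + s *: vel h t) 0 1 = v t + s * (eta t * e1),
       (acc c t + s *: acc h t) 0 0 = a t + s * (zeta t * e0) &
       (acc c t + s *: acc h t) 0 1 = b t + s * (zeta t * e1)].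
  move=> /andP[t0 tL]; have tL' : 0 <= t <= L by rewrite !ltW.
  have E0 (x y : plane R) i : (x + s *: y) 0 i = x 0 i + s * y 0 i by rewrite !mxE.
  rewrite !E0 hvel hacc !vec2_0 !vec2_1 !prE //.
  by rewrite ![_ * zeta t]mulrC.
have -> : (fun s =>
      \int[mu]_(t in `]0, L[) var_bending p (u t) (v t) (a t) (b t) (eta t) (zeta t) e0 e1 s
      + lam * \int[mu]_(t in `]0, L[) var_speed (u t) (v t) (eta t) e0 e1 s) =
    (fun eps : R =>
      bending p L (fun t => vel c t + eps *: vel h t) (fun t => acc c t + eps *: acc h t)
      + lam * curve_length L (fun t => vel c t + eps *: vel h t)).
  apply/funext => s; congr (_ + _ * _); apply: eq_Rintegral => t;
    rewrite inE /= in_itv /= => /entry => /(_ s) [h1 h2 h3 h4].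
    by rewrite /signed_curvature /det2 /enorm h1 h2 h3 h4.
  by rewrite /enorm h1 h2.
move=> [_ D1]; have [_ D2] := fv hC1; move: D1; rewrite D2 => {D2}.
have sp1 t : 0 <= t <= L -> var_speed (u t) (v t) (eta t) e0 e1 0 = 1.
  by move=> tL; rewrite /var_speed /var_u /var_v !mul0r !addr0 uv1 // sqrtr1.
pose dir t : R := e0 * u t + e1 * v t.
pose E0 t : R := p * w t * (eta t * (e0 * b t - e1 * a t) + zeta t * (u t * e1 - v t * e0)
   - 3 * k t * (eta t * dir t)) + `|k t| `^ p * (eta t * dir t).
have vdbE t : 0 <= t <= L ->
    var_dbending p (u t) (v t) (a t) (b t) (eta t) (zeta t) e0 e1 0 = E0 t.
  move=> tL; have curvE : var_curv (u t) (v t) (a t) (b t) (eta t) (zeta t) e0 e1 0 = k t.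
    by rewrite /var_curv sp1 // expr1n divr1 var_detE mul0r addr0.
  have dspE : var_dspeed (u t) (v t) (eta t) e0 e1 0 = eta t * dir t.
    rewrite /var_dspeed sp1 // /var_u /var_v divr1 /dir; ring.
  rewrite /var_dbending curvE dspE sp1 // /var_dcurv sp1 // dspE expr1n divr1.
  by rewrite var_detE mul0r addr0 !mulr1 /E0 -/(k t).
have dspE t : 0 <= t <= L -> var_dspeed (u t) (v t) (eta t) e0 e1 0 = eta t * dir t.
  by move=> tL; rewrite /var_dspeed sp1 // /var_u /var_v divr1 /dir; ring.
have etam := measurable_itg etai.
have dirm : measurable_fun `[0, L] dir.
  exact: measurable_itg (itg_continuous (@dirc2 e0 e1)).
have am := measurable_itg ai; have bm := measurable_itg bi.
have E0i : itg 0 L E0.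
  apply: (itg_le (g := fun t => (p * 2 * 50 * M' + 8 * M') *
    (16 * (`|a t| + `|b t| + 2)) `^ p)).
  - apply: measurable_funD; last first.
      apply: measurable_funM; last exact: measurable_funM.
      apply: (measurableT_comp (measurable_powR _)); exact: measurableT_comp.
    apply: measurable_funM.
      by apply: measurable_funM => //; exact: measurable_itg wi.
    apply: measurable_funB; last first.
      by apply: measurable_funM; [exact: measurable_funM|exact: measurable_funM].
    apply: measurable_funD; apply: measurable_funM => //.
      by apply: measurable_funB; exact: measurable_funM.
    exact: measurable_itg (itg_continuous (@dirc e0 e1)).
  - move=> t tL; rewrite -vdbE //.
    apply: (var_dbending_le _ _ p1 (uv1 tL) e01 e11 M1 (etaM' t tL) (zM' t tL)).
    by rewrite normr0 mul0r divr_ge0.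
  - apply: itgZ; apply: itg_majorant => //; exact: acc_pow_itg.
have dspi : itg 0 L (fun t => eta t * dir t) by exact: itgM_continuous etai (@dirc2 e0 e1).
have inL t : t \in (`]0, L[%classic : set R) -> 0 <= t <= L.
  by rewrite inE /= in_itv /= => /andP[/ltW -> /ltW ->].
have I1 : \int[mu]_(t in `]0, L[)
    var_dbending p (u t) (v t) (a t) (b t) (eta t) (zeta t) e0 e1 0 = iab 0 L E0.
  by rewrite -iab_oo //; apply: eq_Rintegral => t /inL; exact: vdbE.
have I2 : \int[mu]_(t in `]0, L[) var_dspeed (u t) (v t) (eta t) e0 e1 0 =
    iab 0 L (fun t => eta t * dir t).
  by rewrite -iab_oo //; apply: eq_Rintegral => t /inL; exact: dspE.
rewrite I1 I2.
have Azi : itg 0 L (fun t => Amom e0 e1 t * zeta t).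
  exact: itgM_bounded (@Ai e0 e1) mz zM.
have Bzi : itg 0 L (fun t => Bmom e0 e1 t * eta t).
  exact: itgM_continuous (@Bi e0 e1) etac.
rewrite -iabZ // -[iab 0 L E0 + _]iabD //; last exact: itgZ.
move=> E; rewrite -iabD // [RHS]E.
apply: ae_eq_iab; [exact: itgD|by apply: itgD => //; exact: itgZ|].
move: acc_ae; apply: filterS; first exact: (ae_filter_ringOfSetsType mu).
move=> t H tL; have [aE bE] := H tL.
rewrite /E0 /Amom /Bmom /dir -/(eta t).
have wk : `|k t| `^ p = k t * w t by rewrite mulr_sgp // subrK.
by rewrite wk {1}aE {1}bE; ring.
Qed.

Let x t : R := pos c t 0 0.
Let y t : R := pos c t 0 1.

Lemma euler_lagrange : exists (kh : R -> R) (C0 C1 c0 : R),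
  [/\ {within `[0, L], continuous kh},
      {ae mu, forall t, 0 < t < L -> a t = - kh t * v t /\ b t = kh t * u t},
      forall t, 0 <= t <= L -> p * sgp (p - 1) (kh t) = C1 * x t - C0 * y t + c0,
      forall t, 0 < t < L ->
        [/\ is_derive t 1 x (u t), is_derive t 1 y (v t),
            is_derive t 1 u (- kh t * v t) & is_derive t 1 v (kh t * u t)] &
      forall t, 0 < t < L -> (p - 1) * `|kh t| `^ p = lam + C0 * u t + C1 * v t].
Proof.
have le01 : `|0 : R| <= 1 by rewrite normr0.
have le11 : `|1 : R| <= 1 by rewrite normr1.
have [c0 [d0 E0]] := dbr_second L0 (@Ai 1 0) (@Bi 1 0)
  (fun z M mz zM z1 z2 => euler_lagrange_weak le11 le01 mz zM z1 z2).
have [c1 [d1 E1]] := dbr_second L0 (@Ai 0 1) (@Bi 0 1)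
  (fun z M mz zM z1 z2 => euler_lagrange_weak le01 le11 mz zM z1 z2).
pose A0 t : R := iab 0 t (Bmom 1 0) + (c0 + d0 * t).
pose A1 t : R := iab 0 t (Bmom 0 1) + (c1 + d1 * t).
have linc (c' d : R) : {within `[0, L], continuous (fun t : R => c' + d * t)}.
  apply: continuous_subspaceT; apply: (is_derive_continuous (df := fun=> d)) => t.
  by under eq_fun do rewrite addrC; exact: is_derive_affine.
have A0c : {within `[0, L], continuous A0}.
  apply: within_add; last exact: linc.
  exact: prim_continuous (ltW L0) (@Bi 1 0).
have A1c : {within `[0, L], continuous A1}.
  apply: within_add; last exact: linc.
  exact: prim_continuous (ltW L0) (@Bi 0 1).
pose wh t : R := (u t * A1 t - v t * A0 t) * p^-1.
have whc : {within `[0, L], continuous wh}.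
  by apply: within_mul; [apply: within_sub; exact: within_mul|exact: within_const].
pose kh t : R := sgp (p - 1)^-1 (wh t).
have khc : {within `[0, L], continuous kh}.
  apply: within_comp whc _ => t; apply: continuous_sgp; by rewrite invr_gt0.
have sgkh t : sgp (p - 1) (kh t) = wh t by rewrite sgpVK.
have uvoo t : 0 < t < L -> u t ^+ 2 + v t ^+ 2 = 1.
  by move=> /andP[/ltW t0 /ltW tL]; apply: uv1; rewrite t0.
have Aae : {ae mu, forall t, 0 < t < L ->
    [/\ - (p * w t * v t) = A0 t, p * w t * u t = A1 t & k t = kh t]}.
  move: E0 E1; apply: filterS2; first exact: (ae_filter_ringOfSetsType mu).
  move=> t H0 H1 tL; have F0 := H0 tL; have F1 := H1 tL.
  have G0 : - (p * w t * v t) = A0 t by rewrite /A0 -F0 /Amom; ring.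
  have G1 : p * w t * u t = A1 t by rewrite /A1 -F1 /Amom; ring.
  split=> //; rewrite /kh (_ : wh t = w t) ?sgpK // /wh -G0 -G1.
  transitivity (p * w t * (u t ^+ 2 + v t ^+ 2) * p^-1); first by ring.
  by rewrite (uvoo _ tL); field; rewrite gt_eqF.
have acc_kh : {ae mu, forall t, 0 < t < L -> a t = - kh t * v t /\ b t = kh t * u t}.
  move: acc_ae Aae; apply: filterS2; first exact: (ae_filter_ringOfSetsType mu).
  by move=> t H1 H2 tL; have [_ _ <-] := H2 tL; exact: H1.
have pr_ae (f g : R -> R) : itg 0 L f -> itg 0 L g ->
    {ae mu, forall t, 0 < t < L -> f t = g t} ->
    forall t, 0 <= t <= L -> iab 0 t f = iab 0 t g.
  move=> fi gi fg t /andP[t0 tL]; apply: ae_eq_iab; [exact: itgS fi|exact: itgS gi|].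
  move: fg; apply: filterS; first exact: (ae_filter_ringOfSetsType mu).
  by move=> s H /andP[s0 st]; apply: H; rewrite s0 (lt_le_trans st).
have nkvc : {within `[0, L], continuous (fun t => - kh t * v t)}.
  by apply: within_mul => // t; exact: cvgN (khc t).
have kuc : {within `[0, L], continuous (fun t => kh t * u t)} by exact: within_mul.
have Du t : 0 < t < L -> is_derive t 1 u (- kh t * v t).
  apply: (is_derive_prim_within nkvc (F0 := u 0)) => {}t tL.
  have -> : u t = u 0 + iab 0 t a by exact: vel_prim.
  congr (_ + _); apply: pr_ae tL => //; first exact: itg_continuous.
  move: acc_kh; apply: filterS; first exact: (ae_filter_ringOfSetsType mu).
  by move=> s H /H[].
have Dv t : 0 < t < L -> is_derive t 1 v (kh t * u t).
  apply: (is_derive_prim_within kuc (F0 := v 0)) => {}t tL.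
  have -> : v t = v 0 + iab 0 t b by exact: vel_prim.
  congr (_ + _); apply: pr_ae tL => //; first exact: itg_continuous.
  move: acc_kh; apply: filterS; first exact: (ae_filter_ringOfSetsType mu).
  by move=> s H /H[].
have Dx t : 0 < t < L -> is_derive t 1 x (u t).
  apply: (is_derive_prim_within uc (F0 := x 0)) => {}t tL.
  exact: pos_prim.
have Dy t : 0 < t < L -> is_derive t 1 y (v t).
  apply: (is_derive_prim_within vc (F0 := y 0)) => {}t tL.
  exact: pos_prim.
pose B t : R := (1 - 2 * p) * `|kh t| `^ p + lam.
have Bc : {within `[0, L], continuous B}.
  apply: within_add; last exact: within_const.
  apply: within_mul; first exact: within_const.
  by apply: (within_comp (g := fun r : R => `|r| `^ p) khc) => t; exact: continuous_normp.
have DA (e0 e1 c' d : R) t : 0 < t < L ->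
    is_derive t 1 (fun t => iab 0 t (Bmom e0 e1) + (c' + d * t))
      (B t * (e0 * u t + e1 * v t) + d).
  move=> tL; have Bhc : {within `[0, L], continuous (fun t => B t * (e0 * u t + e1 * v t))}.
    by apply: within_mul => //; exact: dirc2.
  have H : is_derive t 1 (fun t => iab 0 t (Bmom e0 e1)) (B t * (e0 * u t + e1 * v t)).
    apply: (is_derive_prim_within Bhc (F0 := 0)) tL => s sL; rewrite add0r.
    apply: pr_ae => //; first exact: itg_continuous.
    move: Aae; apply: filterS; first exact: (ae_filter_ringOfSetsType mu).
    by move=> r Hr /Hr[_ _ kE]; rewrite /Bmom kE.
  apply: (is_derive_eq (is_derive_add H (is_derive_add (is_derive_const c' t)
    (is_derive_cmul d (is_derive_id t 1))))).
  by rewrite mulr1 add0r.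
have DA0 t : 0 < t < L -> is_derive t 1 A0 (B t * u t + d0).
  by move=> tL; apply: (is_derive_eq (@DA 1 0 c0 d0 t tL)); ring.
have DA1 t : 0 < t < L -> is_derive t 1 A1 (B t * v t + d1).
  by move=> tL; apply: (is_derive_eq (@DA 0 1 c1 d1 t tL)); ring.
have ort t : 0 < t < L -> u t * A0 t + v t * A1 t = 0.
  apply: (continuous_ae_eq0 (f := fun t => u t * A0 t + v t * A1 t) (ltW L0)).
    by apply: within_add; exact: within_mul.
  move: Aae; apply: filterS; first exact: (ae_filter_ringOfSetsType mu).
  by move=> s H /H[<- <- _]; ring.
have tang t : 0 < t < L -> v t * A1 t = - (u t * A0 t).
  by move=> tL; apply/eqP; rewrite -addr_eq0 addrC ort.
exists kh, d0, d1, (p * wh 0 - (d1 * x 0 - d0 * y 0)); split => //.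
- move=> t tL; rewrite sgkh.
  have Dc s : 0 < s < L -> is_derive s 1
      (fun t => (u t * A1 t - v t * A0 t) - (d1 * x t - d0 * y t)) 0.
    move=> sL; apply: (is_derive_eq (is_derive_sub
      (is_derive_sub (is_derive_mul (Du _ sL) (DA1 _ sL)) (is_derive_mul (Dv _ sL) (DA0 _ sL)))
      (is_derive_sub (is_derive_cmul d1 (Dx _ sL)) (is_derive_cmul d0 (Dy _ sL))))).
    transitivity (- kh s * (v s * A1 s) - kh s * (u s * A0 s)); first by ring.
    by rewrite tang //; ring.
  have xc : {within `[0, L], continuous x} by exact/within_coord/pos_continuous.
  have yc : {within `[0, L], continuous y} by exact/within_coord/pos_continuous.
  have cc : {within `[0, L], continuous
      (fun t => (u t * A1 t - v t * A0 t) - (d1 * x t - d0 * y t))}.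
    apply: within_sub; first by apply: within_sub; exact: within_mul.
    by apply: within_sub; apply: within_mul => //; exact: within_const.
  have := within_derive0_const cc Dc tL.
  have pwh s : u s * A1 s - v s * A0 s = p * wh s by rewrite /wh; field; rewrite gt_eqF.
  rewrite !pwh => E; rewrite -E; ring.
- by move=> t tL; split; [exact: Dx|exact: Dy|exact: Du|exact: Dv].
- move=> t tL.
  have near_eq : \forall s \near t, u s * A0 s + v s * A1 s = 0.
    by apply: filterS (near_itvoo tL) => s; exact: ort.
  have [_] := near_eq_is_derive near_eq (is_derive_add
    (is_derive_mul (Du _ tL) (DA0 _ tL)) (is_derive_mul (Dv _ tL) (DA1 _ tL))).
  have [_ ->] := is_derive_const (0 : R) t.
  have pw : u t * A1 t - v t * A0 t = p * sgp (p - 1) (kh t).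
    by rewrite sgkh /wh; field; rewrite gt_eqF.
  have kk : kh t * sgp (p - 1) (kh t) = `|kh t| `^ p by rewrite mulr_sgp // subrK.
  have uv := uvoo t tL.
  move=> E.
  have E' : 0 = kh t * (u t * A1 t - v t * A0 t) + B t * (u t ^+ 2 + v t ^+ 2)
    + d0 * u t + d1 * v t by rewrite E; ring.
  rewrite uv pw /B in E'.
  have {}E' : 0 = p * `|kh t| `^ p + ((1 - 2 * p) * `|kh t| `^ p + lam) + d0 * u t + d1 * v t.
    by rewrite E' -kk; ring.
  by apply/eqP; rewrite -subr_eq0; apply/eqP; rewrite -[RHS]oppr0 [in RHS]E'; ring.
Qed.

End EulerLagrange.

Section PeriodicExtension.
Context {R : realType}.
Implicit Types (s t x y T : R) (f g : R -> R).

Lemma periodic_shift f T : (forall t, f (t + T) = f t) ->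
  forall (n : int) t, f (t + T *~ n) = f t.
Proof.
move=> fT; have nat_case (n : nat) t : f (t + T *+ n) = f t.
  elim: n t => [|n IH] t; first by rewrite addr0.
  by rewrite mulrS addrA IH fT.
move=> [n|n] t; first by rewrite -pmulrn nat_case.
by rewrite NegzE -[LHS](nat_case n.+1) mulrNz -pmulrn subrK.
Qed.

Lemma floor_split T t : 0 < T ->
  exists (n : int) s, 0 <= s < T /\ t = s + T *~ n.
Proof.
move=> T0; exists (Num.floor (t / T)), (t - T *~ Num.floor (t / T)).
rewrite subrK; split=> //; rewrite -mulrzr.
have H := floor_itv (t / T).
move: H => /andP[H1 H2]; apply/andP; split.
  by rewrite subr_ge0 mulrC -ler_pdivlMr.
move: H2; rewrite ltr_pdivrMr // intrD mulr1z => H2; lra.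
Qed.

Lemma periodic_derive f g T : 0 < T ->
  (forall t, f (t + T) = f t) -> (forall t, g (t + T) = g t) ->
  continuous f -> continuous g ->
  (forall t, 0 < t < T -> is_derive t 1 f (g t)) ->
  forall t, is_derive t 1 f (g t).
Proof.
move=> T0 fT gT fc gc fd.
have shift (n : int) s : 0 < s < T -> is_derive (s + T *~ n) 1 f (g (s + T *~ n)).
  move=> sT; have E : s + T *~ n - T *~ n = s by rewrite addrK.
  have D : is_derive (s + T *~ n) 1 (fun t : R => 1 * t - T *~ n) 1.
    exact: is_derive_affine.
  have fds : is_derive (1 * (s + T *~ n) - T *~ n) 1 f (g s).
    by rewrite mul1r E; exact: fd.
  have := @is_derive_comp R f (fun t : R => 1 * t - T *~ n) _ _ _ fds D; rewrite mulr1.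
  rewrite (periodic_shift gT).
  rewrite (_ : (fun t => f (1 * t - T *~ n)) = f) //.
  by apply/funext => t; rewrite mul1r -mulrNz (periodic_shift fT).
move=> t; have [n [s [/andP[s0 sT] ->]]] := floor_split t T0.
move: s0; rewrite le_eqVlt => /predU1P[<-|s0]; last by apply: shift; rewrite s0.
rewrite add0r; apply: (is_derive_extend T0 _ (fc _) (gc _)) => x xn xN.
have [lt|gt|/eqP] := ltgtP x (T *~ n); last by rewrite (negbTE xN).
  have -> : x = (x - T *~ n + T) + T *~ (n - 1).
    by rewrite mulrzBr mulr1z; ring.
  apply: shift; move: xn; rewrite ltr0_norm ?subr_lt0 // opprB => xn.
  by apply/andP; split; lra.
have -> : x = (x - T *~ n) + T *~ n by rewrite subrK.
apply: shift; move: xn; rewrite gtr0_norm ?subr_gt0 // => xn.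
by rewrite gt xn.
Qed.

Lemma periodic_eq0 f T : 0 < T -> (forall t, f (t + T) = f t) -> continuous f ->
  (forall t, 0 < t < T -> f t = 0) -> forall t, f t = 0.
Proof.
move=> T0 fT fc f0 t; have [n [s [/andP[s0 sT] ->]]] := floor_split t T0.
rewrite (periodic_shift fT); move: s0; rewrite le_eqVlt => /predU1P[<-|s0]; last first.
  by apply: f0; rewrite s0.
have fr : f x @[x --> (0 : R)^'+] --> f 0.
  by apply: cvg_at_right_filter; exact: fc.
have f0r : f x @[x --> (0 : R)^'+] --> (0 : R).
  apply: cvg_near_cst; near=> x; apply: f0; apply/andP; split.
    by near: x; exact: nbhs_right_gt.
  by near: x; exact: nbhs_right_lt.
by rewrite -(cvg_lim (@Rhausdorff R) fr) (cvg_lim (@Rhausdorff R) f0r).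
Unshelve. all: by end_near. Qed.

End PeriodicExtension.

Section Extremals.
Context {R : realType}.
Notation mu := (@lebesgue_measure R).
Implicit Types (s t : R).

Record extremal (p L lam C0 C1 : R) (x y u v k : R -> R) : Prop := Extremal {
  ext_x : forall t : R, is_derive t 1 x (u t);
  ext_y : forall t : R, is_derive t 1 y (v t);
  ext_u : forall t : R, is_derive t 1 u (- k t * v t);
  ext_v : forall t : R, is_derive t 1 v (k t * u t);
  ext_w : forall t : R, is_derive t 1 (fun s => p * sgp (p - 1) (k s))
    (C1 * u t - C0 * v t);
  ext_energy : forall t, (p - 1) * `|k t| `^ p = lam + C0 * u t + C1 * v t;
  ext_unit : forall t, u t ^+ 2 + v t ^+ 2 = 1;
  ext_k : continuous k;
  ext_xL : forall t, x (t + L) = x t;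
  ext_yL : forall t, y (t + L) = y t;
  ext_uL : forall t, u (t + L) = u t;
  ext_vL : forall t, v (t + L) = v t;
  ext_kL : forall t, k (t + L) = k t }.

Lemma coord_derive1 (f : R -> plane R) (t : R) i : derivable f t 1 ->
  is_derive t 1 (fun s => f s 0 i) (derive1 f t 0 i).
Proof.
move=> fd; have fi : derivable (fun s => f s 0 i) t 1.
  by move/derivable_mxP: fd => /(_ 0 i).
apply: DeriveDef => //.
by rewrite derive1E derive_mx // mxE.
Qed.

Lemma circle_map_pos (p L : R) (c : W2p p L) t : 0 < L -> 0 <= t < L ->
  circle_map c (L^-1 * t) = pos c t.
Proof.
move=> L0 /andP[t0 tL]; rewrite /circle_map.
have -> : Num.floor (L^-1 * t) = 0.
  apply: floor_def; rewrite mulr0z add0r.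
  by rewrite mulr1z mulrC divr_ge0 ?(ltW L0) // ltr_pdivrMr // mul1r.
by rewrite mulr0z subr0 mulrA mulfV ?mul1r // gt_eqF.
Qed.

Lemma elastica_extremal (p L lam : R) (c : W2p p L) : 1 < p -> 0 < L ->
  arclength_parametrized c -> C1_closed c -> first_variation_vanishes lam c ->
  C1_immersed_circle (circle_map c) ->
  exists (C0 C1 : R) (x y u v k : R -> R),
    [/\ extremal p L lam C0 C1 x y u v k,
        forall t, circle_map c t = vec2 (x (L * t)) (y (L * t)),
        forall t, 0 <= t <= L -> pos c t = vec2 (x t) (y t),
        forall t, 0 <= t <= L -> vel c t = vec2 (u t) (v t) &
        {ae mu, forall t, 0 < t < L -> acc c t = vec2 (- k t * v t) (k t * u t)}].
Proof.
move=> p1 L0 arcl [pcl vcl] fv [Gper Gd Gc _].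
have LN0 := lt0r_neq0 L0.
have [kh [C0 [C1 [c0 [khc kae kw kd ken]]]]] := euler_lagrange p1 L0 arcl fv.
pose G := circle_map c.
pose x t : R := G (L^-1 * t) 0 0; pose y t : R := G (L^-1 * t) 0 1.
pose u t : R := L^-1 * derive1 G (L^-1 * t) 0 0.
pose v t : R := L^-1 * derive1 G (L^-1 * t) 0 1.
have Dlin t : is_derive t 1 (fun s : R => L^-1 * s) L^-1.
  by apply: (is_derive_eq (is_derive_cmul L^-1 (is_derive_id t 1))); rewrite mulr1.
have Dx t : is_derive t 1 x (u t).
  apply: (is_derive_eq (is_derive_comp (coord_derive1 0 (Gd _)) (Dlin t))).
  by rewrite mulrC.
have Dy t : is_derive t 1 y (v t).
  apply: (is_derive_eq (is_derive_comp (coord_derive1 1 (Gd _)) (Dlin t))).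
  by rewrite mulrC.
have Gc' i : continuous (fun t : R => derive1 G t 0 i).
  move=> t; exact: (cvg_comp _ (fun M : plane R => M 0 i) (Gc t) (@coord_continuous R 1 2 0 i _)).
have linc : continuous (fun s : R => L^-1 * s) by exact: is_derive_continuous Dlin.
have uc : continuous u.
  apply: continuous_mul; first exact: continuous_const.
  exact: (continuous_compose linc (Gc' 0)).
have vc : continuous v.
  apply: continuous_mul; first exact: continuous_const.
  exact: (continuous_compose linc (Gc' 1)).
have argL t : L^-1 * (t + L) = L^-1 * t + 1 by rewrite mulrDr mulVf.
have xL t : x (t + L) = x t by rewrite /x argL /G Gper.
have yL t : y (t + L) = y t by rewrite /y argL /G Gper.
have derL (f : R -> R) (df : R -> R) : (forall t, is_derive t 1 f (df t)) ->
    (forall t, f (t + L) = f t) -> forall t, df (t + L) = df t.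
  move=> Df fL t; have [_ <-] := Df t.
  have D : is_derive t 1 (fun s => 1 * s + L) 1 by exact: is_derive_affine.
  have Df' : is_derive (1 * t + L) 1 f (df (t + L)) by rewrite mul1r; exact: Df.
  have := @is_derive_comp R f (fun s : R => 1 * s + L) _ _ _ Df' D; rewrite mulr1.
  rewrite (_ : (fun s => f (1 * s + L)) = f); first by case.
  by apply/funext => s; rewrite mul1r fL.
have uL := derL _ _ Dx xL; have vL := derL _ _ Dy yL.
pose w t : R := (C1 * x t - C0 * y t + c0) * p^-1.
pose k t : R := sgp (p - 1)^-1 (w t).
have p10 : 0 < p - 1 by rewrite subr_gt0.
have p0 : 0 < p by rewrite (lt_trans ltr01).
have Dw t : is_derive t 1 (fun s => p * sgp (p - 1) (k s)) (C1 * u t - C0 * v t).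
  rewrite (_ : (fun s => _) = fun s => C1 * x s - C0 * y s + c0); last first.
    by apply/funext => s; rewrite /k sgpVK // /w mulrC divfK ?gt_eqF.
  apply: (is_derive_eq (is_derive_add (is_derive_sub (is_derive_cmul C1 (Dx t))
    (is_derive_cmul C0 (Dy t))) (is_derive_const c0 t))).
  by rewrite addr0.
have wc : continuous w.
  move=> t; apply: cvgM; last exact: cvg_cst.
  apply: cvgD; last exact: cvg_cst.
  by apply: cvgB; apply: cvgM; [exact: cvg_cst|exact: is_derive_cont (Dx t)|
    exact: cvg_cst|exact: is_derive_cont (Dy t)].
have kc : continuous k.
  by apply: continuous_compose wc _ => t; apply: continuous_sgp; rewrite invr_gt0.
have kL t : k (t + L) = k t by rewrite /k /w xL yL.
have posco t : 0 <= t < L -> G (L^-1 * t) = pos c t by exact: circle_map_pos.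
have xpos t : 0 <= t <= L -> x t = pos c t 0 0 /\ y t = pos c t 0 1.
  move=> /andP[t0]; rewrite le_eqVlt => /predU1P[->|tL]; last first.
    by rewrite /x /y posco // t0.
  have -> : x L = x 0 by rewrite -[in LHS](add0r L) xL.
  have -> : y L = y 0 by rewrite -[in LHS](add0r L) yL.
  by rewrite /x /y posco ?lexx // pcl.
have kin t : 0 <= t <= L -> k t = kh t.
  move=> tL; have [xt yt] := xpos t tL.
  rewrite /k /w xt yt -kw // mulrC mulrA mulVf ?gt_eqF // mul1r sgpK //.
have near_x t : 0 < t < L -> \forall s \near t, pos c s 0 0 = x s /\ pos c s 0 1 = y s.
  move=> tL; apply: filterS (near_itvoo tL) => s /andP[/ltW s0 /ltW sL].
  by have [|-> ->] := xpos s; rewrite ?s0.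
have velin t : 0 < t < L -> vel c t 0 0 = u t /\ vel c t 0 1 = v t.
  move=> tL; have [D1 D2 _ _] := kd t tL; split.
    have [_ <-] := near_eq_is_derive (filterS (fun s => @proj1 _ _) (near_x t tL)) D1.
    by have [_ ->] := Dx t.
  have [_ <-] := near_eq_is_derive (filterS (fun s => @proj2 _ _) (near_x t tL)) D2.
  by have [_ ->] := Dy t.
have near_u t : 0 < t < L -> \forall s \near t, vel c s 0 0 = u s.
  by move=> tL; apply: filterS (near_itvoo tL) => s /velin[].
have near_v t : 0 < t < L -> \forall s \near t, vel c s 0 1 = v s.
  by move=> tL; apply: filterS (near_itvoo tL) => s /velin[].
have inL t : 0 < t < L -> 0 <= t <= L by move=> /andP[/ltW -> /ltW ->].
have Du : forall t, is_derive t 1 u (- k t * v t).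
  apply: (periodic_derive L0 uL _ uc).
  - by move=> t; rewrite kL vL.
  - by apply: continuous_mul vc => t; exact: cvgN (kc t).
  - move=> t tL; have [_ _ D3 _] := kd t tL.
    have := near_eq_is_derive (near_u t tL) D3.
    by have [_ ->] := velin t tL; rewrite kin // inL.
have Dv : forall t, is_derive t 1 v (k t * u t).
  apply: (periodic_derive L0 vL _ vc).
  - by move=> t; rewrite kL uL.
  - exact: (continuous_mul kc uc).
  - move=> t tL; have [_ _ _ D4] := kd t tL.
    have := near_eq_is_derive (near_v t tL) D4.
    by have [-> _] := velin t tL; rewrite kin // inL.
have un t : u t ^+ 2 + v t ^+ 2 = 1.
  apply/eqP; rewrite -subr_eq0; apply/eqP.
  apply: (@periodic_eq0 R (fun t => u t ^+ 2 + v t ^+ 2 - 1) L L0).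
  - by move=> s; rewrite uL vL.
  - apply: continuous_sub; last exact: continuous_const.
    by apply: continuous_add; [exact: (continuous_mul uc uc)|exact: (continuous_mul vc vc)].
  - move=> s sL; have [<- <-] := velin s sL.
    by rewrite (vel_unit arcl) ?inL // subrr.
have en t : (p - 1) * `|k t| `^ p = lam + C0 * u t + C1 * v t.
  apply/eqP; rewrite -subr_eq0; apply/eqP.
  apply: (@periodic_eq0 R (fun t => (p - 1) * `|k t| `^ p -
    (lam + C0 * u t + C1 * v t)) L L0).
  - by move=> s; rewrite uL vL kL.
  - apply: continuous_sub.
      apply: continuous_mul; first exact: continuous_const.
      by apply: (continuous_compose (g := fun r : R => `|r| `^ p) kc) => s; exact: continuous_normp.
    apply: continuous_add; first apply: continuous_add.
    + exact: continuous_const.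
    + exact: (continuous_mul (@continuous_const _ _) uc).
    + exact: (continuous_mul (@continuous_const _ _) vc).
  - move=> s sL; have := ken s sL; have [-> ->] := velin s sL.
    by rewrite -kin ?inL // => ->; rewrite subrr.
have velcc t : 0 <= t <= L -> vel c t 0 0 = u t /\ vel c t 0 1 = v t.
  have edge i (f : R -> R) : continuous f ->
      (forall s, 0 < s < L -> vel c s 0 i = f s) -> vel c 0 0 i = f 0.
    move=> fc H; have cv := @within_coord R _ _ i (@vel_continuous _ _ _ c).
    have [_ H0 _] := (continuous_within_itvP _ L0).1 cv.
    have fr : f s @[s --> (0 : R)^'+] --> f 0 by apply: cvg_at_right_filter; exact: fc.
    apply: (cvg_unique (@Rhausdorff R) H0); apply: cvg_trans fr.
    apply: near_eq_cvg; near=> s; rewrite H //; apply/andP; split.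
      by near: s; exact: nbhs_right_gt.
    by near: s; exact: nbhs_right_lt.
  have v0 : vel c 0 0 0 = u 0 /\ vel c 0 0 1 = v 0.
    by split; apply: edge => // s /velin[].
  move=> /andP[]; rewrite le_eqVlt => /predU1P[<- //|t0].
  rewrite le_eqVlt => /predU1P[->|tL]; last by apply: velin; rewrite t0.
  have u0L : u L = u 0 by rewrite -(uL 0) add0r.
  have v0L : v L = v 0 by rewrite -(vL 0) add0r.
  by rewrite -vcl u0L v0L.
exists C0, C1, x, y, u, v, k; split.
- by split.
- move=> t; have E : L^-1 * (L * t) = t by rewrite mulrA mulVf ?mul1r.
  by apply: plane_eq; rewrite ?vec2_0 ?vec2_1 /x /y E.
- by move=> t /xpos[-> ->]; apply: plane_eq; rewrite ?vec2_0 ?vec2_1.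
- by move=> t /velcc[<- <-]; apply: plane_eq; rewrite ?vec2_0 ?vec2_1.
- move: kae; apply: filterS; first exact: (ae_filter_ringOfSetsType mu).
  move=> t H tL; have [a0 a1] := H tL; have [v0 v1] := velin t tL.
  by apply: plane_eq; rewrite ?vec2_0 ?vec2_1 kin ?inL // -?v0 -?v1.
Unshelve. all: by end_near. Qed.

End Extremals.

Section Toolbox.
Context {R : realType}.
Implicit Types (s t x y a b : R) (f F : R -> R).

Lemma locally_constant (P : R -> Prop) a b : a <= b ->
  (forall t, a <= t <= b -> exists2 d, 0 < d &
    forall s, a <= s <= b -> `|s - t| < d -> (P s <-> P t)) -> (P a <-> P b).
Proof.
move=> ab H.
have /choice [d Hd] : forall t, exists d, a <= t <= b -> 0 < d /\
    forall s, a <= s <= b -> `|s - t| < d -> (P s <-> P t).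
  move=> t; have [/H[d d0 Hd]|ntab] := boolP (a <= t <= b); first by exists d.
  by exists 0.
pose I : set R := `[a, b]%classic.
pose B : set R := [set t | I t /\ (P t <-> P a)].
have inI t : I t -> a <= t <= b by rewrite /I /= in_itv.
have ballB t s : I t -> I s -> ball t (d t) s -> (P s <-> P t).
  move=> /inI It /inI Is; rewrite /ball /= => st; have [_] := Hd t It; apply => //.
  by rewrite distrC.
have self t : I t -> ball t (d t) t.
  by move=> /inI It; apply: ballxx; have [] := Hd t It.
have Ia : I a by rewrite /I /= in_itv /= lexx.
suff BI : B = I.
  by have [_ ->] : B b by rewrite BI /I /= in_itv /= lexx ab.
apply: (@segment_connected R a b).
- by exists a.
- exists (\bigcup_(t in B) ball t (d t)).
    by apply: bigcup_open => t _; exact: ball_open.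
  apply/seteqP; split => [t Bt|s [Is [t [It Pt] ts]]].
    by split; [case: Bt|exists t => //; apply: self; case: Bt].
  by split => //; have := ballB _ _ It Is ts; tauto.
- exists (~` \bigcup_(t in I `\` B) ball t (d t)).
    by apply: open_closedC; apply: bigcup_open => t _; exact: ball_open.
  apply/seteqP; split => [s [Is Ps]|s [Is ns]].
    split=> // -[t [It nBt] ts]; apply: nBt; split=> //.
    by have := ballB _ _ It Is ts; tauto.
  apply: contrapT => nBs; apply: ns; exists s => //; exact: self.
Qed.

Lemma normp_MVT (p a b : R) : 1 < p -> exists x,
  [/\ Num.min a b <= x, x <= Num.max a b &
      `|a| `^ p - `|b| `^ p = p * sgp (p - 1) x * (a - b)].
Proof.
move=> p1; wlog ab : a b / a <= b.
  move=> W; case/orP: (le_total a b) => [/W //|/W[x [H1 H2 H3]]].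
  by exists x; rewrite minC maxC; split=> //; lra.
move: ab; rewrite le_eqVlt => /predU1P[->|ab].
  by exists b; rewrite minxx maxxx lexx !subrr mulr0.
have [c /andP[ac cb] E] := MVT_is_derive_cc ab (fun x _ => is_derive_normp x p1).
exists c; rewrite (min_idPl (ltW ab)) (max_idPr (ltW ab)); split; [exact: ltW..|].
by rewrite -opprB E; ring.
Qed.

Lemma normp_lip_unit (q a b : R) : 1 < q -> `|a| <= 1 -> `|b| <= 1 ->
  `| `|a| `^ q - `|b| `^ q | <= q * `|a - b|.
Proof.
move=> q1 a1 b1; have [xi [m1 m2 ->]] := normp_MVT a b q1.
have q0 : 0 < q by lra.
have q10 : 0 < q - 1 by lra.
rewrite [leLHS]normrM [`|q * _|]normrM (gtr0_norm q0); apply: ler_wpM2r => //.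
rewrite -[leRHS]mulr1; apply: ler_wpM2l; first exact: ltW.
have pw1 : (1 : R) `^ (q - 1) = 1 by rewrite powR1.
rewrite normr_sgp // -[leRHS]pw1; apply: ge0_ler_powR; rewrite ?nnegrE // ?(ltW q10) //.
move: a1 b1 m1 m2; rewrite !ler_norml ge_min le_max => /andP[h1 h1'] /andP[h2 h2'].
by move=> /orP m1 /orP m2; apply/andP; split; [case: m1|case: m2] => ?; lra.
Qed.

Lemma primitive_exists f : continuous f ->
  exists F, forall t, is_derive t 1 F (f t).
Proof.
move=> fc; pose F t : R := iab 0 t f - iab t 0 f; exists F => t.
have gt_iab a b : b <= a -> iab a b f = 0.
  rewrite le_eqVlt => /predU1P[->|ba]; first exact: iab_point.
  by rewrite /iab set_itv_ge ?Rintegral_set0 // bnd_simp -ltNge.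
have FE a s : a <= 0 -> a <= s -> F s = iab a s f - iab a 0 f.
  move=> a0 as_; rewrite /F; have [s0|/ltW s0] := leP 0 s.
    by rewrite (@iab_split R a 0 s) ?(gt_iab s 0) //; [ring|exact: continuous_itg].
  by rewrite (@iab_split R a s 0) ?(gt_iab 0 s) //; [ring|exact: continuous_itg].
pose a : R := - `|t| - 1.
have ta : a < t < t + 1.
  by rewrite /a; have := ler_norm (- t); rewrite normrN => H; apply/andP; split; lra.
have a0 : a <= 0 by rewrite /a; have := normr_ge0 t; lra.
apply: (@near_eq_is_derive R (fun s => iab a s f - iab a 0 f)).
  by apply: filterS (near_itvoo ta) => s /andP[/ltW ? _]; rewrite -FE.
apply: (is_derive_eq (is_derive_sub (prim_derive ta _) (is_derive_const (iab a 0 f) t))).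
  exact: continuous_subspaceT.
by rewrite subr0.
Qed.

Lemma increasing_inverse F f (m : R) : 0 < m ->
  (forall t, is_derive t 1 F (f t)) -> (forall t, m <= f t) ->
  exists G : R -> R, [/\ cancel F G, cancel G F &
    forall y, is_derive y 1 G (f (G y))^-1].
Proof.
move=> m0 DF mf.
have Flt x y : x < y -> F x < F y.
  by move=> xy; apply: (is_derive_lt xy (fun t _ => DF t)) => t _; exact: lt_le_trans (mf t).
have Fc := is_derive_continuous DF.
have grow x y : x <= y -> m * (y - x) <= F y - F x.
  move=> xy; have D t : is_derive t 1 (fun t => F t - m * t) (f t - m).
    apply: (is_derive_eq (is_derive_sub (DF t) (is_derive_cmul m (is_derive_id t 1)))).
    by rewrite mulr1.
  have := is_derive_le xy (fun t _ => D t) (fun t _ => _).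
  have fm t : 0 <= f t - m by rewrite subr_ge0.
  by move=> /(_ fm); lra.
have /choice [G FG] : forall y, exists t, F t = y.
  move=> y; pose T : R := `|y - F 0| / m.
  have T0 : 0 <= T by rewrite divr_ge0 // ltW.
  have mT : m * T = `|y - F 0| by rewrite mulrC divfK ?gt_eqF.
  have [] := @IVT R F (- T) T y; first by lra.
  - exact: continuous_subspaceT.
  - have H1 := grow _ _ T0; have H2 : m * (0 - - T) <= F 0 - F (- T) by apply: grow; lra.
    rewrite sub0r opprK mT in H2; rewrite subr0 mT in H1.
    have H3 := ler_norm (y - F 0); have H4 := ler_norm (- (y - F 0)).
    rewrite normrN in H4; rewrite ge_min le_max; apply/andP; split; apply/orP; [left|right]; lra.
  - by move=> t _ Ft; exists t.
have GF : cancel F G.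
  move=> t; have := FG (F t); have [lt|lt|//] := ltgtP (G (F t)) t.
    by move=> E; have := Flt _ _ lt; rewrite E ltxx.
  by move=> E; have := Flt _ _ lt; rewrite E ltxx.
exists G; split => // y; rewrite -{1}(FG y).
apply: is_derive_inverse.
- by near=> s; exact: GF.
- by near=> s; exact: Fc.
- by rewrite gt_eqF // (lt_le_trans m0).
Unshelve. all: by end_near. Qed.

Lemma periodic_monotone f (df : R -> R) : (forall t, is_derive t 1 f (df t)) ->
  (forall t, 0 <= df t) -> (forall t, f (t + 1) = f t) -> forall t, df t = 0.
Proof.
move=> Df df0 f1 t; have mon x y : x <= y -> f x <= f y.
  by move=> xy; exact: (is_derive_le xy (fun s _ => Df s) (fun s _ => df0 s)).
have cst s : t - 2^-1 < s < t + 2^-1 -> f (t - 2^-1) = f s.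
  move=> /andP[s1 s2]; apply/eqP; rewrite eq_le mon ?(ltW s1) //=.
  by rewrite -(f1 (t - 2^-1)) mon //; lra.
have tin : t - 2^-1 < t < t + 2^-1 by apply/andP; split; lra.
have [_ <-] := Df t.
have E : {near t, (fun _ : R => f (t - 2^-1)) =1 f}.
  by apply: filterS (near_itvoo tin) => s /cst.
by have [_] := near_eq_is_derive E (is_derive_const _ t).
Qed.

Lemma gronwall_near (D dD : R -> R) (C t d : R) :
  (forall r : R, is_derive r 1 D (dD r)) ->
  (forall r, `|r - t| < d -> `|dD r| <= C * `|D r|) -> D t = 0 ->
  forall s, `|s - t| < d -> D s = 0.
Proof.
move=> DD lip Dt s st; have [ts|/ltW ts] := leP t s.
  have [|H _] := @gronwall0 R D dD C t s ts (fun r _ => DD r); last exact: H.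
  move=> r /andP[r1 r2]; apply: lip; apply: le_lt_trans st.
  by rewrite !ger0_norm ?subr_ge0 // lerB.
have [|_ H] := @gronwall0 R D dD C s t ts (fun r _ => DD r); last exact: H.
move=> r /andP[r1 r2]; apply: lip; apply: le_lt_trans st.
by rewrite !ler0_norm ?subr_le0 // lerN2 lerB.
Qed.

End Toolbox.

Section WaveUniqueness.
Context {R : realType}.
Variables (p c : R) (p1 : 1 < p).
Implicit Types (r s t : R).

Record wave (x z : R -> R) : Prop := Wave {
  wave_x : forall t : R, is_derive t 1 x (z t);
  wave_w : forall t : R, is_derive t 1 (fun s => sgp (p - 1) (z s)) (- c * x t);
  wave_z : continuous z;
  wave_energy : forall t, `|z t| `^ p + x t ^+ 2 = 1 }.

Variables (x1 z1 x2 z2 : R -> R).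
Hypotheses (w1 : wave x1 z1) (w2 : wave x2 z2).

Let P t := x1 t = x2 t /\ z1 t = z2 t.
Let p10 : 0 < p - 1. Proof. by rewrite subr_gt0. Qed.
Let p0 : 0 < p. Proof. exact: lt_trans p1. Qed.

Let xle (x z : R -> R) : wave x z -> forall t, `|x t| <= 1.
Proof.
move=> w t; have := wave_energy w t; have := powR_ge0 `|z t| p => H E.
by rewrite -[leRHS](ger0_norm ler01) -ler_sqr ?nnegrE // !real_normK ?num_real //; lra.
Qed.

Let near_close (f : R -> R) (e : R) t : continuous f -> 0 < e ->
  exists2 d, 0 < d & forall s, `|s - t| < d -> `|f s - f t| < e.
Proof.
move=> fc e0; have /cvgrPdist_lt/(_ _ e0) := fc t.
move=> /nbhs_ballP[d d0 Hd]; exists d => // s st.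
by rewrite distrC; apply: Hd; rewrite /ball /= distrC.
Qed.

(* The ODE is Lipschitz in [x] where [z] does not vanish. *)
Let local_z t : P t -> z1 t != 0 -> exists2 d, 0 < d &
  forall s, `|s - t| < d -> P s.
Proof.
move=> [xt zt] z0.
have e0 : 0 < `|z1 t| / 2 by rewrite divr_gt0 // normr_gt0.
have [d1 d10 H1] := near_close t (wave_z w1) e0.
have [d2 d20 H2] := near_close t (wave_z w2) e0.
pose d : R := Num.min d1 d2.
have key s : `|s - t| < d -> exists2 xi, `|z1 t| / 2 <= `|xi| &
    x2 s ^+ 2 - x1 s ^+ 2 = p * sgp (p - 1) xi * (z1 s - z2 s).
  rewrite lt_min => /andP[/H1 h1 /H2 h2]; rewrite -zt in h2.
  have [xi [m1 m2 E]] := normp_MVT (z1 s) (z2 s) p1; exists xi.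
    move: m1 m2 h1 h2; rewrite ge_min le_max !ltr_norml.
    move=> /orP m1 /orP m2 /andP[h1 h1'] /andP[h2 h2'].
    have [zp|zn] := leP 0 (z1 t).
      rewrite ger0_norm // in h1 h1' h2 h2' *; apply: le_trans (ler_norm xi).
      by case: m1 => ?; lra.
    rewrite ltr0_norm // in h1 h1' h2 h2' *; rewrite -[leRHS]normrN; apply: le_trans (ler_norm _).
    by case: m2 => ?; lra.
  by rewrite -E; have := wave_energy w1 s; have := wave_energy w2 s; lra.
pose m : R := p * (`|z1 t| / 2) `^ (p - 1).
have m0 : 0 < m by rewrite mulr_gt0 // powR_gt0.
have lip s : `|s - t| < d -> `|z1 s - z2 s| <= 2 / m * `|x1 s - x2 s|.
  move=> /key[xi xib E].
  have A : m * `|z1 s - z2 s| <= `|x2 s ^+ 2 - x1 s ^+ 2|.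
    rewrite E [leRHS]normrM [`|p * _|]normrM (gtr0_norm p0) normr_sgp //.
    apply: ler_wpM2r => //; apply: ler_wpM2l; first exact: ltW.
    by apply: ge0_ler_powR => //; rewrite ?nnegrE ltW.
  have B : `|x2 s ^+ 2 - x1 s ^+ 2| <= 2 * `|x1 s - x2 s|.
    rewrite subr_sqr normrM mulrC [`|x2 s - _|]distrC; apply: ler_wpM2r => //.
    apply: le_trans (ler_normD _ _) _.
    by have := xle w1 s; have := xle w2 s; lra.
  by rewrite mulrAC ler_pdivlMr // mulrC (le_trans A).
exists d; first by rewrite lt_min d10.
move=> s st; have E : x1 s - x2 s = 0.
  have D r : is_derive r 1 (fun r => x1 r - x2 r) (z1 r - z2 r).
    exact: is_derive_sub (wave_x w1 r) (wave_x w2 r).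
  by apply: (gronwall_near D lip) st; rewrite xt subrr.
have xs : x1 s = x2 s by apply/eqP; rewrite -subr_eq0 E.
split=> //; have := lip s st; rewrite E normr0 mulr0 normr_le0 subr_eq0.
by move/eqP.
Qed.

(* Where [z] vanishes, [x] is near [1] or [-1], and the ODE is Lipschitz in
   the momentum [sgp (p - 1) z] instead. *)
Let local_x t : P t -> z1 t = 0 -> exists2 d, 0 < d &
  forall s, `|s - t| < d -> P s.
Proof.
move=> [xt zt] z0.
have x1t : x1 t ^+ 2 = 1 by have := wave_energy w1 t; rewrite z0 normr0 powR0 ?gt_eqF //; lra.
have e0 : 0 < (2^-1 : R) by rewrite invr_gt0.
have [d1 d10 H1] := near_close t (is_derive_continuous (wave_x w1)) e0.
have [d2 d20 H2] := near_close t (is_derive_continuous (wave_x w2)) e0.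
pose d : R := Num.min d1 d2.
have far s : `|s - t| < d -> 1 <= `|x1 s + x2 s|.
  rewrite lt_min => /andP[/H1 h1 /H2 h2]; rewrite -xt in h2.
  move: h1 h2; rewrite !ltr_norml => /andP[h1 h1'] /andP[h2 h2'].
  have : (x1 t - 1) * (x1 t + 1) = 0 by rewrite -subr_sqr_1 x1t subrr.
  move/eqP; rewrite mulf_eq0 subr_eq0 addr_eq0 => /orP[]/eqP E; rewrite E in h1 h1' h2 h2'.
    by apply: le_trans (ler_norm _); lra.
  by rewrite -normrN; apply: le_trans (ler_norm _); lra.
have [q q1 wp] : exists2 q : R, 1 < q & forall z : R, `|sgp (p - 1) z| `^ q = `|z| `^ p.
  exists (p / (p - 1)) => [|z]; first by rewrite ltr_pdivlMr // mul1r gtrBl.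
  by rewrite normr_sgp // -powRrM mulrC divfK // gt_eqF.
have pw1 (r : R) : (1 : R) `^ r = 1 by rewrite powR1.
have wle (x z : R -> R) : wave x z -> forall s, `|sgp (p - 1) (z s)| <= 1.
  move=> w s; rewrite normr_sgp //.
  have z1' : `|z s| <= 1.
    rewrite leNgt; apply/negP => z_1.
    have : 1 < `|z s| `^ p by rewrite -[ltLHS](pw1 p); apply: gt0_ltr_powR; rewrite ?nnegrE.
    by have := wave_energy w s; have := sqr_ge0 (x s); lra.
  rewrite -[leRHS](pw1 (p - 1)); apply: ge0_ler_powR; rewrite ?nnegrE // ?ltW //.
pose W1 s := sgp (p - 1) (z1 s); pose W2 s := sgp (p - 1) (z2 s).
have lip s : `|s - t| < d -> `|x1 s - x2 s| <= q * `|W1 s - W2 s|.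
  move=> /far fs.
  have A : `|x1 s - x2 s| <= `|x1 s ^+ 2 - x2 s ^+ 2|.
    by rewrite subr_sqr normrM -[leLHS]mulr1; apply: ler_wpM2l.
  apply: le_trans A _.
  have -> : x1 s ^+ 2 - x2 s ^+ 2 = - (`|W1 s| `^ q - `|W2 s| `^ q).
    have e1 : x1 s ^+ 2 = 1 - `|W1 s| `^ q by rewrite wp -(wave_energy w1 s) addrC addKr.
    have e2 : x2 s ^+ 2 = 1 - `|W2 s| `^ q by rewrite wp -(wave_energy w2 s) addrC addKr.
    by rewrite e1 e2 !opprD !opprK addrACA subrr add0r.
  by rewrite normrN; apply: normp_lip_unit q1 _ _; apply: wle; eassumption.
exists d; first by rewrite lt_min d10.
move=> s st; have E : W1 s - W2 s = 0.
  have D r : is_derive r 1 (fun r => W1 r - W2 r) (- c * x1 r - - c * x2 r).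
    exact: is_derive_sub (wave_w w1 r) (wave_w w2 r).
  have B r : `|r - t| < d -> `|- c * x1 r - - c * x2 r| <= (`|c| * q) * `|W1 r - W2 r|.
    move=> /lip h; rewrite -mulrBr normrM normrN -mulrA; exact: ler_wpM2l.
  have Wt : W1 t - W2 t = 0 by rewrite /W1 /W2 zt subrr.
  exact: (gronwall_near D B Wt).
split.
  have := lip s st; rewrite E normr0 mulr0 normr_le0 subr_eq0.
  by move/eqP.
by apply: (can_inj (sgpK p10)); apply/eqP; rewrite -subr_eq0; apply/eqP.
Qed.

Lemma wave_unique : x1 0 = x2 0 -> z1 0 = z2 0 ->
  forall t, x1 t = x2 t /\ z1 t = z2 t.
Proof.
move=> x0 z0.
have loc t : exists2 d, 0 < d & forall s, `|s - t| < d -> (P s <-> P t).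
  have [Pt|nPt] := pselect (P t).
    have [z1t|z1t] := eqVneq (z1 t) 0.
      by have [d d0 H] := local_x Pt z1t; exists d => // s /H.
    by have [d d0 H] := local_z Pt z1t; exists d => // s /H.
  have cont (f g : R -> R) : continuous f -> continuous g -> f t != g t ->
      exists2 d, 0 < d & forall s, `|s - t| < d -> f s != g s.
    move=> fc gc fg; have h0 : 0 < `|f t - g t| by rewrite normr_gt0 subr_eq0.
    have [d d0 H] := @near_close (fun s => f s - g s) _ t (continuous_sub fc gc) h0.
    exists d => // s /H; apply: contraTneq => ->.
    by rewrite subrr sub0r normrN ltxx.
  have [x12|x12] := eqVneq (x1 t) (x2 t); last first.
    have [d d0 H] := cont _ _ (is_derive_continuous (wave_x w1)) (is_derive_continuous (wave_x w2)) x12.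
    by exists d => // s /H /eqP ns; split => // -[].
  have z12 : z1 t != z2 t by apply/eqP => z12; apply: nPt.
  have [d d0 H] := cont _ _ (wave_z w1) (wave_z w2) z12.
  by exists d => // s /H /eqP ns; split => // -[].
move=> t; have P0 : P 0 by [].
have locab a b : forall s, a <= s <= b -> exists2 d, 0 < d &
    forall r, a <= r <= b -> `|r - s| < d -> (P r <-> P s).
  by move=> s _; have [d d0 H] := loc s; exists d => // r _; exact: H.
have [t0|/ltW t0] := leP 0 t.
  by have [H _] := locally_constant t0 (locab 0 t); exact: H.
by have [_ H] := locally_constant t0 (locab t 0); exact: H.
Qed.

End WaveUniqueness.

Section Normalise.
Context {R : realType}.
Implicit Types (r s t : R).

Lemma sgpM (r a x : R) : 0 < a -> sgp r (a * x) = a `^ r * sgp r x.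
Proof.
move=> a0; rewrite /sgp sgrM (gtr0_sg a0) mul1r normrM (gtr0_norm a0).
by rewrite powRM ?(ltW a0) // mulrCA.
Qed.

Lemma extremal_normalise (p L lam C0 C1 : R) (x y u v k : R -> R) :
  1 < p -> 0 < L -> extremal p L lam C0 C1 x y u v k ->
  exists (A lam' e0 e1 : R), [/\ 0 <= A, e0 ^+ 2 + e1 ^+ 2 = 1 &
    extremal p 1 lam' A 0
      (fun t => L^-1 * (e0 * x (L * t) + e1 * y (L * t)))
      (fun t => L^-1 * (e0 * y (L * t) - e1 * x (L * t)))
      (fun t => e0 * u (L * t) + e1 * v (L * t))
      (fun t => e0 * v (L * t) - e1 * u (L * t))
      (fun t => L * k (L * t))].
Proof.
move=> p1 L0 E; have p0 : 0 < p by lra.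
have [N [e0 [e1 [N0 ee C0E C1E]]]] : exists N e0 e1 : R,
    [/\ 0 <= N, e0 ^+ 2 + e1 ^+ 2 = 1, C0 = N * e0 & C1 = N * e1].
  pose N := Num.sqrt (C0 ^+ 2 + C1 ^+ 2).
  have S0 : 0 <= C0 ^+ 2 + C1 ^+ 2 by rewrite addr_ge0 ?sqr_ge0.
  have [N0|N0] := eqVneq N 0.
    exists 0, 1, 0; rewrite !mul0r expr1n expr0n addr0; split=> //.
      have : C0 ^+ 2 + C1 ^+ 2 = 0 by rewrite -(sqr_sqrtr S0) -/N N0 expr0n.
      by move/eqP; rewrite paddr_eq0 ?sqr_ge0 // !sqrf_eq0 => /andP[/eqP ->].
    have : C0 ^+ 2 + C1 ^+ 2 = 0 by rewrite -(sqr_sqrtr S0) -/N N0 expr0n.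
    by move/eqP; rewrite paddr_eq0 ?sqr_ge0 // !sqrf_eq0 => /andP[_ /eqP ->].
  exists N, (C0 / N), (C1 / N); split.
  - exact: sqrtr_ge0.
  - rewrite !expr_div_n -mulrDl -(sqr_sqrtr S0) -/N divff // expf_neq0 //.
  - by rewrite mulrC divfK.
  - by rewrite mulrC divfK.
pose a : R := L `^ (p - 1).
have aL : L `^ p = L * a by rewrite /a mulr_powRB1 // ltW.
exists (L * a * N), (L * a * lam), e0, e1.
have Dl t : is_derive t 1 (fun s : R => L * s) L.
  by apply: (is_derive_eq (is_derive_cmul L (is_derive_id t 1))); rewrite mulr1.
have comp (f : R -> R) (df : R -> R) : (forall t : R, is_derive t 1 f (df t)) ->
    forall t, is_derive t 1 (fun s => f (L * s)) (df (L * t) * L).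
  move=> Df t; exact: (@is_derive_comp R f (fun s => L * s) t _ _ (Df (L * t)) (Dl t)).
have argL t : L * (t + 1) = L * t + L by rewrite mulrDr mulr1.
have LN0 : L != 0 by rewrite gt_eqF.
have A0 : 0 <= L * a * N by apply: mulr_ge0 N0; apply: mulr_ge0 (powR_ge0 _ _); exact: ltW.
split; [exact: A0|exact: ee|split].
- move=> t; apply: (is_derive_eq (is_derive_cmul L^-1 (is_derive_add
    (is_derive_cmul e0 (comp _ _ (ext_x E) t)) (is_derive_cmul e1 (comp _ _ (ext_y E) t))))).
  by field.
- move=> t; apply: (is_derive_eq (is_derive_cmul L^-1 (is_derive_sub
    (is_derive_cmul e0 (comp _ _ (ext_y E) t)) (is_derive_cmul e1 (comp _ _ (ext_x E) t))))).
  by field.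
- move=> t; apply: (is_derive_eq (is_derive_add
    (is_derive_cmul e0 (comp _ _ (ext_u E) t)) (is_derive_cmul e1 (comp _ _ (ext_v E) t)))).
  by ring.
- move=> t; apply: (is_derive_eq (is_derive_sub
    (is_derive_cmul e0 (comp _ _ (ext_v E) t)) (is_derive_cmul e1 (comp _ _ (ext_u E) t)))).
  by ring.
- move=> t; rewrite (_ : (fun s => _) = fun s => a * (p * sgp (p - 1) (k (L * s)))); last first.
    by apply/funext => s; rewrite sgpM // mulrCA.
  apply: (is_derive_eq (is_derive_cmul a (comp _ _ (ext_w E) t))).
  by rewrite C0E C1E; ring.
- move=> t; rewrite normrM (gtr0_norm L0) powRM ?(ltW L0) // aL.
  have := ext_energy E (L * t); rewrite C0E C1E => e.
  by rewrite mulrCA e; ring.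
- move=> t; have := ext_unit E (L * t) => e.
  rewrite -[RHS](mulr1 1) -{1}ee -e; ring.
- apply: continuous_mul; first exact: continuous_const.
  exact: (continuous_compose (is_derive_continuous Dl) (ext_k E)).
- by move=> t; rewrite argL (ext_xL E) (ext_yL E).
- by move=> t; rewrite argL (ext_xL E) (ext_yL E).
- by move=> t; rewrite argL (ext_uL E) (ext_vL E).
- by move=> t; rewrite argL (ext_uL E) (ext_vL E).
- by move=> t; rewrite argL (ext_kL E).
Qed.

Section Trichotomy.
Variables (p lam A : R) (x y u v k : R -> R).
Hypotheses (p1 : 1 < p) (E : extremal p 1 lam A 0 x y u v k).

Let p10 : 0 < p - 1. Proof. by rewrite subr_gt0. Qed.
Let p0 : 0 < p. Proof. exact: lt_trans p1. Qed.

Let energy t : (p - 1) * `|k t| `^ p = lam + A * u t.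
Proof. by rewrite (ext_energy E) mul0r addr0. Qed.

Lemma velocity_nonconstant (a b : R) : ~ (forall t, u t = a /\ v t = b).
Proof.
move=> H; have per (f df : R -> R) (c : R) : (forall t : R, is_derive t 1 f (df t)) ->
    (forall t, f (t + 1) = f t) -> (forall t, df t = c) -> c = 0.
  move=> Df f1 dfc; have [z _] := MVT_is_derive_cc (ltr01 : (0 : R) < 1) (fun t _ => Df t).
  by rewrite dfc -{1}[1]add0r f1 subrr subr0 mulr1.
have := per _ _ _ (ext_x E) (ext_xL E) (fun t => (H t).1).
have := per _ _ _ (ext_y E) (ext_yL E) (fun t => (H t).2) => b0 a0.
have := ext_unit E 0; have [-> ->] := H 0.
by rewrite a0 b0 !expr0n addr0 => /eqP; rewrite eq_sym oner_eq0.
Qed.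

Lemma u_le1 t : `|u t| <= 1.
Proof.
have := ext_unit E t; have := sqr_ge0 (v t) => h e.
by rewrite -[leRHS](ger0_norm ler01) -ler_sqr ?nnegrE // !real_normK ?num_real //; lra.
Qed.

Lemma extremal_circle : A = 0 -> exists2 kap, kap != 0 & forall t, k t = kap.
Proof.
move=> A0; have D t : is_derive t 1 (fun s => p * sgp (p - 1) (k s)) 0.
  by apply: (is_derive_eq (ext_w E t)); rewrite A0 !mul0r subrr.
have kc t : k t = k 0.
  have e : p * sgp (p - 1) (k t) = p * sgp (p - 1) (k 0).
    exact: (is_derive_0_is_cst t 0 D).
  apply: (can_inj (sgpK p10)); exact: (mulfI (lt0r_neq0 p0) e).
exists (k 0) => //; apply/eqP => k0; apply: (@velocity_nonconstant (u 0) (v 0)) => t.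
have Du s : is_derive s 1 u 0 by apply: (is_derive_eq (ext_u E s)); rewrite kc k0 oppr0 mul0r.
have Dv s : is_derive s 1 v 0 by apply: (is_derive_eq (ext_v E s)); rewrite kc k0 mul0r.
by split; [exact: (is_derive_0_is_cst t 0 Du)|exact: (is_derive_0_is_cst t 0 Dv)].
Qed.

(* If the energy level is too high, [v] is reflected at the zeros of [k] so
   that the reflected function has derivative [|k| u], which dominates a
   multiple of [u = x'] with equality only where [u = 0]. *)
Lemma extremal_lam_lt : 0 < A -> lam < A.
Proof.
move=> A0; rewrite ltNge; apply/negP => lamA.
have lam0 : 0 < lam by exact: lt_le_trans lamA.
pose P t : R := Num.sg (k t) * v t.
have DP t : is_derive t 1 P (`|k t| * u t).
  have [kt|kt] := eqVneq (k t) 0.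
    rewrite kt normr0 mul0r.
    have ut : u t = - 1.
      have := energy t; rewrite kt normr0 powR0 ?gt_eqF // mulr0 => e.
      have := u_le1 t; rewrite ler_norml => /andP[h _].
      have h2 : A * (u t + 1) <= 0 by rewrite mulrDr mulr1; lra.
      by rewrite pmulr_rle0 // in h2; lra.
    have vt : v t = 0.
      have := ext_unit E t; rewrite ut sqrrN expr1n => e.
      by apply/eqP; rewrite -sqrf_eq0; apply/eqP; lra.
    have /is_derive1_caratheodory[g [gE gc gt]] : is_derive t 1 v 0.
      by apply: (is_derive_eq (ext_v E t)); rewrite kt mul0r.
    apply/is_derive1_caratheodory; exists (fun s => Num.sg (k s) * g s); split.
    - move=> s; rewrite /P vt mulr0 subr0 -mulrA -gE vt subr0 //.
    - have gc0 : g s @[s --> t] --> (0 : R) by move: gc; rewrite /prop_for /continuous_at gt.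
      have e0 : (0 : R) = Num.sg (k t) * g t by rewrite gt mulr0.
      rewrite /prop_for /continuous_at -e0; apply/cvgr0Pnorm_lt => e epos.
      move/cvgr0Pnorm_lt : gc0 => /(_ _ epos).
      apply: filterS => s; apply: le_lt_trans; rewrite normrM -[leRHS]mul1r.
      by apply: ler_wpM2r => //; rewrite normr_sg; case: (k s != 0).
    - by rewrite gt mulr0.
  have kct : k s @[s --> t] --> k t by exact: (ext_k E).
  have kn : \forall s \near t, Num.sg (k s) = Num.sg (k t).
    have [kp|kn|k0] := ltgtP (k t) 0; last by rewrite k0 eqxx in kt.
      have : \forall s \near t, k s < 0 by exact: cvgr_lt kct _ kp.
      by apply: filterS => s ks; rewrite !ltr0_sg.
    have : \forall s \near t, 0 < k s by exact: cvgr_gt kct _ kn.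
    by apply: filterS => s ks; rewrite !gtr0_sg.
  apply: (@near_eq_is_derive R (fun s => Num.sg (k t) * v s)).
    by apply: filterS kn => s ks; rewrite /P ks.
  apply: (is_derive_eq (is_derive_cmul _ (ext_v E t))).
  by rewrite mulrA -normrEsg.
pose k0 : R := (lam / (p - 1)) `^ p^-1.
have k00 : 0 < k0 by rewrite powR_gt0 // divr_gt0.
have k0E : (p - 1) * k0 `^ p = lam.
  rewrite /k0 -powRrM mulVf ?gt_eqF // powRr1 ?divr_ge0 ?ltW //.
  by rewrite mulrC divfK // gt_eqF.
have cmp t : 0 <= u t * (`|k t| - k0).
  have e := energy t; rewrite -k0E in e.
  have [u0|u0] := leP 0 (u t).
    rewrite mulr_ge0 // subr_ge0 leNgt; apply/negP => kk.
    have : `|k t| `^ p < k0 `^ p by apply: gt0_ltr_powR; rewrite ?nnegrE // ltW.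
    rewrite -(ltr_pM2l p10) e.
    have Au : 0 <= A * u t by rewrite mulr_ge0 // ltW.
    by rewrite gtrDl ltNge Au.
  rewrite nmulr_rge0 // subr_le0 leNgt; apply/negP => kk.
  have : k0 `^ p < `|k t| `^ p by apply: gt0_ltr_powR; rewrite ?nnegrE // ltW.
  rewrite -(ltr_pM2l p10) e.
  have Au : A * u t < 0 by rewrite pmulr_rlt0.
  by rewrite ltrDl ltNge ltW.
have Z : forall t, u t * (`|k t| - k0) = 0.
  apply: (@periodic_monotone R (fun t => P t - k0 * x t) _ _ cmp) => t.
    apply: (is_derive_eq (is_derive_sub (DP t) (is_derive_cmul k0 (ext_x E t)))).
    by ring.
  by rewrite /P (ext_kL E) (ext_vL E) (ext_xL E).
have u0 t : u t = 0.
  have /eqP := Z t; rewrite mulf_eq0 subr_eq0 => /orP[/eqP //|/eqP kk].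
  have := energy t; rewrite kk k0E => /eqP; rewrite -subr_eq0 opprD addrA subrr add0r oppr_eq0.
  by rewrite mulf_eq0 gt_eqF //= => /eqP.
have kt0 : k 0 = 0.
  have [_ D1] := ext_u E 0.
  have [_ D2] : is_derive (0 : R) 1 u 0.
    by rewrite (_ : u = fun _ => 0); [exact: is_derive_const|exact/funext].
  have v1 : v 0 ^+ 2 = 1 by have := ext_unit E 0; rewrite u0; lra.
  have /eqP : - k 0 * v 0 = 0 by rewrite -D1 D2.
  rewrite mulf_eq0 oppr_eq0 => /orP[/eqP //|/eqP vz].
  by move: v1; rewrite vz expr0n => /eqP; rewrite eq_sym oner_eq0.
have := energy 0; rewrite kt0 u0 normr0 powR0 ?gt_eqF // !mulr0 addr0 => l0.
by rewrite -l0 ltxx in lam0.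
Qed.

Lemma extremal_lam_gt : 0 < A -> - A < lam.
Proof.
move=> A0; rewrite ltNge; apply/negP => lamA.
apply: (@velocity_nonconstant 1 0) => t.
have u1 : u t = 1.
  have := u_le1 t; rewrite ler_norml => /andP[_ h].
  have : 0 <= (p - 1) * `|k t| `^ p by rewrite mulr_ge0 ?powR_ge0 ?ltW.
  rewrite energy => h1; have : 0 <= A * (u t - 1) by rewrite mulrBr mulr1; lra.
  by rewrite pmulr_rge0 // => h2; lra.
split=> //; have := ext_unit E t; rewrite u1 expr1n => e.
by apply/eqP; rewrite -sqrf_eq0; apply/eqP; lra.
Qed.

Lemma extremal_u_gt : 0 < A -> forall t, - 1 < u t.
Proof.
move=> A0 t; have := extremal_lam_lt A0 => lamA.
have : 0 <= (p - 1) * `|k t| `^ p by rewrite mulr_ge0 ?powR_ge0 ?ltW.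
rewrite energy => h1; have : 0 < A * (u t + 1) by rewrite mulrDr mulr1; lra.
by rewrite pmulr_rgt0 // => h2; lra.
Qed.

End Trichotomy.
End Normalise.

Section TimedWaves.
Context {R : realType}.
Variable (p : R) (p1 : 1 < p).
Implicit Types (r s t q b : R) (x z : R -> R).

Let p0 : 0 < p. Proof. exact: lt_trans p1. Qed.
Let p10 : 0 < p - 1. Proof. by rewrite subr_gt0. Qed.

Definition wave_speed q b x t := b / (2 * q) * Num.sqrt (1 - (q * x t) ^+ 2).

Record timed_wave q b x z : Prop := TimedWave {
  tw_q : 0 < q < 1;
  tw_b : 0 < b;
  tw_x : forall t : R, is_derive t 1 x (wave_speed q b x t * z t);
  tw_w : forall t : R, is_derive t 1 (fun s => sgp (p - 1) (z s))
    (- (2 * (p - 1) / p) * (wave_speed q b x t * x t));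
  tw_z : continuous z;
  tw_energy : forall t, `|z t| `^ p + x t ^+ 2 = 1;
  tw_x1 : forall t, x (t + 1) = x t;
  tw_z1 : forall t, z (t + 1) = z t }.

Lemma tw_x_le1 q b x z : timed_wave q b x z -> forall t, x t ^+ 2 <= 1.
Proof. by move=> w t; have := tw_energy w t; have := powR_ge0 `|z t| p; lra. Qed.

Lemma tw_mod q b x z : timed_wave q b x z -> forall t, 1 - q ^+ 2 <= 1 - (q * x t) ^+ 2.
Proof.
move=> w t; rewrite lerB // exprMn -[leRHS]mulr1; apply: ler_wpM2l; first exact: sqr_ge0.
exact: tw_x_le1 w t.
Qed.

Lemma tw_mod0 q b x z : timed_wave q b x z -> 0 < 1 - q ^+ 2.
Proof. by move=> w; have /andP[q0 q1] := tw_q w; rewrite subr_gt0 expr_lt1 // ltW. Qed.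

Lemma wave_speed_ge q b x z : timed_wave q b x z ->
  exists2 m : R, 0 < m & forall t, m <= wave_speed q b x t.
Proof.
move=> w; have /andP[q0 q1] := tw_q w.
have b0 : 0 < b / (2 * q) by rewrite divr_gt0 ?(tw_b w) // mulr_gt0.
exists (b / (2 * q) * Num.sqrt (1 - q ^+ 2)).
  by rewrite mulr_gt0 // sqrtr_gt0 (tw_mod0 w).
move=> t; apply: ler_wpM2l; first exact: ltW.
exact: ler_wsqrtr (tw_mod w t).
Qed.

Lemma wave_speed_continuous q b x z : timed_wave q b x z -> continuous (wave_speed q b x).
Proof.
move=> w; apply: continuous_mul; first exact: continuous_const.
apply: (@continuous_compose R (fun t => 1 - (q * x t) ^+ 2)); last exact: sqrt_continuous.
apply: continuous_sub; first exact: continuous_const.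
have qx : continuous (fun t => q * x t).
  exact: (continuous_mul (@continuous_const R q) (is_derive_continuous (tw_x w))).
exact: (continuous_mul qx qx).
Qed.

Lemma timed_wave_crest q b x z : timed_wave q b x z -> exists t, x t = 0 /\ z t = 1.
Proof.
move=> w; have [m m0 mw] := wave_speed_ge w.
have [c c01 cmax] := EVT_max (ler01 : (0 : R) <= 1) (continuous_subspaceT (tw_z w)).
have zmax t : z t <= z c.
  have [n [s [/andP[s0 s1] ->]]] := floor_split t (ltr01 : (0 : R) < 1).
  by rewrite (periodic_shift (tw_z1 w)) cmax // in_itv /= s0 ltW.
have xc : x c = 0.
  have D0 : is_derive c 1 (fun s => sgp (p - 1) (z s)) 0.
    apply: (@derive1_at_max R _ (c - 1) (c + 1)).
    - by lra.
    - by move=> t _; have [] := tw_w w t.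
    - by rewrite in_itv /=; apply/andP; split; lra.
    - move=> t _; rewrite leNgt ltr_sgp // -leNgt; exact: zmax.
  have [_ D1] := D0; have [_ D2] := tw_w w c; move: D2; rewrite D1 => /esym/eqP.
  have c0 : 2 * (p - 1) / p != 0 by rewrite gt_eqF // divr_gt0 // mulr_gt0.
  rewrite mulf_eq0 oppr_eq0 (negbTE c0) mulf_eq0 gt_eqF ?(lt_le_trans m0) //=.
  by move/eqP.
have zc : `|z c| = 1.
  have := tw_energy w c; rewrite xc expr0n addr0 => e.
  have : (`|z c| `^ p) `^ p^-1 = 1 by rewrite e powR1.
  by rewrite -powRrM mulfV ?gt_eqF // powRr1.
exists c; split=> //; apply/eqP; move/eqP: zc; rewrite eqr_norml ler01 andbT.
move=> /orP[//|/eqP zm].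
have D t : is_derive t 1 (fun s => - x s) (- (wave_speed q b x t * z t)).
  exact: is_derive_opp (tw_x w t).
have : - x 0 < - x (0 + 1).
  rewrite add0r; apply: (is_derive_lt ltr01 (fun t _ => D t)) => t _.
  rewrite oppr_gt0 nmulr_llt0; first exact: lt_le_trans (mw t).
  by apply: le_lt_trans (zmax t) _; rewrite zm oppr_lt0.
by rewrite (tw_x1 w) ltxx.
Qed.

Lemma timed_wave_reparam q b x z t0 : timed_wave q b x z -> exists T G : R -> R,
  [/\ G 0 = t0, cancel T G, forall t : R, is_derive t 1 T (wave_speed q b x t),
      forall t : R, is_derive t 1 G (wave_speed q b x (G t))^-1 &
      wave p (2 * (p - 1) / p) (x \o G) (z \o G)].
Proof.
move=> w; have [m m0 mw] := wave_speed_ge w.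
have [T0 DT0] := primitive_exists (wave_speed_continuous w).
have DT t : is_derive t 1 (fun s => T0 s - T0 t0) (wave_speed q b x t).
  by apply: (is_derive_eq (is_derive_sub (DT0 t) (is_derive_const (T0 t0) t))); rewrite subr0.
have [G [TG GT DG]] := increasing_inverse m0 DT mw.
have sN0 t : wave_speed q b x t != 0 by rewrite gt_eqF // (lt_le_trans m0).
exists (fun s => T0 s - T0 t0), G; split=> //.
  by have := TG t0; rewrite subrr.
split.
- move=> t; apply: (is_derive_eq (is_derive_comp (tw_x w (G t)) (DG t))).
  by rewrite /= mulrAC mulfV ?mul1r.
- move=> t; apply: (is_derive_eq (@is_derive_comp R (fun s => sgp (p - 1) (z s)) G t _ _
    (tw_w w (G t)) (DG t))).
  rewrite /= -[LHS]mulrA; congr (_ * _); rewrite mulrAC mulfV ?mul1r //.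
- exact: (continuous_compose (is_derive_continuous DG) (tw_z w)).
- by move=> t; exact: tw_energy w (G t).
Qed.

Lemma timed_wave_match q1 b1 x1 z1 q2 b2 x2 z2 :
  timed_wave q1 b1 x1 z1 -> timed_wave q2 b2 x2 z2 ->
  exists sig : R -> R, forall t : R,
    [/\ x2 (sig t) = x1 t, z2 (sig t) = z1 t &
        is_derive t 1 sig (wave_speed q1 b1 x1 t / wave_speed q2 b2 x2 (sig t))].
Proof.
move=> w1 w2; have [t1 [x1t z1t]] := timed_wave_crest w1.
have [t2 [x2t z2t]] := timed_wave_crest w2.
have [T1 [G1 [G10 TG1 DT1 _ W1]]] := timed_wave_reparam t1 w1.
have [T2 [G2 [G20 _ _ DG2 W2]]] := timed_wave_reparam t2 w2.
have xe0 : (x1 \o G1) 0 = (x2 \o G2) 0 by rewrite /= G10 G20 x1t x2t.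
have ze0 : (z1 \o G1) 0 = (z2 \o G2) 0 by rewrite /= G10 G20 z1t z2t.
have U := wave_unique p1 W1 W2 xe0 ze0.
exists (G2 \o T1) => t; have [/= xe ze] := U (T1 t); rewrite TG1 in xe ze.
split=> //; apply: (is_derive_eq (is_derive_comp (DG2 (T1 t)) (DT1 t))).
by rewrite mulrC.
Qed.

Lemma periodic_bounded (f : R -> R) : continuous f -> (forall t, f (t + 1) = f t) ->
  exists M, forall t, `|f t| <= M.
Proof.
move=> fc f1; have [M HM] := continuous_bounded (continuous_subspaceT fc : {within `[0, 1], continuous f}).
exists M => t; have [n [s [/andP[s0 s1] ->]]] := floor_split t (ltr01 : (0 : R) < 1).
by rewrite (periodic_shift f1) HM // s0 ltW.
Qed.

(* The horizontal drifts of two matched waves differ by a function of constant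
   sign, whereas both have to vanish over a period. *)
Lemma timed_wave_closing q1 b1 x1 z1 X1 q2 b2 x2 z2 X2 :
  timed_wave q1 b1 x1 z1 -> timed_wave q2 b2 x2 z2 ->
  (forall t : R, is_derive t 1 X1 (1 - 2 * (q1 * x1 t) ^+ 2)) ->
  (forall t : R, is_derive t 1 X2 (1 - 2 * (q2 * x2 t) ^+ 2)) ->
  (forall t, X1 (t + 1) = X1 t) -> (forall t, X2 (t + 1) = X2 t) -> q2 <= q1.
Proof.
move=> w1 w2 DX1 DX2 X11 X21; rewrite leNgt; apply/negP => q12.
have [sig H] := timed_wave_match w1 w2.
have /andP[q10 _] := tw_q w1; have /andP[q20 _] := tw_q w2.
have b10 := tw_b w1; have b20 := tw_b w2.
pose s1 t : R := Num.sqrt (1 - (q1 * x1 t) ^+ 2).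
pose s2 t : R := Num.sqrt (1 - (q2 * x1 t) ^+ 2).
have m1 t : 0 < 1 - (q1 * x1 t) ^+ 2 by apply: lt_le_trans (tw_mod0 w1) (tw_mod w1 t).
have m2 t : 0 < 1 - (q2 * x1 t) ^+ 2.
  by have [<- _ _] := H t; apply: lt_le_trans (tw_mod0 w2) (tw_mod w2 _).
have s10 t : 0 < s1 t by rewrite sqrtr_gt0.
have s20 t : 0 < s2 t by rewrite sqrtr_gt0.
have s1E t : (q1 * x1 t) ^+ 2 = 1 - s1 t ^+ 2 by rewrite sqr_sqrtr ?(ltW (m1 t)) //; ring.
have s2E t : (q2 * x1 t) ^+ 2 = 1 - s2 t ^+ 2 by rewrite sqr_sqrtr ?(ltW (m2 t)) //; ring.
pose r : R := (b2 / (2 * q2)) / (b1 / (2 * q1)).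
pose D t : R := X1 t - r * X2 (sig t).
pose dD t : R := (s1 t - s2 t) * (2 * s1 t + (s2 t)^-1).
have DD t : is_derive t 1 D (dD t).
  have [xe _ Ds] := H t.
  apply: (is_derive_eq (is_derive_sub (DX1 t) (is_derive_cmul r (is_derive_comp (DX2 (sig t)) Ds)))).
  rewrite /wave_speed xe -/(s1 t) -/(s2 t) s1E s2E /r /dD.
  have := s20 t; move: (s1 t) (s2 t) => S1 S2 S20.
  by field; rewrite !gt_eqF.
have s12 t : s2 t <= s1 t.
  apply: ler_wsqrtr; rewrite lerB // !exprMn; apply: ler_wpM2r; first exact: sqr_ge0.
  by rewrite ler_sqr ?nnegrE ltW.
have dD0 t : 0 <= dD t.
  by rewrite mulr_ge0 ?subr_ge0 // addr_ge0 ?invr_ge0 ?mulr_ge0 ?(ltW (s10 t)) ?(ltW (s20 t)).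
have dD1 t : dD (t + 1) = dD t by rewrite /dD /s1 /s2 (tw_x1 w1).
have [M1 HM1] := periodic_bounded (is_derive_continuous DX1) X11.
have [M2 HM2] := periodic_bounded (is_derive_continuous DX2) X21.
have r0 : 0 < r by rewrite !divr_gt0 // mulr_gt0.
pose M := M1 + r * M2.
have DM t : `|D t| <= M.
  apply: le_trans (ler_normB _ _) _; apply: lerD (HM1 t) _.
  rewrite normrM (gtr0_norm r0); apply: ler_wpM2l (HM2 _); exact: ltW.
pose del := D 1 - D 0.
have step t : D (t + 1) - D t = del.
  have E s : is_derive s 1 (fun s => D (s + 1) - D s) 0.
    have DA : is_derive s 1 (fun s : R => s + 1) 1.
      by apply: (is_derive_eq (is_derive_add (is_derive_id s 1) (is_derive_const 1 s))); rewrite addr0.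
    apply: (is_derive_eq (is_derive_sub (@is_derive_comp R D (fun s => s + 1) s _ _
      (DD (s + 1)) DA) (DD s))).
    by rewrite dD1 mulr1 subrr.
  by rewrite (is_derive_0_is_cst t 0 E) add0r.
have Dn n : D n%:R = D 0 + n%:R * del.
  elim: n => [|n IH]; first by rewrite mul0r addr0.
  by rewrite -natr1 -[D _](subrK (D n%:R)) step IH; ring.
have del0 : del = 0.
  apply/eqP; rewrite -normr_le0 leNgt; apply/negP => dp.
  have [n Hn] : exists n : nat, (2 * M) / `|del| < n%:R.
    exists (Num.truncn ((2 * M) / `|del|)).+1; exact: truncnS_gt.
  move: Hn; rewrite ltr_pdivrMr // ltNge => /negP; apply.
  rewrite -[X in X * _](ger0_norm (ler0n R n)) -normrM.
  have -> : n%:R * del = D n%:R - D 0 by rewrite Dn; ring.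
  by apply: le_trans (ler_normB _ _) _; have := DM n%:R; have := DM 0; lra.
have Z : forall t, dD t = 0.
  apply: (periodic_monotone DD dD0) => t.
  by have := step t; rewrite del0; lra.
have x0 t : x1 t = 0.
  have /eqP := Z t; rewrite mulf_eq0 subr_eq0 [X in _ || X]gt_eqF ?orbF; last first.
    by rewrite addr_gt0 ?invr_gt0 ?mulr_gt0.
  move/eqP => s12E; have := s1E t; rewrite s12E -s2E !exprMn => /eqP.
  rewrite -subr_eq0 -mulrBl mulf_eq0 sqrf_eq0 => /orP[|/eqP //].
  by rewrite subr_sqr mulf_eq0 subr_eq0 lt_eqF //= gt_eqF // addr_gt0.
have [m m0 mw] := wave_speed_ge w1.
have z0 : z1 0 = 0.
  have [_ D1] := tw_x w1 0.
  have [_ D2] : is_derive (0 : R) 1 x1 0.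
    by rewrite (_ : x1 = fun _ => 0); [exact: is_derive_const|exact/funext].
  move/eqP: D1; rewrite D2 eq_sym mulf_eq0 gt_eqF ?(lt_le_trans m0) //=.
  by move/eqP.
have := tw_energy w1 0; rewrite z0 x0 normr0 powR0 ?gt_eqF // expr0n addr0 => /eqP.
by rewrite eq_sym oner_eq0.
Qed.

End TimedWaves.

Section Wavelike.
Context {R : realType}.
Variable (p : R) (p1 : 1 < p).
Implicit Types (r s t q b : R).

Let p0 : 0 < p. Proof. exact: lt_trans p1. Qed.
Let p10 : 0 < p - 1. Proof. by rewrite subr_gt0. Qed.

(* With [theta] the tangent angle, [q * X = sin (theta / 2)] and the wave
   speed is proportional to [cos (theta / 2)]. *)
Lemma extremal_timed_wave (lam A : R) (x y u v k : R -> R) :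
  0 < A -> extremal p 1 lam A 0 x y u v k -> exists (q b : R) (X Z : R -> R),
  [/\ timed_wave p q b X Z, forall t, u t = 1 - 2 * (q * X t) ^+ 2 &
      forall t, v t = 2 * (q * X t) * Num.sqrt (1 - (q * X t) ^+ 2)].
Proof.
move=> A0 E; have lamA := extremal_lam_lt p1 E A0; have lamA' := extremal_lam_gt p1 E A0.
have u1 := extremal_u_gt p1 E A0.
have [q [q0 q1 q2]] : exists q : R, [/\ 0 < q, q < 1 & 2 * A * q ^+ 2 = lam + A].
  have h : 0 < (lam + A) / (2 * A) by rewrite divr_gt0 ?mulr_gt0 //; lra.
  exists (Num.sqrt ((lam + A) / (2 * A))); split.
  - by rewrite sqrtr_gt0.
  - rewrite -[ltRHS]sqrtr1 ltr_sqrt // ltr_pdivrMr ?mulr_gt0 //; lra.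
  - by rewrite sqr_sqrtr ?ltW // mulrC divfK // gt_eqF // mulr_gt0.
have Aq : 0 < 2 * A * q ^+ 2 by rewrite q2; lra.
have [b b0 bp] : exists2 b : R, 0 < b & (p - 1) * b `^ p = 2 * A * q ^+ 2.
  have h : 0 < 2 * A * q ^+ 2 / (p - 1) by rewrite divr_gt0.
  exists ((2 * A * q ^+ 2 / (p - 1)) `^ p^-1); first by rewrite powR_gt0.
  by rewrite -powRrM mulVf ?gt_eqF // powRr1 ?ltW // mulrC divfK // gt_eqF.
have en t : (p - 1) * `|k t| `^ p = lam + A * u t.
  by rewrite (ext_energy E) mul0r addr0.
pose cc t : R := Num.sqrt ((1 + u t) / 2).
have h0 t : 0 < (1 + u t) / 2 by have := u1 t; lra.
have cc0 t : 0 < cc t by rewrite sqrtr_gt0.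
have cc2 t : cc t ^+ 2 = (1 + u t) / 2 by rewrite sqr_sqrtr // ltW.
pose S t : R := v t / (2 * cc t).
have vE t : v t = 2 * S t * cc t.
  by rewrite /S; field; rewrite gt_eqF.
have uE t : u t = 2 * cc t ^+ 2 - 1 by rewrite cc2; field.
have S2 t : S t ^+ 2 = 1 - cc t ^+ 2.
  have := ext_unit E t; rewrite vE uE => e.
  have e4 : 4 * cc t ^+ 2 != 0 by rewrite gt_eqF // mulr_gt0 // exprn_gt0.
  apply: (mulfI e4); move: e; move: (cc t) (S t) => c s e.
  have -> : 4 * c ^+ 2 * s ^+ 2 =
    (2 * c ^+ 2 - 1) ^+ 2 + (2 * s * c) ^+ 2 - (2 * c ^+ 2 - 1) ^+ 2 by ring.
  by rewrite e; ring.
have Dcc t : is_derive t 1 cc (- k t * S t / 2).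
  have D : is_derive t 1 (fun s => (1 + u s) / 2) (- k t * v t / 2).
    apply: (is_derive_eq (is_derive_mul (is_derive_add (is_derive_const 1 t) (ext_u E t))
      (is_derive_const 2^-1 t))).
    by rewrite add0r mulr0 addr0.
  apply: (is_derive_eq (@is_derive_comp R Num.sqrt (fun s => (1 + u s) / 2) t _ _
    (is_derive1_sqrt (h0 t)) D)).
  rewrite -/(cc t) vE; have := cc0 t; move: (cc t) => c c0.
  by field; rewrite gt_eqF.
have DS t : is_derive t 1 S (k t * cc t / 2).
  have c2 : 2 * cc t != 0 by rewrite gt_eqF // mulr_gt0.
  apply: (is_derive_eq (@is_derive_div R v (fun s => 2 * cc s) t _ _ c2 (ext_v E t)
    (is_derive_cmul 2 (Dcc t)))).
  rewrite vE uE; have := S2 t; have := cc0 t; move: (cc t) (S t) => c s c0 s2.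
  have -> : k t * (2 * c ^+ 2 - 1) * (2 * c) - 2 * s * c * (2 * (- k t * s / 2)) =
     2 * k t * c * (2 * c ^+ 2 - 1 + s ^+ 2) by field.
  by rewrite s2; field; rewrite gt_eqF.
pose X t : R := S t / q; pose Z t : R := k t / b.
have qX t : q * X t = S t by rewrite /X mulrC divfK ?gt_eqF.
have speedE t : wave_speed q b X t = b / (2 * q) * cc t.
  rewrite /wave_speed qX S2 opprB addrC subrK sqrtr_sqr gtr0_norm //.
exists q, b, X, Z; split; first split.
- by rewrite q0.
- exact: b0.
- move=> t; apply: (is_derive_eq (is_derive_mul (DS t) (is_derive_const q^-1 t))).
  by rewrite speedE mulr0 addr0 /Z; field; rewrite !gt_eqF.
- move=> t; pose B := (b^-1) `^ (p - 1).
  have BE : B * (2 * A * q ^+ 2) = (p - 1) * b.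
    rewrite -bp -(mulr_powRB1 (ltW b0) p0).
    have BB : B * b `^ (p - 1) = 1.
      by rewrite /B -powRM ?invr_ge0 ?(ltW b0) // mulVf ?gt_eqF // powR1.
    transitivity ((p - 1) * b * (B * b `^ (p - 1))); last by rewrite BB mulr1.
    by ring.
  rewrite (_ : (fun s => _) = fun s => B / p * (p * sgp (p - 1) (k s))); last first.
    apply/funext => s; rewrite /Z mulrC sgpM ?invr_gt0 // -/B.
    by rewrite mulrA divfK // gt_eqF.
  apply: (is_derive_eq (is_derive_cmul (B / p) (ext_w E t))).
  rewrite mul0r sub0r speedE vE /X.
  have -> : B / p * - (A * (2 * S t * cc t)) = - (B * (2 * A * q ^+ 2)) * (S t * cc t) / (p * q ^+ 2).
    by field; rewrite !gt_eqF.
  by rewrite BE; field; rewrite !gt_eqF.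
- move=> t; apply: cvgM; [exact: (ext_k E)|exact: cvg_cst].
- move=> t; rewrite /Z /X normrM powRM // [`|b^-1|]gtr0_norm ?invr_gt0 //.
  have bB : (b^-1) `^ p * b `^ p = 1.
    by rewrite -powRM ?invr_ge0 ?(ltW b0) // mulVf ?gt_eqF // powR1.
  have pp : (p - 1) * b `^ p != 0 by rewrite gt_eqF // mulr_gt0 // powR_gt0.
  apply: (mulfI pp); rewrite mulrDr mulr1.
  have -> : (p - 1) * b `^ p * (`|k t| `^ p * (b^-1) `^ p) =
      (p - 1) * `|k t| `^ p * ((b^-1) `^ p * b `^ p) by ring.
  rewrite bB mulr1 en bp uE exprMn S2.
  have -> : lam = 2 * A * q ^+ 2 - A by rewrite q2 addrK.
  by field; rewrite gt_eqF.
- by move=> t; rewrite /X /S /cc (ext_uL E) (ext_vL E).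
- by move=> t; rewrite /Z (ext_kL E).
- by move=> t; rewrite qX S2 uE; ring.
- by move=> t; rewrite qX S2 opprB addrC subrK sqrtr_sqr gtr0_norm.
Qed.

Lemma wavelike_compare (lam1 A1 lam2 A2 : R) (x1 y1 u1 v1 k1 x2 y2 u2 v2 k2 : R -> R) :
  0 < A1 -> extremal p 1 lam1 A1 0 x1 y1 u1 v1 k1 ->
  0 < A2 -> extremal p 1 lam2 A2 0 x2 y2 u2 v2 k2 ->
  exists2 r, 0 < r & exists s0, forall t,
    u2 (r * t + s0) = u1 t /\ v2 (r * t + s0) = v1 t.
Proof.
move=> A10 E1 A20 E2.
have [q1 [b1 [X1 [Z1 [w1 uE1 vE1]]]]] := extremal_timed_wave A10 E1.
have [q2 [b2 [X2 [Z2 [w2 uE2 vE2]]]]] := extremal_timed_wave A20 E2.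
have D1 t : is_derive t 1 x1 (1 - 2 * (q1 * X1 t) ^+ 2) by rewrite -uE1; exact: (ext_x E1).
have D2 t : is_derive t 1 x2 (1 - 2 * (q2 * X2 t) ^+ 2) by rewrite -uE2; exact: (ext_x E2).
have q12 : q1 = q2.
  apply/eqP; rewrite eq_le.
  by rewrite (timed_wave_closing p1 w2 w1 D2 D1 (ext_xL E2) (ext_xL E1))
    (timed_wave_closing p1 w1 w2 D1 D2 (ext_xL E1) (ext_xL E2)).
rewrite -{}q12 in w2 uE2 vE2.
have [sig H] := timed_wave_match p1 w1 w2.
have b10 := tw_b w1; have b20 := tw_b w2; have /andP[q0 _] := tw_q w1.
pose r : R := b1 / b2.
exists r; first by rewrite divr_gt0.
exists (sig 0) => t.
have Ds s : is_derive s 1 sig r.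
  have [xe _ Ds] := H s; apply: (is_derive_eq Ds); rewrite /wave_speed xe.
  have : 0 < Num.sqrt (1 - (q1 * X1 s) ^+ 2).
    by rewrite sqrtr_gt0; exact: lt_le_trans (tw_mod0 w1) (tw_mod w1 s).
  move: (Num.sqrt _) => S S0; rewrite /r; field.
  by rewrite !gt_eqF.
have -> : r * t + sig 0 = sig t.
  have E s : is_derive s 1 (fun s => sig s - r * s) 0.
    apply: (is_derive_eq (is_derive_sub (Ds s) (is_derive_cmul r (is_derive_id s 1)))).
    by rewrite mulr1 subrr.
  by have := is_derive_0_is_cst t 0 E; rewrite mulr0 subr0 => <-; rewrite addrC subrK.
by have [xe _ _] := H t; rewrite uE2 vE2 uE1 vE1 xe.
Qed.

End Wavelike.

Section Splice.
Context {R : realType}.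
Notation mu := (@lebesgue_measure R).
Implicit Types (r s t x y w : R) (f F : R -> R).

Lemma uniform_continuity_segment f (a b eta : R) : continuous f -> 0 < eta ->
  exists2 d, 0 < d & forall s t, a <= s <= b -> a <= t <= b -> `|s - t| < d ->
    `|f s - f t| < eta.
Proof.
move=> fc eta0; have eta2 : 0 < eta / 2 by rewrite divr_gt0.
have /compact_near_coveringP K := @segment_compact R a b.
have := K R (0 : R)^'+ (fun d t => forall s, `|s - t| < d -> `|f s - f t| < eta).
have H : forall x, `[a, b]%classic x -> \forall t \near x & d \near (0 : R)^'+,
    forall s, `|s - t| < d -> `|f s - f t| < eta.
  move=> x _; have /cvgrPdist_lt/(_ _ eta2) := fc x.
  move=> /nbhs_ballP[r r0 Hr]; have r20 : 0 < r / 2 by rewrite divr_gt0.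
  exists (ball x (r / 2), [set d | d < r / 2]) => /=.
    by split; [exact: nbhsx_ballx|exact: nbhs_right_lt].
  move=> [t d] [/= xt dr] s st; rewrite /ball /= in xt.
  have h1 : `|f x - f t| < eta / 2.
    by apply: Hr; rewrite /ball /=; apply: lt_trans xt _; lra.
  have h2 : `|f x - f s| < eta / 2.
    apply: Hr; rewrite /ball /=; apply: le_lt_trans (ler_distD t _ _) _.
    by rewrite [`|t - s|]distrC; lra.
  apply: le_lt_trans (ler_distD (f x) _ _) _.
  by rewrite [`|f s - f x|]distrC; lra.
move=> /(_ _ H) N.
have : \forall d \near (0 : R)^'+, 0 < d /\
    (`[a, b] `<=` (fun t => forall s, `|s - t| < d -> `|f s - f t| < eta))%classic.
  by near=> d; split; [near: d; exact: nbhs_right_gt|near: d; exact: N].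
move=> /filter_ex[d [d0 Hd]]; exists d => // s t _ tab st.
by apply: Hd => //; rewrite /= in_itv.
Unshelve. all: by end_near. Qed.

(* The curve skips its arc over [a, b] and instead runs through the translated
   arc over [a + T, b + T] at half speed. *)
Variables (L a b T : R).
Hypotheses (a0 : 0 <= a) (ab : a <= b) (bT : b <= a + T) (TL : b + T <= L).

Let e : R := a + T - (b - a).

Definition splice_time t := if t <= a then t else if t <= e then t + (b - a)
  else if t <= b + T then a + T + (t - e) / 2 else t.

Definition splice w f t :=
  (if (e < t) && (t <= b + T) then w else 1) * f (splice_time t).

Let ae_ : a <= e. Proof. by move: bT ab; rewrite /e => ? ?; lra. Qed.
Let ebT : e <= b + T. Proof. by move: bT ab; rewrite /e => ? ?; lra. Qed.
Let L0 : 0 <= L. Proof. by move: a0 ae_ ebT TL => ? ? ? ?; lra. Qed.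

Lemma splice_time_near t : `|splice_time t - t| <= b - a.
Proof.
rewrite /splice_time; case: ifPn => [_|_]; first by rewrite subrr normr0 subr_ge0.
have h0 : 0 <= b - a by rewrite subr_ge0.
case: ifPn => [_|]; first by rewrite addrAC subrr add0r ger0_norm.
rewrite -ltNge => h2; case: ifPn => [h3|_]; last by rewrite subrr normr0.
by move: h2 h3 ab; rewrite /e => ? ? ?; rewrite ger0_norm; lra.
Qed.

Lemma splice_time_in t : 0 <= t <= L -> 0 <= splice_time t <= L.
Proof.
move=> /andP[t0 tL]; rewrite /splice_time.
case: ifPn => [_|]; first by rewrite t0.
rewrite -ltNge => h1; case: ifPn => [h2|].
  by move: h2 h1 ab a0 bT TL; rewrite /e => ? ? ? ? ? ?; apply/andP; split; lra.
rewrite -ltNge => h2; case: ifPn => [h3|_]; last by rewrite t0.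
by move: h2 h1 h3 ab a0 bT TL; rewrite /e => ? ? ? ? ? ? ?; apply/andP; split; lra.
Qed.

Lemma measurable_splice w f : continuous f -> measurable_fun setT (splice w f).
Proof.
move=> fc; have ml s : measurable_fun setT (fun t => t <= s).
  by apply: measurable_fun_ler => //; exact: measurable_cst.
have mrho : measurable_fun setT splice_time.
  apply: measurable_fun_ifT => //; apply: measurable_fun_ifT => //.
    by apply: measurable_funD => //; exact: measurable_cst.
  apply: measurable_fun_ifT => //; apply: continuous_measurable_fun.
  apply: (@is_derive_continuous R _ (fun=> 2^-1)) => t.
  rewrite (_ : (fun t => _) = fun t => 2^-1 * t + (a + T - e / 2)).
    exact: is_derive_affine.
  by apply/funext => s; field.
apply: measurable_funM; last first.
  by apply: measurableT_comp mrho; exact: continuous_measurable_fun.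
apply: measurable_fun_ifT; [|exact: measurable_cst|exact: measurable_cst].
apply: measurable_and => //; apply: measurable_fun_ltr => //; exact: measurable_cst.
Qed.

Lemma splice_bounded w f : continuous f ->
  exists M, forall t, 0 <= t <= L -> `|splice w f t| <= M.
Proof.
move=> fc; have [M HM] := continuous_bounded (continuous_subspaceT fc : {within `[0, L], continuous f}).
exists ((1 + `|w|) * M) => t tL; rewrite normrM; apply: ler_pM => //.
  by case: ifP => _; [rewrite lerDr|rewrite normr1 lerDl].
exact/HM/splice_time_in.
Qed.

Lemma splice_itg w f : continuous f -> itg 0 L (splice w f).
Proof.
move=> fc; have [M HM] := splice_bounded w fc.
apply: itg_bounded HM; apply: measurable_funS (measurable_splice w fc) => //.
Qed.

Lemma ftc_oo (x y : R) (g h H : R -> R) : x <= y -> continuous h ->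
  (forall t, is_derive t 1 H (h t)) -> (forall t, x < t < y -> h t = g t) ->
  iab x y g = H y - H x.
Proof.
move=> xy hc DH gh; have [_ <-] := eq_iab_oo (@continuous_itg R x y h hc) gh.
have hw : {within `[x, y], continuous h} by exact: continuous_subspaceT.
exact: (ftc xy hw (is_derive_within (fun t _ => DH t)) (fun t _ => DH t)).
Qed.

Lemma splice_prim w f F t : continuous f -> (forall t, is_derive t 1 F (f t)) ->
  0 <= t <= L ->
  iab 0 t (splice w f) =
  if t <= a then F t - F 0
  else if t <= e then F (t + (b - a)) - F b + (F a - F 0)
  else if t <= b + T then
    2 * w * (F (splice_time t) - F (a + T)) + (F (a + T) - F b) + (F a - F 0)
  else F t - F (b + T) + 2 * w * (F (b + T) - F (a + T)) + (F (a + T) - F b) + (F a - F 0).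
Proof.
move=> fc DF /andP[t0 tL]; have gi := splice_itg w fc.
have gS x y : 0 <= x -> y <= L -> itg x y (splice w f) by move=> x0 yL; exact: itgS gi.
have P1 s : 0 <= s <= a -> iab 0 s (splice w f) = F s - F 0.
  move=> /andP[s0 sa]; apply: (ftc_oo s0 fc DF) => r /andP[_ rs].
  have ra : r <= a by lra.
  by rewrite /splice /splice_time ra ltNge (le_trans ra ae_) /= mul1r.
have P2 s : a <= s <= e -> iab a s (splice w f) = F (s + (b - a)) - F b.
  move=> /andP[as_ se]; have Dsh r : is_derive r 1 (fun r => r + (b - a)) 1.
    by apply: (is_derive_eq (is_derive_add (is_derive_id r 1) (is_derive_const (b - a) r))); rewrite addr0.
  have DF2 r : is_derive r 1 (fun r => F (r + (b - a))) (f (r + (b - a))).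
    by apply: (is_derive_eq (@is_derive_comp R F (fun r => r + (b - a)) r _ _ (DF _) (Dsh r))); rewrite mulr1.
  rewrite (ftc_oo as_ _ DF2).
  - by rewrite [a + _]addrC subrK.
  - exact: (continuous_compose (is_derive_continuous Dsh) fc).
  - move=> r /andP[ar rs]; have re : r <= e by lra.
    by rewrite /splice /splice_time (leNgt r a) ar /= re ltNge re /= mul1r.
have P3 s : e <= s <= b + T -> iab e s (splice w f) =
    2 * w * (F (a + T + (s - e) / 2) - F (a + T)).
  move=> /andP[es sb].
  have Dsh r : is_derive r 1 (fun r => a + T + (r - e) / 2) 2^-1.
    rewrite (_ : (fun t => _) = fun t => 2^-1 * t + (a + T - e / 2)).
      exact: is_derive_affine.
    by apply/funext => s'; field.
  have DF2 r : is_derive r 1 (fun r => 2 * w * F (a + T + (r - e) / 2)) (w * f (a + T + (r - e) / 2)).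
    apply: (is_derive_eq (is_derive_cmul (2 * w) (@is_derive_comp R F (fun r => a + T + (r - e) / 2)
      r _ _ (DF _) (Dsh r)))).
    by field.
  rewrite (ftc_oo es _ DF2).
  - by rewrite subrr mul0r addr0 mulrBr.
  - apply: continuous_mul; first exact: continuous_const.
    exact: (continuous_compose (is_derive_continuous Dsh) fc).
  - move=> r /andP[er rs]; have rb : r <= b + T by lra.
    have ar : a < r by have := ae_; lra.
    by rewrite /splice /splice_time (leNgt r a) ar (leNgt r e) er rb.
have P4 s : b + T <= s <= L -> iab (b + T) s (splice w f) = F s - F (b + T).
  move=> /andP[bs sL]; apply: (ftc_oo bs fc DF) => r /andP[br rs].
  have er : e < r by have := ebT; lra.
  have ar : a < r by have := ae_; lra.
  by rewrite /splice /splice_time (leNgt r a) ar (leNgt r e) er (leNgt r (b + T)) br /= mul1r.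
have ebT' : e <= b + T by exact: ebT.
have ae' : a <= e by exact: ae_.
have eL : e <= L by exact: le_trans TL.
have e0 : 0 <= e by exact: le_trans ae'.
have Qa : iab 0 a (splice w f) = F a - F 0 by rewrite P1 // a0 lexx.
have Qe : iab 0 e (splice w f) = F (a + T) - F b + (F a - F 0).
  rewrite (@iab_split R 0 a e) //; [|by apply: gS].
  rewrite Qa P2 ?ae' ?lexx // addrC; congr (F _ - _ + _).
  by rewrite /e; ring.
have Qb : iab 0 (b + T) (splice w f) =
    2 * w * (F (b + T) - F (a + T)) + (F (a + T) - F b) + (F a - F 0).
  rewrite (@iab_split R 0 e (b + T)) ?(le_trans a0) //; [|by apply: gS].
  rewrite Qe P3 ?ebT' ?lexx // [LHS]addrC -[RHS]addrA; congr (2 * w * (F _ - _) + _).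
  by rewrite /e; field.
case: ifPn => [ta|]; first by rewrite P1 // t0.
rewrite -ltNge => /ltW at_; case: ifPn => [te|].
  rewrite (@iab_split R 0 a t) //; [|by apply: gS].
  by rewrite Qa P2 ?at_ // addrC.
rewrite -ltNge => et; case: ifPn => [tb|].
  rewrite (@iab_split R 0 e t) ?(ltW et) ?(le_trans a0) //; [|by apply: gS].
  rewrite Qe P3 ?(ltW et) // addrC -[RHS]addrA; congr (2 * w * (F _ - _) + _).
  have ta : a < t by lra.
  by rewrite /splice_time (leNgt t a) ta (leNgt t e) et tb.
rewrite -ltNge => /ltW bt.
rewrite (@iab_split R 0 (b + T) t) //; [|by have := ae_; have := ebT; lra|exact: gS].
by rewrite Qb P4 ?bt // addrC !addrA.
Qed.

Lemma splice_half f F t : continuous f -> (forall t, is_derive t 1 F (f t)) ->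
  F a = F b -> 0 <= t <= L -> iab 0 t (splice 2^-1 f) = F (splice_time t) - F 0.
Proof.
move=> fc DF Fab tL; rewrite (splice_prim _ fc DF) // mulfV // mul1r.
rewrite -Fab /splice_time; case: (leP t a) => // _; case: (leP t e) => _; first by ring.
by case: (leP t (b + T)) => _; ring.
Qed.

Lemma splice_total w f F : a < b -> continuous f -> (forall t, is_derive t 1 F (f t)) ->
  iab 0 L (splice w f) =
    F L - F 0 - (F b - F a) + (2 * w - 1) * (F (b + T) - F (a + T)).
Proof.
move=> ltab fc DF; rewrite (splice_prim _ fc DF) ?L0 ?lexx //.
have aL : a < L by move: ltab bT TL => ? ? ?; lra.
have eL : e < L by move: ltab bT TL; rewrite /e => ? ? ?; lra.
rewrite (leNgt L a) aL (leNgt L e) eL /=.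
have [Lb|bL] := leP L (b + T); last by ring.
have E : L = b + T by apply/eqP; rewrite eq_le Lb TL.
rewrite /splice_time (leNgt L a) aL (leNgt L e) eL Lb /=.
have -> : a + T + (L - e) / 2 = b + T by rewrite E /e; field.
by rewrite E; ring.
Qed.

Lemma splice1 f t : splice 1 f t = f (splice_time t).
Proof. by rewrite /splice; case: ifP => _; rewrite mul1r. Qed.

Lemma splice_half_close f (t0 eps eta t : R) : b - a < eps -> a <= t0 <= b ->
  f t0 = 0 -> (forall t, f (t + T) = f t) ->
  (forall s t, 0 <= s <= L -> 0 <= t <= L -> `|s - t| < 2 * eps ->
    `|f s - f t| < eta) ->
  0 <= t <= L -> `|f t - splice 2^-1 f t| <= eta.
Proof.
move=> be t0ab ft0 fT fU tL; have rt := splice_time_in tL.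
have h1 : `|f (splice_time t) - f t| < eta.
  apply: fU => //; apply: le_lt_trans (splice_time_near t) _.
  by move: be ab => ? ?; lra.
rewrite distrC /splice; case: ifP => [/andP[et tb]|_]; last by rewrite mul1r ltW.
have /andP[at0 t0b] := t0ab.
have h2 : `|f t| < eta.
  have -> : f t = f t - f (t0 + T) by rewrite fT ft0 subr0.
  move: et tb be at0 t0b a0 bT TL; rewrite /e => et tb be at0 t0b a0' bT' TL'.
  apply: fU => //; first by apply/andP; split; lra.
  by rewrite ltr_norml; apply/andP; split; lra.
have -> : 2^-1 * f (splice_time t) - f t = 2^-1 * ((f (splice_time t) - f t) - f t) by field.
rewrite normrM ger0_norm; last by rewrite invr_ge0.
have := ler_normB (f (splice_time t) - f t) (f t) => h3.
by rewrite mulrC ler_pdivrMr //; lra.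
Qed.

Lemma splice1_iab_close f (eta t : R) : continuous f -> 0 < eta ->
  (forall s, 0 <= s <= L -> `|f (splice_time s) - f s| < eta) -> 0 <= t <= L ->
  `|iab 0 t f - iab 0 t (splice 1 f)| <= eta * L.
Proof.
move=> fc eta0 fe /andP[t0' tL]; have gi := itgS (lexx 0) tL (splice_itg 1 fc).
have fi : itg 0 t f by exact: continuous_itg.
rewrite -iabB //; apply: le_trans (_ : eta * (t - 0) <= _); last by rewrite subr0 ler_pM2l.
apply: iab_bound => //; first exact: itgB.
move=> s /andP[s0 st]; rewrite splice1 distrC; apply/ltW/fe.
by rewrite s0 (le_trans st).
Qed.

End Splice.

Lemma periodic_increment {R : realType} (F f : R -> R) (T a b : R) :
  (forall t : R, is_derive t 1 F (f t)) -> (forall t, f (t + T) = f t) ->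
  F (b + T) - F (a + T) = F b - F a.
Proof.
move=> DF fT; have Dsh (s : R) : is_derive s 1 (fun s : R => s + T) 1.
  by apply: (is_derive_eq (is_derive_add (is_derive_id s 1) (is_derive_const T s))); rewrite addr0.
have D (s : R) : is_derive s 1 (fun s => F (s + T) - F s) 0.
  apply: (is_derive_eq (is_derive_sub (@is_derive_comp R F (fun s => s + T) s _ _
    (DF (s + T)) (Dsh s)) (DF s))).
  by rewrite fT mulr1 subrr.
by have := is_derive_0_is_cst a b D; lra.
Qed.

Section Competitor.
Context {R : realType}.
Notation mu := (@lebesgue_measure R).
Implicit Types (r s t w : R).

Lemma enorm_le (w : plane R) : enorm w <= `|w 0 0| + `|w 0 1|.
Proof.
have h0 : 0 <= `|w 0 0| + `|w 0 1| by rewrite addr_ge0.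
rewrite /enorm -[leRHS](ger0_norm h0) -sqrtr_sqr; apply: ler_wsqrtr.
rewrite sqrrD !real_normK ?num_real // -addrA lerD2l addrC lerDl.
by rewrite mulrn_wge0 // mulr_ge0.
Qed.

Lemma measurable_enorm (L : R) (f : R -> plane R) :
  (forall i, measurable_fun `[0, L] (fun t => f t 0 i)) ->
  measurable_fun `[0, L] (fun t => enorm (f t)).
Proof.
move=> mf; apply: (measurableT_comp (f := fun s : R => Num.sqrt s)).
  by apply: continuous_measurable_fun => s; exact: sqrt_continuous.
by apply: measurable_funD; apply: measurable_funX.
Qed.

Lemma Lp_norm_bound (p L M : R) (f : R -> plane R) : 0 < p -> 0 <= L -> 0 <= M ->
  (forall i, measurable_fun `[0, L] (fun t => f t 0 i)) ->
  {ae mu, forall t, 0 < t < L -> `|f t 0 0| <= M /\ `|f t 0 1| <= M} ->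
  (Lp_norm p L f <= (2 * M * L `^ p^-1)%:E)%E.
Proof.
move=> p0 L0 M0 mf fM; apply: Lnorm_bounded => //.
- by rewrite mulr_ge0.
- exact: measurable_enorm.
- move: fM; apply: filterS; first exact: (ae_filter_ringOfSetsType mu).
  move=> t H /H[h0 h1]; rewrite ger0_norm ?sqrtr_ge0 //.
  by apply: le_trans (enorm_le _) _; rewrite mulr2n mulrDl !mul1r lerD.
Qed.

Lemma bending_unit (p L : R) (V A : R -> plane R) (kap : R -> R) : 0 < p ->
  (forall i, measurable_fun `[0, L] (fun t => V t 0 i)) ->
  (forall i, measurable_fun `[0, L] (fun t => A t 0 i)) ->
  itg 0 L (fun t => `|kap t| `^ p) ->
  (forall t, 0 < t < L -> enorm (V t) = 1) ->
  {ae mu, forall t, 0 < t < L -> det2 (V t) (A t) = kap t} ->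
  bending p L V A = iab 0 L (fun t => `|kap t| `^ p).
Proof.
move=> p0 mV mA kapi V1 VA; rewrite -iab_oo // /bending.
transitivity (\int[mu]_(t in `]0, L[) (`|det2 (V t) (A t)| `^ p)).
  apply: eq_Rintegral => t; rewrite inE /= in_itv /= => tL.
  by rewrite /signed_curvature V1 // expr1n divr1 mulr1.
rewrite /Rintegral; congr fine; apply: ae_eq_integral => //.
- apply/measurable_EFinP; apply: (@measurable_funS _ _ _ _ `[0, L]) => //.
    exact: subset_itv_oo_cc.
  apply: (measurableT_comp (measurable_powR _)); apply: measurableT_comp => //.
  by apply: measurable_funB; apply: measurable_funM.
- by apply: measurable_int; apply/itg_oo.
- move: VA; apply: filterS; first exact: (ae_filter_ringOfSetsType mu).
  by move=> t H /=; rewrite in_itv /= => /H ->.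
Qed.

Variables (p L lam C0 C1 : R) (c : W2p p L) (x y u v k : R -> R).
Hypotheses (p1 : 1 < p) (L0 : 0 < L) (E : extremal p L lam C0 C1 x y u v k).
Hypotheses (posE : forall t, 0 <= t <= L -> pos c t = vec2 (x t) (y t))
  (velE : forall t, 0 <= t <= L -> vel c t = vec2 (u t) (v t))
  (accE : {ae mu, forall t, 0 < t < L -> acc c t = vec2 (- k t * v t) (k t * u t)}).

Lemma enorm_vec2 (X Y : R) : X ^+ 2 + Y ^+ 2 = 1 -> enorm (vec2 X Y) = 1.
Proof. by move=> XY; rewrite /enorm vec2_0 vec2_1 XY sqrtr1. Qed.

Lemma short_period_unstable (T : R) : 0 < T -> 2 * T <= L ->
  (forall t, u (t + T) = u t) -> (forall t, v (t + T) = v t) ->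
  (forall t, k (t + T) = k t) ->
  (forall eps, 0 < eps -> exists a b t0 t1 : R,
    [/\ 0 < a /\ b < T, a < t1 < b /\ b - a < eps, a <= t0 <= b,
        u a = u b /\ v a = v b & k t0 = 0 /\ k t1 != 0]) -> ~ stable c.
Proof.
have cancelD (X Y Z : R) : X + Y - (X + Z) = Y - Z by rewrite opprD addrACA subrr add0r.
have gain (w D Q : R) : 0 < (2 - 2 * w) * D -> Q - D + (2 * w - 1) * D < Q.
  by move=> ?; lra.
move=> T0 TL uT vT kT fold [delta delta0 Hst].
have p0 : 0 < p by exact: lt_trans p1.
have uc := is_derive_continuous (ext_u E); have vc := is_derive_continuous (ext_v E).
have kc := ext_k E.
pose A0 t : R := - k t * v t; pose A1 t : R := k t * u t.
have A0c : continuous A0.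
  by apply: continuous_mul vc => t; apply: cvgN; exact: kc.
have A1c : continuous A1 by exact: (continuous_mul kc uc).
pose Bd : R := L `^ p^-1; have Bd0 : 0 <= Bd by exact: powR_ge0.
have [eta eta0 etaK] : exists2 eta : R, 0 < eta &
    2 * (eta * L) * Bd + 2 * eta * Bd + 2 * eta * Bd < delta.
  pose K : R := (2 * L + 4) * Bd + 1.
  have K0 : 0 < K by rewrite ltr_wpDl // mulr_ge0 // addr_ge0 // mulr_ge0 // ltW.
  have dK : delta = delta / K * K by rewrite divfK // gt_eqF.
  have d0 : 0 < delta / K by rewrite divr_gt0.
  exists (delta / K) => //; rewrite [ltRHS]dK; move: (delta / K) d0 => eta eta0.
  have -> : 2 * (eta * L) * Bd + 2 * eta * Bd + 2 * eta * Bd =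
    eta * ((2 * L + 4) * Bd) by ring.
  by rewrite /K ltr_pM2l // ltrDl.
have [d1 d10 U1] := uniform_continuity_segment 0 L uc eta0.
have [d2 d20 U2] := uniform_continuity_segment 0 L vc eta0.
have [d3 d30 U3] := uniform_continuity_segment 0 L A0c eta0.
have [d4 d40 U4] := uniform_continuity_segment 0 L A1c eta0.
have [eps eps0 [e1 e2 e3 e4]] : exists2 eps, 0 < eps &
    [/\ eps <= d1, eps <= d2, 2 * eps <= d3 & 2 * eps <= d4].
  exists (Num.min (Num.min d1 d2) (Num.min (d3 / 2) (d4 / 2))).
    by rewrite !lt_min d10 d20 !divr_gt0.
  split; rewrite ?ge_min ?lexx ?orbT // mulrC -ler_pdivlMr // !ge_min lexx ?orbT //.
have [a [b [t0 [t1 [[a0 bT] [at1b bae] t0ab [uab vab] [kt0 kt1]]]]]] := fold _ eps0.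
have /andP[at1 t1b] := at1b; have ab := lt_trans at1 t1b.
have a0' := ltW a0; have ab' := ltW ab.
have baT : b <= a + T by lra.
have bTL : b + T <= L by lra.
pose rho := splice_time a b T.
have rin t : 0 <= t <= L -> 0 <= rho t <= L by exact: splice_time_in.
have rnear t : `|rho t - t| < eps by apply: le_lt_trans bae; apply: splice_time_near.
have r0 : rho 0 = 0 by rewrite /rho /splice_time a0'.
have rL : rho L = L.
  have h1 : a < L by lra.
  have h2 : a + T - (b - a) < L by lra.
  rewrite /rho /splice_time (leNgt L a) h1 (leNgt L (a + T - (b - a))) h2 /=.
  by case: (leP L (b + T)) => // h3; lra.
have [M0 HM0] := splice_bounded a0' ab' baT bTL 2^-1 A0c.
have [M1 HM1] := splice_bounded a0' ab' baT bTL 2^-1 A1c.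
have mspl w (f : R -> R) : continuous f -> measurable_fun `[0, L] (splice a b T w f).
  by move=> fc; apply: measurable_funS (measurable_splice a b T w fc).
have HM0' t : 0 <= t <= L -> `|splice a b T 2^-1 A0 t| <= `|M0| + `|M1|.
  by move=> /HM0 h; apply: le_trans h _; rewrite -[leLHS]addr0 lerD // ler_norm.
have HM1' t : 0 <= t <= L -> `|splice a b T 2^-1 A1 t| <= `|M0| + `|M1|.
  by move=> /HM1 h; apply: le_trans h _; rewrite -[leLHS]add0r lerD // ler_norm.
have [d [dpos dvel dacc]] := exists_W2p (x 0) (y 0) (u 0) (v 0) p0 (ltW L0)
  (mspl _ _ A0c) (mspl _ _ A1c) HM0' HM1'.
have hu t : 0 <= t <= L -> u 0 + iab 0 t (splice a b T 2^-1 A0) = u (rho t).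
  by move=> tL; rewrite (splice_half a0' ab' baT bTL A0c (ext_u E) uab tL) addrC subrK.
have hv t : 0 <= t <= L -> v 0 + iab 0 t (splice a b T 2^-1 A1) = v (rho t).
  by move=> tL; rewrite (splice_half a0' ab' baT bTL A1c (ext_v E) vab tL) addrC subrK.
have velD t : 0 <= t <= L -> vel d t = vec2 (u (rho t)) (v (rho t)).
  by move=> tL; rewrite dvel hu // hv.
have posD t : 0 <= t <= L -> pos d t =
    vec2 (x 0 + iab 0 t (splice a b T 1 u)) (y 0 + iab 0 t (splice a b T 1 v)).
  move=> /andP[t0' tL]; rewrite dpos; congr (vec2 (_ + _) (_ + _)); apply: eq_iab => s /andP[s0 st].
    by rewrite hu ?splice1 // s0 (le_trans st).
  by rewrite hv ?splice1 // s0 (le_trans st).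
have in0 : 0 <= (0 : R) <= L by rewrite lexx ltW.
have inL : 0 <= L <= L by rewrite lexx ltW.
have x0L : x L = x 0 by rewrite -(ext_xL E 0) add0r.
have y0L : y L = y 0 by rewrite -(ext_yL E 0) add0r.
have u0L : u L = u 0 by rewrite -(ext_uL E 0) add0r.
have v0L : v L = v 0 by rewrite -(ext_vL E 0) add0r.
have Ad : A_closed (pos c 0) (vel c 0) d.
  split.
  - by move=> t tL; rewrite velD // enorm_vec2 // (ext_unit E).
  - by rewrite posD // !iab_point !addr0 posE.
  - rewrite posD // (splice_total a0' ab' baT bTL 1 ab uc (ext_x E)).
    rewrite (splice_total a0' ab' baT bTL 1 ab vc (ext_y E)).
    rewrite (periodic_increment a b (ext_x E) uT) (periodic_increment a b (ext_y E) vT) posE // x0L y0L.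
    by congr vec2; ring.
  - by rewrite velD // r0 velE.
  - by rewrite velD // rL velE // u0L v0L.
have xint t : 0 <= t <= L -> x t = x 0 + iab 0 t u /\ y t = y 0 + iab 0 t v.
  move=> /andP[t0' _]; rewrite (ftc_oo t0' uc (ext_x E)) // (ftc_oo t0' vc (ext_y E)) //.
  by rewrite ![_ + (_ - _)]addrC !subrK.
have ue s : 0 <= s <= L -> `|u (rho s) - u s| < eta.
  by move=> sL; apply: U1 => //; [exact: rin|exact: lt_le_trans e1].
have ve s : 0 <= s <= L -> `|v (rho s) - v s| < eta.
  by move=> sL; apply: U2 => //; [exact: rin|exact: lt_le_trans e2].
have ooL t : 0 < t < L -> 0 <= t <= L by move=> /andP[/ltW -> /ltW ->].
have SubE (M N : plane R) i : (M - N) 0 i = M 0 i - N 0 i by rewrite !mxE.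
have Sub (f g : R -> plane R) i : (fun t => (f t - g t) 0 i) = (fun t => f t 0 i - g t 0 i).
  by apply/funext => t; rewrite !mxE.
have etaL0 : 0 <= eta * L by rewrite mulr_ge0 // ltW.
have Eoo : {ae mu, forall t, 0 < t < L -> det2 (vel c t) (acc c t) = k t}.
  move: accE; apply: filterS; first exact: (ae_filter_ringOfSetsType mu).
  move=> t H tL; rewrite (H tL) velE ?ooL // /det2 !vec2_0 !vec2_1.
  by have := ext_unit E t; move: (u t) (v t) (k t) => U V K UV; rewrite -[RHS]mulr1 -UV; ring.
have p1' := ltW p1.
have mpos (h : W2p p L) i : measurable_fun `[0, L] (fun t => pos h t 0 i).
  by apply: Lp_on_measurable; exact: pos_Lp.
have mvel (h : W2p p L) i : measurable_fun `[0, L] (fun t => vel h t 0 i).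
  by apply: Lp_on_measurable; exact: vel_Lp.
have macc (h : W2p p L) i : measurable_fun `[0, L] (fun t => acc h t 0 i).
  by apply: Lp_on_measurable; exact: acc_Lp.
have dist : (W2p_dist c d < delta%:E)%E.
  apply: (@le_lt_trans _ _ (2 * (eta * L) * Bd + 2 * eta * Bd + 2 * eta * Bd)%:E); last first.
    by rewrite lte_fin.
  rewrite /W2p_dist !EFinD; apply: leeD; first apply: leeD.
  - apply: (Lp_norm_bound p0 (ltW L0) etaL0).
      by move=> i; rewrite Sub; exact: measurable_funB.
    apply: aeW => t /ooL tL; have [xt yt] := xint t tL.
    have := splice1_iab_close a0' ab' baT bTL vc eta0 ve tL.
    have := splice1_iab_close a0' ab' baT bTL uc eta0 ue tL.
    rewrite posE // posD // !SubE xt yt.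
    by rewrite !vec2_0 !vec2_1 !cancelD.
  - apply: (Lp_norm_bound p0 (ltW L0) (ltW eta0)).
      by move=> i; rewrite Sub; exact: measurable_funB.
    apply: aeW => t /ooL tL; rewrite velE // velD // !SubE.
    have := ue t tL; rewrite distrC => /ltW h1.
    have := ve t tL; rewrite distrC => /ltW h2.
    by rewrite !vec2_0 !vec2_1.
  - apply: (Lp_norm_bound p0 (ltW L0) (ltW eta0)).
      by move=> i; rewrite Sub; exact: measurable_funB.
    move: accE; apply: filterS; first exact: (ae_filter_ringOfSetsType mu).
    move=> t H tL; rewrite (H tL) dacc !SubE !vec2_0 !vec2_1.
    have B (f : R -> R) d' : 2 * eps <= d' -> f t0 = 0 -> (forall t, f (t + T) = f t) ->
      (forall s t, 0 <= s <= L -> 0 <= t <= L -> `|s - t| < d' -> `|f s - f t| < eta) ->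
      `|f t - splice a b T 2^-1 f t| <= eta.
      move=> ed ft0 fT fU; apply: (splice_half_close a0' ab' baT bTL bae t0ab ft0 fT _ (ooL _ tL)).
      by move=> s r sL rL' sr; apply: fU => //; exact: lt_le_trans ed.
    split; [apply: (B A0 _ e3 _ _ U3)|apply: (B A1 _ e4 _ _ U4)].
    + by rewrite /A0 kt0 oppr0 mul0r.
    + by move=> r; rewrite /A0 kT vT.
    + by rewrite /A1 kt0 mul0r.
    + by move=> r; rewrite /A1 kT uT.
have := Hst d Ad dist.
pose f t : R := `|k t| `^ p.
have fc : continuous f.
  by apply: (continuous_compose (g := fun r : R => `|r| `^ p) kc) => s; exact: continuous_normp.
have [P DP] := primitive_exists fc.
have fT t : f (t + T) = f t by rewrite /f kT.
pose w : R := 2^-1 `^ p.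
have w1 : w < 1.
  have pw1 : (1 : R) `^ p = 1 by rewrite powR1.
  rewrite -pw1; apply: gt0_ltr_powR; rewrite ?nnegrE //; lra.
have fw t : `|splice a b T 2^-1 k t| `^ p = splice a b T w f t.
  rewrite /splice; case: ifP => _; last by rewrite !mul1r.
  by rewrite normrM powRM // ger0_norm ?invr_ge0.
rewrite (bending_unit (kap := k) p0 (mvel c) (macc c)) //; last 2 first.
- exact: continuous_itg.
- by move=> t /ooL tL; rewrite velE // enorm_vec2 // (ext_unit E).
have fwi : itg 0 L (fun t => `|splice a b T 2^-1 k t| `^ p).
  rewrite (_ : (fun t => _) = splice a b T w f); last exact/funext.
  exact: splice_itg.
rewrite (bending_unit (kap := splice a b T 2^-1 k) p0 (mvel d) (macc d) fwi); last 2 first.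
- by move=> t /ooL tL; rewrite velD // enorm_vec2 // (ext_unit E).
- apply: aeW => t /ooL tL; rewrite velD // dacc /det2 !vec2_0 !vec2_1 /splice -/rho.
  have := ext_unit E (rho t); rewrite /A0 /A1; move: (u (rho t)) (v (rho t)) (k (rho t)) => U V K UV.
  by rewrite -[RHS]mulr1 -UV; ring.
have -> : (fun t => `|splice a b T 2^-1 k t| `^ p) = splice a b T w f by exact/funext.
rewrite (splice_total a0' ab' baT bTL w ab fc DP) (periodic_increment a b DP fT).
have -> : iab 0 L f = P L - P 0 by apply: (ftc_oo (ltW L0) fc DP).
have f0 t : 0 <= f t by exact: powR_ge0.
have mono r s : r <= s -> P r <= P s.
  by move=> rs; exact: (is_derive_le rs (fun t _ => DP t) (fun t _ => f0 t)).
have Pab : P a < P b.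
  rewrite lt_neqAle mono // andbT; apply/eqP => Pab.
  have near_cst : {near t1, (fun _ : R => P a) =1 P}.
    apply: filterS (near_itvoo at1b) => s /andP[as_ sb].
    by apply/eqP; rewrite eq_le mono ?(ltW as_) //= Pab mono // ltW.
  have [_] := near_eq_is_derive near_cst (is_derive_const _ t1).
  have [_ ->] := DP t1 => /eqP; rewrite powR_eq0 normr_eq0 (negbTE kt1) //.
rewrite leNgt => /negP; apply.
by apply: gain; rewrite mulr_gt0 ?subr_gt0 // -[ltRHS]mulr1 ltr_pM2l.
Qed.

End Competitor.

Section Folding.
Context {R : realType}.
Implicit Types (r s t : R).

Lemma derivative_periodic (f df : R -> R) (T : R) :
  (forall t : R, is_derive t 1 f (df t)) -> (forall t, f (t + T) = f t) ->
  forall t, df (t + T) = df t.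
Proof.
move=> Df fT t; have [_ <-] := Df t.
have D : is_derive t 1 (fun s => s + T) 1.
  by apply: (is_derive_eq (is_derive_add (is_derive_id t 1) (is_derive_const T t))); rewrite addr0.
have := @is_derive_comp R f (fun s => s + T) t _ _ (Df (t + T)) D; rewrite mulr1.
by rewrite (_ : (fun s => f (s + T)) = f); [case|exact/funext].
Qed.

Lemma level_pair_at_max (f : R -> R) (t0 del : R) : continuous f -> 0 < del ->
  f (t0 - del) <= f t0 -> f (t0 + del) <= f t0 -> exists a b : R,
  [/\ t0 - del <= a <= t0, t0 <= b <= t0 + del, a < b & f a = f b].
Proof.
move=> fc del0 f1 f2.
have h1 : t0 - del <= t0 by lra.
have h2 : t0 <= t0 + del by lra.
have [le|/ltW le] := leP (f (t0 - del)) (f (t0 + del)).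
  have [] := @IVT R f (t0 - del) t0 (f (t0 + del)) h1 (continuous_subspaceT fc).
    by rewrite (min_idPl f1) (max_idPr f1) le f2.
  move=> a; rewrite in_itv /= => /andP[a1 a2] fa; exists a, (t0 + del).
  by split; rewrite ?fa ?a1 ?a2 ?h2 ?lexx //; lra.
have [] := @IVT R f t0 (t0 + del) (f (t0 - del)) h2 (continuous_subspaceT fc).
  by rewrite (min_idPr f2) (max_idPl f2) le f1.
move=> b; rewrite in_itv /= => /andP[b1 b2] fb; exists (t0 - del), b.
by split; rewrite ?fb ?b1 ?b2 ?h1 ?lexx //; lra.
Qed.

Section WaveFold.
Variables (p lam A tau : R) (x y u v k : R -> R).
Hypotheses (p1 : 1 < p) (A0 : 0 < A) (E : extremal p 1 lam A 0 x y u v k).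
Hypotheses (tau0 : 0 < tau) (ut : forall t, u (t + tau) = u t)
  (vt : forall t, v (t + tau) = v t).

Let g t : R := v t / (1 + u t).

Let u1 t : 0 < 1 + u t.
Proof. by have := extremal_u_gt p1 E A0 t; lra. Qed.

Let Dg t : is_derive t 1 g (k t / (1 + u t)).
Proof.
have D : is_derive t 1 (fun s => 1 + u s) (- k t * v t).
  by apply: (is_derive_eq (is_derive_add (is_derive_const 1 t) (ext_u E t))); rewrite add0r.
have uN0 : 1 + u t != 0 by rewrite gt_eqF.
apply: (is_derive_eq (@is_derive_div R v (fun s => 1 + u s) t _ _ uN0 (ext_v E t) D)).
have -> : k t * u t * (1 + u t) - v t * (- k t * v t) =
  k t * (u t + (u t ^+ 2 + v t ^+ 2)) by ring.
by rewrite (ext_unit E); field.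
Qed.

Let g_inj a b : g a = g b -> u a = u b /\ v a = v b.
Proof.
move=> gab; have vE t : v t = g t * (1 + u t) by rewrite /g divfK // gt_eqF.
have uE t : 1 - u t = g t ^+ 2 * (1 + u t).
  have uN0 : 1 + u t != 0 by rewrite gt_eqF.
  apply: (mulIf uN0); rewrite -mulrA -expr2 -exprMn -vE.
  have -> : v t ^+ 2 = 1 - u t ^+ 2 by rewrite -(ext_unit E t) addrC addKr.
  by ring.
have uab : u a = u b.
  have ga := uE a; have gb := uE b; rewrite gab in ga.
  have : (1 + g b ^+ 2) * (u a - u b) = 0.
    have -> : (1 + g b ^+ 2) * (u a - u b) =
      (g b ^+ 2 * (1 + u a) - g b ^+ 2 * (1 + u b)) + (u a - u b) by ring.
    by rewrite -ga -gb; ring.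
  move/eqP; rewrite mulf_eq0 gt_eqF ?ltr_pwDl ?sqr_ge0 //= subr_eq0.
  by move/eqP.
by split=> //; rewrite vE gab uab -vE.
Qed.

Let g_extremum : exists (sg t0 : R), [/\ (sg == 1) || (sg == -1), 0 < t0 < tau &
  forall t, 0 <= t <= tau -> sg * g t <= sg * g t0].
Proof.
have gc := is_derive_continuous Dg.
have gT t : g (t + tau) = g t by rewrite /g ut vt.
have [M Min HM] := EVT_max (ltW tau0) (continuous_subspaceT gc).
have [m min_ Hm] := EVT_min (ltW tau0) (continuous_subspaceT gc).
have gtau : g tau = g 0 by rewrite -[tau]add0r gT.
have interior s : s \in `[0, tau] -> g s != g 0 -> 0 < s < tau.
  rewrite in_itv /= !le_eqVlt => /andP[/predU1P[<-|->] /predU1P[->|->]] //.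
  - by rewrite eqxx.
  - by rewrite eqxx.
  - by rewrite gtau eqxx.
have [g0|/(interior _ Min) Mi] := eqVneq (g M) (g 0); last first.
  by exists 1, M; rewrite eqxx; split=> // t tin; rewrite !mul1r HM // in_itv.
have [g0'|/(interior _ min_) mi] := eqVneq (g m) (g 0); last first.
  by exists (-1), m; rewrite eqxx orbT; split=> // t tin; rewrite !mulN1r lerN2 Hm // in_itv.
exfalso; have g0c t : g t = g 0.
  have [n [s [/andP[s0 s1] ->]]] := floor_split t tau0.
  rewrite (periodic_shift gT); apply/eqP; rewrite eq_le.
  have sin_ : s \in `[0, tau] by rewrite in_itv /= s0 ltW.
  by rewrite -{1}g0 HM // -g0' Hm.
apply: (velocity_nonconstant E (a := u 0) (b := v 0)) => t.
exact: g_inj.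
Qed.

Lemma wave_fold (eps : R) : 0 < eps -> exists a b t0 t1 : R,
  [/\ 0 < a /\ b < tau, a < t1 < b /\ b - a < eps, a <= t0 <= b,
      u a = u b /\ v a = v b & k t0 = 0 /\ k t1 != 0].
Proof.
move=> eps0; have [sg [t0 [sg1 /andP[t00 t0t] Hmax]]] := g_extremum.
have sgN0 : sg != 0 by case/orP: sg1 => /eqP ->; rewrite ?oppr_eq0 oner_eq0.
have Dsg t : is_derive t 1 (fun s => sg * g s) (sg * (k t / (1 + u t))).
  exact: is_derive_cmul (Dg t).
have kt0 : k t0 = 0.
  have D0 : is_derive t0 1 (fun s => sg * g s) 0.
    apply: (@derive1_at_max R _ 0 tau) => //; first exact: ltW.
    - by rewrite in_itv /= t00.
    - by move=> t; rewrite in_itv /= => /andP[h1 h2]; apply: Hmax; rewrite !ltW.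
  have [_ D1] := D0; have [_ D2] := Dsg t0; move: D2; rewrite D1 => /esym/eqP.
  by rewrite mulf_eq0 (negbTE sgN0) /= mulf_eq0 invr_eq0 (gt_eqF (u1 _)) orbF => /eqP.
have [del del0 [d1 d2 d3]] : exists2 del : R, 0 < del &
    [/\ del < t0, del < tau - t0 & 2 * del < eps].
  exists (Num.min (Num.min (t0 / 2) ((tau - t0) / 2)) (eps / 3)).
    by rewrite !lt_min; do 2?[apply/andP; split]; lra.
  split; rewrite ?gt_min; last first.
  - apply: (@le_lt_trans _ _ (2 * (eps / 3))); last by lra.
    by rewrite ler_pM2l // ge_min lexx orbT.
  - by apply/orP; left; apply/orP; right; lra.
  - by apply/orP; left; apply/orP; left; lra.
have [a [b [/andP[a1 a2] /andP[b1 b2] ab sgab]]] : exists a b : R,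
    [/\ t0 - del <= a <= t0, t0 <= b <= t0 + del, a < b & sg * g a = sg * g b].
  apply: (@level_pair_at_max (fun s => sg * g s)) => //.
  - exact: is_derive_continuous Dsg.
  - by apply: Hmax; apply/andP; split; lra.
  - by apply: Hmax; apply/andP; split; lra.
have gab : g a = g b by apply: (mulfI sgN0).
have [t1 at1b kt1] : exists2 t1, a < t1 < b & k t1 != 0.
  apply: contrapT => nex; pose m := (a + b) / 2.
  have mab : a < m < b by rewrite /m; apply/andP; split; lra.
  have k0 s : a < s < b -> k s = 0.
    by move=> sab; apply/eqP; apply: contrapT => /negP ks; apply: nex; exists s.
  have km := k0 m mab; have near0 : {near m, (fun _ : R => 0) =1 (fun s => p * sgp (p - 1) (k s))}.
    by apply: filterS (near_itvoo mab) => s /k0 ->; rewrite sgp0 mulr0.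
  have [_ D1] := near_eq_is_derive near0 (is_derive_const 0 m).
  have [_ D2] := ext_w E m; move: D2; rewrite D1 mul0r sub0r => /esym/eqP.
  rewrite oppr_eq0 mulf_eq0 gt_eqF //= => /eqP vm.
  have := ext_unit E m; rewrite vm expr0n addr0 => um.
  have : (u m - 1) * (1 + u m) = u m ^+ 2 - 1 by ring.
  rewrite um subrr.
  move/eqP; rewrite mulf_eq0 (gt_eqF (u1 m)) orbF subr_eq0 => /eqP um1.
  have := ext_energy E m; rewrite km um1 normr0 powR0 ?gt_eqF ?(lt_trans ltr01) //.
  rewrite mulr0 mulr1 mul0r addr0 => e0.
  by have := extremal_lam_gt p1 E A0; lra.
exists a, b, t0, t1; split.
- by split; lra.
- by split=> //; lra.
- by rewrite a2 b1.
- exact: g_inj.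
- by [].
Qed.

End WaveFold.

Lemma stable_wave_period (p L lam C0 C1 lam' A e0 e1 tau : R) (c : W2p p L)
    (x y u v k : R -> R) :
  1 < p -> 0 < L -> extremal p L lam C0 C1 x y u v k ->
  (forall t, 0 <= t <= L -> pos c t = vec2 (x t) (y t)) ->
  (forall t, 0 <= t <= L -> vel c t = vec2 (u t) (v t)) ->
  {ae @lebesgue_measure R,
    forall t, 0 < t < L -> acc c t = vec2 (- k t * v t) (k t * u t)} ->
  stable c -> e0 ^+ 2 + e1 ^+ 2 = 1 -> 0 < A ->
  let U t := e0 * u (L * t) + e1 * v (L * t) in
  let V t := e0 * v (L * t) - e1 * u (L * t) in
  (exists X Y, extremal p 1 lam' A 0 X Y U V (fun t => L * k (L * t))) ->
  0 < tau < 1 -> (forall t, U (t + tau) = U t) -> (forall t, V (t + tau) = V t) ->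
  False.
Proof.
move=> p1 L0 E posE velE accE st ee A0 U V [X [Y En]].
wlog tau2 : tau / (2 * tau <= 1).
  move=> W /andP[tau0 tau1] Ut Vt; have [t2|t2] := leP (2 * tau) 1.
    by apply: (W tau) => //; rewrite tau0.
  have tshift t : t + (1 - tau) + tau = t + 1 by ring.
  apply: (W (1 - tau)); [lra|by apply/andP; split; lra| |] => t.
    by rewrite -(ext_uL En t) -tshift Ut.
  by rewrite -(ext_vL En t) -tshift Vt.
move=> /andP[tau0 tau1] Ut Vt.
have uE t : u (L * t) = e0 * U t - e1 * V t.
  rewrite /U /V -[LHS]mul1r -ee; ring.
have vE t : v (L * t) = e1 * U t + e0 * V t.
  rewrite /U /V -[LHS]mul1r -ee; ring.
have LK t : L * (t / L) = t by rewrite mulrC divfK // gt_eqF.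
have LT t : t + L * tau = L * (t / L + tau) by rewrite mulrDr LK.
have uT t : u (t + L * tau) = u t by rewrite LT uE Ut Vt -uE LK.
have vT t : v (t + L * tau) = v t by rewrite LT vE Ut Vt -vE LK.
have kT t : k (t + L * tau) = k t.
  have D1 := derivative_periodic (ext_u E) uT t; have D2 := derivative_periodic (ext_v E) vT t.
  rewrite /= vT in D1; rewrite /= uT in D2.
  have := ext_unit E t => un; rewrite -[LHS]mulr1 -[RHS]mulr1 -un.
  have -> : k (t + L * tau) * (u t ^+ 2 + v t ^+ 2) =
    u t * (k (t + L * tau) * u t) - v t * (- k (t + L * tau) * v t) by ring.
  by rewrite D1 D2; ring.
apply: (@short_period_unstable R p L lam C0 C1 c x y u v k p1 L0 E posE velE accE (L * tau)) => //.
- exact: mulr_gt0.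
- by rewrite mulrCA -[leRHS]mulr1 ler_pM2l.
move=> eps eps0; have epsL : 0 < eps / L by rewrite divr_gt0.
have [a [b [t0 [t1 [[a0 bt] [/andP[at1 t1b] bae] /andP[at0 t0b] [Uab Vab] [kt0 kt1]]]]]] :=
  wave_fold p1 A0 En tau0 Ut Vt epsL.
exists (L * a), (L * b), (L * t0), (L * t1); split.
- by rewrite mulr_gt0 // ltr_pM2l.
- split; first by rewrite !ltr_pM2l // at1.
  by rewrite -mulrBr mulrC -ltr_pdivlMr.
- by rewrite !ler_pM2l // at0.
- by rewrite !uE !vE Uab Vab.
- move/eqP: kt0; move: kt1; rewrite !mulf_eq0 (gt_eqF L0) /= => kt1 /eqP kt0.
  by [].
Qed.

End Folding.

Section RotationNumber.
Context {R : realType}.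
Implicit Types (r s t d : R) (G : R -> plane R).

(* The rotation number of the closed curve of directions G is d / (2 pi). *)
Definition angle_lift G d := exists th : R -> R,
  [/\ continuous th,
      forall t, exists2 r, 0 < r & G t 0 0 = r * cos (th t) /\ G t 0 1 = r * sin (th t) &
      forall t, th (t + 1) = th t + d].

Definition dot2 (a b : plane R) : R := a 0 0 * b 0 0 + a 0 1 * b 0 1.

Lemma dot2_near (a b : plane R) : enorm (b - a) < enorm a -> 0 < dot2 a b.
Proof.
move=> h; have Y0 : 0 < a 0 0 ^+ 2 + a 0 1 ^+ 2.
  by have := le_lt_trans (sqrtr_ge0 _) h; rewrite sqrtr_gt0.
move: h; rewrite /enorm ltr_sqrt // !mxE /dot2 => h.
have := sqr_ge0 (b 0 0); have := sqr_ge0 (b 0 1); move: h.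
move: (a 0 0) (a 0 1) (b 0 0) (b 0 1) => a0 a1 b0 b1; rewrite !sqrrB => h h1 h0.
by lra.
Qed.

Lemma angle_lift_near G G' d : (forall t, 0 < dot2 (G t) (G' t)) ->
  (forall i, continuous (fun t => G t 0 i)) -> (forall i, continuous (fun t => G' t 0 i)) ->
  (forall t, G (t + 1) = G t) -> (forall t, G' (t + 1) = G' t) ->
  angle_lift G d -> angle_lift G' d.
Proof.
move=> dot0 Gc Gc' G1 G1' [th [thc thE th1]].
pose be t : R := atan (det2 (G t) (G' t) / dot2 (G t) (G' t)).
have Dc : continuous (fun t => dot2 (G t) (G' t)).
  by apply: continuous_add; apply: continuous_mul.
have Ec : continuous (fun t => det2 (G t) (G' t)).
  by apply: continuous_sub; apply: continuous_mul.
exists (fun t => th t + be t); split.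
- apply: continuous_add => //.
  apply: (@continuous_compose R (fun t => det2 (G t) (G' t) / dot2 (G t) (G' t)) atan).
    by move=> t; apply: cvgM; [exact: Ec|apply: cvgV; [rewrite gt_eqF|exact: Dc]].
  exact: continuous_atan.
- move=> t; have [r r0 [g0 g1]] := thE t.
  set D := dot2 (G t) (G' t); set Dl := det2 (G t) (G' t).
  have D0 : 0 < D := dot0 t.
  have cb : 0 < cos (be t) by rewrite cos_atan invr_gt0 sqrtr_gt0 ltr_pwDl ?sqr_ge0.
  have cbN : cos (be t) != 0 by rewrite gt_eqF.
  have tb : sin (be t) = Dl / D * cos (be t).
    have : tan (be t) = Dl / D by rewrite /be atanK.
    by rewrite /tan => <-; rewrite divfK.
  pose m : R := D / cos (be t).
  have m0 : 0 < m by rewrite divr_gt0.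
  have DE : D = m * cos (be t) by rewrite /m divfK.
  have DlE : Dl = m * sin (be t).
    by rewrite tb /m; field; rewrite cbN gt_eqF.
  exists (m / r); first by rewrite divr_gt0.
  have := cos2Dsin2 (th t); move: DE DlE; rewrite /D /Dl /dot2 /det2 g0 g1 cosD sinD.
  move: (cos (th t)) (sin (th t)) (cos (be t)) (sin (be t)) (G' t 0 0) (G' t 0 1).
  clear -r0; move=> c s cb sb x y DE DlE cs.
  have rN : r != 0 by rewrite gt_eqF.
  have E1 : c * x + s * y = m / r * cb.
    by rewrite mulrAC -DE; field.
  have E2 : c * y - s * x = m / r * sb.
    by rewrite mulrAC -DlE; field.
  split.
    have -> : m / r * (c * cb - s * sb) = c * (m / r * cb) - s * (m / r * sb) by ring.
    by rewrite -E1 -E2 -[LHS]mul1r -cs; ring.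
  have -> : m / r * (s * cb + c * sb) = s * (m / r * cb) + c * (m / r * sb) by ring.
  by rewrite -E1 -E2 -[LHS]mul1r -cs; ring.
- by move=> t; rewrite th1 /be G1 G1' addrAC.
Qed.

Lemma angle_lift_unique G d d' : angle_lift G d -> angle_lift G d' -> d = d'.
Proof.
move=> [th [thc thE th1]] [th' [thc' thE' th1']].
pose f t : R := th t - th' t.
have fc : continuous f by exact: continuous_sub.
have cs t : cos (th t) = cos (th' t) /\ sin (th t) = sin (th' t).
  have [r r0 [g0 g1]] := thE t; have [r' r0' [g0' g1']] := thE' t.
  rewrite g0 in g0'; rewrite g1 in g1'.
  have rr : r = r'.
    have : r ^+ 2 = r' ^+ 2.
      rewrite -[LHS]mulr1 -(cos2Dsin2 (th t)) -[RHS]mulr1 -(cos2Dsin2 (th' t)).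
      by rewrite !mulrDr -!exprMn g0' g1'.
    by move/eqP; rewrite eqrXn2 ?ltW // => /eqP.
  have rN : r != 0 by rewrite gt_eqF.
  by rewrite -rr in g0' g1'; split; apply: (mulfI rN).
have sub s t : `|f s - f t| < pi -> f s = f t.
  have sin0 r : sin (f r) = 0.
    by rewrite /f sinB; have [-> ->] := cs r; rewrite mulrC subrr.
  have ss : sin (f s - f t) = 0 by rewrite sinB !sin0 mul0r mulr0 subrr.
  rewrite ltr_norml => /andP[h1 h2]; apply/eqP; rewrite -subr_eq0.
  have [lt|gt|//] := ltgtP (f s - f t) 0.
    have : 0 < sin (- (f s - f t)) by rewrite sin_gt0_pi // oppr_gt0 lt /= ltrNl.
    by rewrite sinN ss oppr0 ltxx.
  have : 0 < sin (f s - f t) by rewrite sin_gt0_pi // gt.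
  by rewrite ss ltxx.
have loc t : 0 <= t <= 1 -> exists2 e, 0 < e &
    forall s, 0 <= s <= 1 -> `|s - t| < e -> (f s = f 0 <-> f t = f 0).
  move=> _; have /cvgrPdist_lt/(_ _ (pi_gt0 R)) := fc t.
  move=> /nbhs_ballP[e e0 He]; exists e => // s _ st.
  have -> : f s = f t by apply: sub; rewrite distrC; apply: He; rewrite /ball /= distrC.
  by [].
have [H _] := @locally_constant R (fun t => f t = f 0) 0 1 ler01 loc.
have := H erefl; rewrite /f -[1]add0r th1 th1' => e.
by apply/eqP; rewrite -subr_eq0; apply/eqP; lra.
Qed.

Lemma rotation_number_invariant (c0 c1 : R -> plane R) d0 d1 :
  regularly_homotopic c0 c1 -> angle_lift (derive1 c0) d0 ->
  angle_lift (derive1 c1) d1 -> d0 = d1.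
Proof.
move=> [H [H0 H1 Him Hc]] l0 l1.
suff [h _] : angle_lift (derive1 (H 0)) d0 <-> angle_lift (derive1 (H 1)) d0.
  by apply: angle_lift_unique l1; rewrite -H1; apply: h; rewrite H0.
have coordc s : 0 <= s <= 1 -> forall i, continuous (fun t => derive1 (H s) t 0 i).
  move=> s01 i t; have [_ _ c _] := Him s s01.
  exact: (cvg_comp _ (fun M : plane R => M 0 i) (c t) (@coord_continuous R 1 2 0 i _)).
have per s : 0 <= s <= 1 -> forall t, derive1 (H s) (t + 1) = derive1 (H s) t.
  move=> s01 t; have [Hp Hd _ _] := Him s s01.
  have coord i : derive1 (H s) (t + 1) 0 i = derive1 (H s) t 0 i.
    apply: (@derivative_periodic R (fun r => H s r 0 i) (fun r => derive1 (H s) r 0 i) 1).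
      by move=> r; exact: coord_derive1.
    by move=> r; rewrite Hp.
  by apply: plane_eq.
apply: (@locally_constant R (fun s => angle_lift (derive1 (H s)) d0) 0 1 ler01) => s s01.
have [Hp Hd cG G0] := Him s s01.
pose N t : R := enorm (derive1 (H s) t).
have Nc : continuous N.
  apply: (@continuous_compose R _ Num.sqrt); last exact: sqrt_continuous.
  by apply: continuous_add; apply: continuous_mul; exact: coordc.
have [m m01 Hm] := EVT_min (ler01 : (0 : R) <= 1) (continuous_subspaceT Nc).
have Nm0 : 0 < N m.
  rewrite sqrtr_gt0 lt_neqAle addr_ge0 ?sqr_ge0 // andbT eq_sym.
  rewrite paddr_eq0 ?sqr_ge0 // !sqrf_eq0; apply/negP => /andP[/eqP a0 /eqP a1].
  have := G0 m; rewrite (_ : derive1 (H s) m = 0) ?eqxx //.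
  by apply: plane_eq; rewrite ?a0 ?a1 mxE.
have Nmin t : N m <= N t.
  have [n [r [/andP[r0 r1] ->]]] := floor_split t (ltr01 : (0 : R) < 1).
  have NT q : N (q + 1) = N q by rewrite /N per.
  by rewrite (periodic_shift NT) Hm // in_itv /= r0 ltW.
have [del del0 Hdel] := Hc s s01 _ Nm0.
exists del; [exact: del0|move=> r r01 rs].
have dot0 t : 0 < dot2 (derive1 (H s) t) (derive1 (H r) t).
  by apply: dot2_near; have [_ h] := Hdel r r01 rs t; exact: lt_le_trans (Nmin t).
split.
  apply: angle_lift_near; [|exact: coordc|exact: coordc|exact: per|exact: per].
  by move=> t; rewrite /dot2 mulrC [X in _ + X]mulrC; exact: dot0.
by apply: angle_lift_near; [exact: dot0|exact: coordc|exact: coordc|exact: per|exact: per].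
Qed.

End RotationNumber.

Section Lifts.
Context {R : realType}.
Implicit Types (r s t d : R) (u v : R -> R).

Lemma unit_angle (a b : R) : a ^+ 2 + b ^+ 2 = 1 ->
  exists al : R, a = cos al /\ b = sin al.
Proof.
move=> ab; have a1 : -1 <= a <= 1.
  have := sqr_ge0 b => h; rewrite -ler_norml -[leRHS](ger0_norm ler01).
  by rewrite -ler_sqr ?nnegrE // !real_normK ?num_real //; lra.
have ca : cos (acos a) = a by rewrite acosK // in_itv.
have sa : sin (acos a) = `|b|.
  by rewrite sin_acos // -sqrtr_sqr; congr Num.sqrt; lra.
have [b0|b0] := leP 0 b.
  by exists (acos a); rewrite ca sa ger0_norm.
by exists (- acos a); rewrite cosN sinN ca sa ltr0_norm // opprK.
Qed.

Definition unit_lift u v d := exists th : R -> R, [/\ continuous th,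
  forall t, u t = cos (th t) /\ v t = sin (th t) & forall t, th (t + 1) = th t + d].

Lemma circle_angle u v (kap : R) :
  (forall t : R, is_derive t 1 u (- kap * v t)) ->
  (forall t : R, is_derive t 1 v (kap * u t)) ->
  (forall t, u t ^+ 2 + v t ^+ 2 = 1) ->
  exists al : R, forall t, u t = cos (kap * t + al) /\ v t = sin (kap * t + al).
Proof.
move=> Du Dv uv; have [al [u0 v0]] := unit_angle (uv 0); exists al => t.
have Dk s : is_derive s 1 (fun s => kap * s) kap.
  by apply: (is_derive_eq (is_derive_cmul kap (is_derive_id s 1))); rewrite mulr1.
have Dc s : is_derive s 1 (fun s => cos (kap * s)) (- sin (kap * s) * kap).
  exact: (@is_derive_comp R cos (fun s => kap * s) s _ _ (is_derive_cos _) (Dk s)).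
have Ds s : is_derive s 1 (fun s => sin (kap * s)) (cos (kap * s) * kap).
  exact: (@is_derive_comp R sin (fun s => kap * s) s _ _ (is_derive_sin _) (Dk s)).
have E1 s : is_derive s 1 (fun s => u s * cos (kap * s) + v s * sin (kap * s)) 0.
  apply: (is_derive_eq (is_derive_add (is_derive_mul (Du s) (Dc s)) (is_derive_mul (Dv s) (Ds s)))).
  by ring.
have E2 s : is_derive s 1 (fun s => v s * cos (kap * s) - u s * sin (kap * s)) 0.
  apply: (is_derive_eq (is_derive_sub (is_derive_mul (Dv s) (Dc s)) (is_derive_mul (Du s) (Ds s)))).
  by ring.
have := is_derive_0_is_cst t 0 E1; have := is_derive_0_is_cst t 0 E2.
rewrite mulr0 cos0 sin0 !mulr1 !mulr0 addr0 subr0 u0 v0 cosD sinD => e2 e1.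
have cs := cos2Dsin2 (kap * t); move: e1 e2 cs.
move: (cos (kap * t)) (sin (kap * t)) => c s <- <- cs; split.
  by rewrite -[LHS]mulr1 -cs; ring.
by rewrite -[LHS]mulr1 -cs; ring.
Qed.

Lemma circle_unit_lift u v (kap al : R) :
  (forall t, u t = cos (kap * t + al) /\ v t = sin (kap * t + al)) ->
  unit_lift u v kap.
Proof.
move=> H; exists (fun t => kap * t + al); split=> // [|t]; last by rewrite mulrDr mulr1 addrAC.
exact: (is_derive_continuous (fun t => is_derive_affine kap al t)).
Qed.

Lemma wave_unit_lift u v : continuous u -> continuous v -> (forall t, - 1 < u t) ->
  (forall t, u t ^+ 2 + v t ^+ 2 = 1) -> (forall t, u (t + 1) = u t) ->
  (forall t, v (t + 1) = v t) -> unit_lift u v 0.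
Proof.
move=> uc vc u1 uv uT vT; have u0 t : 1 + u t != 0 by rewrite gt_eqF //; have := u1 t; lra.
pose g t : R := v t / (1 + u t).
have gc : continuous g.
  move=> t; apply: cvgM; first exact: vc.
  by apply: cvgV => //; apply: cvgD; [exact: cvg_cst|exact: uc].
have ac : continuous (fun t => atan (g t)).
  apply: (continuous_compose gc) => t; exact: continuous_atan.
exists (fun t => atan (g t) + atan (g t)); split.
- exact: (continuous_add ac ac).
- move=> t; have g0 : 0 < 1 + g t ^+ 2 by rewrite ltr_pwDl ?sqr_ge0.
  have cb2 : cos (atan (g t)) ^+ 2 = (1 + g t ^+ 2)^-1.
    by rewrite cos_atan exprVn sqr_sqrtr // ltW.
  have cbN : cos (atan (g t)) != 0 by rewrite cos_atan invr_eq0 gt_eqF // sqrtr_gt0.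
  have tb : sin (atan (g t)) = g t * cos (atan (g t)).
    by rewrite -{2}(atanK (g t)) /tan divfK.
  have gE : 1 + g t ^+ 2 = 2 / (1 + u t).
    have -> : 1 + g t ^+ 2 = ((1 + u t) ^+ 2 + v t ^+ 2) / (1 + u t) ^+ 2.
      by rewrite /g; field; exact: u0.
    have -> : (1 + u t) ^+ 2 + v t ^+ 2 = 1 + 2 * u t + (u t ^+ 2 + v t ^+ 2) by ring.
    by rewrite uv; field; exact: u0.
  have c2 : cos (atan (g t)) ^+ 2 = (1 + u t) / 2 by rewrite cb2 gE invf_div.
  rewrite cosD sinD tb; split.
    have -> : cos (atan (g t)) * cos (atan (g t)) - g t * cos (atan (g t)) * (g t * cos (atan (g t)))
      = cos (atan (g t)) ^+ 2 * (2 - (1 + g t ^+ 2)) by ring.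
    by rewrite c2 gE; field; exact: u0.
  have -> : g t * cos (atan (g t)) * cos (atan (g t)) + cos (atan (g t)) * (g t * cos (atan (g t)))
      = cos (atan (g t)) ^+ 2 * (2 * g t) by ring.
  by rewrite c2 /g; field; exact: u0.
- by move=> t; rewrite addr0 /g uT vT.
Qed.

Definition rot (e0 e1 : R) (w : plane R) : plane R :=
  vec2 (e0 * w 0 0 - e1 * w 0 1) (e1 * w 0 0 + e0 * w 0 1).

Lemma scale_coord (a : R) (w : plane R) i : (a *: w) 0 i = a * w 0 i.
Proof. by rewrite mxE. Qed.

Lemma add_coord (w z : plane R) i : (w + z) 0 i = w 0 i + z 0 i.
Proof. by rewrite mxE. Qed.

Lemma sub_coord (w z : plane R) i : (w - z) 0 i = w 0 i - z 0 i.
Proof. by rewrite !mxE. Qed.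

Lemma unit_lift_rot (G : R -> plane R) u v (L e0 e1 d : R) : 0 < L ->
  e0 ^+ 2 + e1 ^+ 2 = 1 ->
  (forall t, G t = L *: rot e0 e1 (vec2 (u t) (v t))) -> unit_lift u v d -> angle_lift G d.
Proof.
move=> L0 ee GE [th [thc thE th1]]; have [al [e0E e1E]] := unit_angle ee.
exists (fun t => al + th t); split.
- by apply: continuous_add => //; exact: continuous_const.
- move=> t; exists L => //; have [uE vE] := thE t.
  rewrite GE !scale_coord /rot !vec2_0 !vec2_1 uE vE e0E e1E cosD sinD.
  by split; congr (_ * _).
- by move=> t; rewrite th1 addrA.
Qed.

Lemma enorm_rot e0 e1 w : e0 ^+ 2 + e1 ^+ 2 = 1 -> enorm (rot e0 e1 w) = enorm w.
Proof.
move=> ee; rewrite /enorm /rot vec2_0 vec2_1; congr Num.sqrt.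
by rewrite -[RHS]mul1r -ee; ring.
Qed.

Lemma rotB e0 e1 (w z : plane R) : rot e0 e1 w - rot e0 e1 z = rot e0 e1 (w - z).
Proof.
by apply: plane_eq; rewrite sub_coord /rot ?vec2_0 ?vec2_1 !sub_coord; ring.
Qed.

Lemma rotK e0 e1 w : e0 ^+ 2 + e1 ^+ 2 = 1 -> rot e0 (- e1) (rot e0 e1 w) = w.
Proof.
move=> ee; apply: plane_eq; rewrite /rot ?vec2_0 ?vec2_1.
  by rewrite -[RHS]mul1r -ee; ring.
by rewrite -[RHS]mul1r -ee; ring.
Qed.

Lemma shift_diffeo s0 : circle_diffeo (fun t : R => t + s0).
Proof.
have D t : is_derive t 1 (fun t => t + s0) 1.
  by apply: (is_derive_eq (is_derive_add (is_derive_id t 1) (is_derive_const s0 t))); rewrite addr0.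
have d1 : derive1 (fun t : R => t + s0) = fun _ => 1.
  by apply/funext => t; rewrite derive1E; have [_ ->] := D t.
split.
- by move=> t; have [] := D t.
- by rewrite d1; exact: continuous_const.
- by move=> t; rewrite d1 oner_eq0.
- by left => t; rewrite addrAC.
Qed.

Lemma congruent_agree (c1 c2 : R -> plane R) (L1 L2 e0 e1 f0 f1 s0 : R)
    (w : plane R) (Z1 Z2 : R -> plane R) : 0 < L1 -> 0 < L2 ->
  e0 ^+ 2 + e1 ^+ 2 = 1 -> f0 ^+ 2 + f1 ^+ 2 = 1 ->
  (forall t, c1 t = L1 *: rot e0 e1 (Z1 t)) -> (forall t, c2 t = L2 *: rot f0 f1 (Z2 t)) ->
  (forall t, Z2 (t + s0) = Z1 t + w) ->
  agree_up_to_similarity_and_reparametrization c1 c2.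
Proof.
move=> L10 L20 ee ff c1E c2E ZE.
have ee' : e0 ^+ 2 + (- e1) ^+ 2 = 1 by rewrite sqrrN.
pose g z := rot f0 f1 (rot e0 (- e1) z + w).
exists ((fun z => L2 *: z) \o (g \o (fun z => L1^-1 *: z))), (fun t => t + s0); split.
- apply: similarity_comp; first exact: similarity_scaling.
  apply: similarity_comp; last by apply: similarity_scaling; rewrite invr_gt0.
  apply: similarity_isometry => z1 z2; rewrite /g rotB enorm_rot //.
  have -> : rot e0 (- e1) z1 + w - (rot e0 (- e1) z2 + w) = rot e0 (- e1) z1 - rot e0 (- e1) z2.
    by rewrite opprD addrACA subrr addr0.
  by rewrite rotB enorm_rot.
- exact: shift_diffeo.
- by move=> t; rewrite c2E ZE /= c1E scalerA mulVf ?gt_eqF // scale1r /g rotK.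
Qed.

End Lifts.

Section Conclusion.
Context {R : realType}.
Implicit Types (s t : R).

Lemma extremal_translate (p lam1 A1 lam2 A2 s0 : R)
    (x1 y1 u1 v1 k1 x2 y2 u2 v2 k2 : R -> R) :
  extremal p 1 lam1 A1 0 x1 y1 u1 v1 k1 -> extremal p 1 lam2 A2 0 x2 y2 u2 v2 k2 ->
  (forall t, u2 (t + s0) = u1 t /\ v2 (t + s0) = v1 t) ->
  exists w, forall t, vec2 (x2 (t + s0)) (y2 (t + s0)) = vec2 (x1 t) (y1 t) + w.
Proof.
move=> E1 E2 uv; have Dsh t : is_derive t 1 (fun s => s + s0) 1.
  by apply: (is_derive_eq (is_derive_add (is_derive_id t 1) (is_derive_const s0 t))); rewrite addr0.
have D (f2 df2 f1 df1 : R -> R) : (forall t : R, is_derive t 1 f2 (df2 t)) ->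
    (forall t : R, is_derive t 1 f1 (df1 t)) -> (forall t, df2 (t + s0) = df1 t) ->
    forall t, f2 (t + s0) = f1 t + (f2 (0 + s0) - f1 0).
  move=> D2 D1 d12 t; have Dd s : is_derive s 1 (fun s => f2 (s + s0) - f1 s) 0.
    apply: (is_derive_eq (is_derive_sub (@is_derive_comp R f2 (fun s => s + s0) s _ _
      (D2 (s + s0)) (Dsh s)) (D1 s))).
    by rewrite d12 mulr1 subrr.
  by have := is_derive_0_is_cst t 0 Dd; lra.
exists (vec2 (x2 (0 + s0) - x1 0) (y2 (0 + s0) - y1 0)) => t.
have hx := D _ _ _ _ (ext_x E2) (ext_x E1) (fun t => (uv t).1) t.
have hy := D _ _ _ _ (ext_y E2) (ext_y E1) (fun t => (uv t).2) t.
apply: plane_eq.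
  by rewrite [RHS]add_coord !vec2_0 hx.
by rewrite [RHS]add_coord !vec2_1 hy.
Qed.

Lemma stable_elastica_data (p L : R) (c : W2p p L) : 1 < p -> 0 < L ->
  closed_planar_p_elastica c -> stable c -> C1_immersed_circle (circle_map c) ->
  exists (lam A e0 e1 : R) (X Y U V K : R -> R),
  [/\ extremal p 1 lam A 0 X Y U V K, 0 <= A /\ e0 ^+ 2 + e1 ^+ 2 = 1,
      forall t, circle_map c t = L *: rot e0 e1 (vec2 (X t) (Y t)),
      forall t, derive1 (circle_map c) t = L *: rot e0 e1 (vec2 (U t) (V t)) &
      0 < A -> forall tau : R, 0 < tau < 1 -> (forall t, U (t + tau) = U t) ->
        (forall t, V (t + tau) = V t) -> False].
Proof.
move=> p1 L0 [arcl [pcl vcl] [lam0 fv]] st im.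
have [C0 [C1 [x [y [u [v [k [E cE posE velE accE]]]]]]]] :=
  elastica_extremal p1 L0 arcl (conj pcl vcl) fv im.
have [A [lam [e0 [e1 [A0 ee En]]]]] := extremal_normalise p1 L0 E.
exists lam, A, e0, e1; do 5 eexists; split; first exact: En.
- by [].
- move=> t; rewrite cE; apply: plane_eq.
    rewrite scale_coord /rot !vec2_0 vec2_1 -[LHS]mul1r -ee; field; exact: lt0r_neq0.
  rewrite scale_coord /rot !vec2_1 vec2_0 -[LHS]mul1r -ee; field; exact: lt0r_neq0.
- have [_ Gd _ _] := im; have Dl t : is_derive t 1 (fun s : R => L * s) L.
    by apply: (is_derive_eq (is_derive_cmul L (is_derive_id t 1))); rewrite mulr1.
  move=> t; apply: plane_eq.
    have [_ <-] := coord_derive1 0 (Gd t).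
    rewrite (_ : (fun s => _) = fun s => x (L * s)); last first.
      by apply/funext => s; rewrite cE vec2_0.
    have [_ ->] := @is_derive_comp R x (fun s => L * s) t _ _ (ext_x E (L * t)) (Dl t).
    by rewrite scale_coord /rot !vec2_0 vec2_1 -[LHS]mul1r -ee; ring.
  have [_ <-] := coord_derive1 1 (Gd t).
  rewrite (_ : (fun s => _) = fun s => y (L * s)); last first.
    by apply/funext => s; rewrite cE vec2_1.
  have [_ ->] := @is_derive_comp R y (fun s => L * s) t _ _ (ext_y E (L * t)) (Dl t).
  by rewrite scale_coord /rot !vec2_1 vec2_0 -[LHS]mul1r -ee; ring.
- move=> Apos tau tau01 Ut Vt.
  by apply: (stable_wave_period p1 L0 E posE velE accE st ee Apos _ tau01 Ut Vt); do 2 eexists; exact: En.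
Qed.

End Conclusion.

Theorem corollary2p10 (R : realType) (p : R) (hp : 1 < p)
    (L1 L2 : R) (hL1 : 0 < L1) (hL2 : 0 < L2)
    (c1 : W2p p L1) (c2 : W2p p L2)
    (hc1 : closed_planar_p_elastica c1) (hs1 : stable c1)
    (hc2 : closed_planar_p_elastica c2) (hs2 : stable c2)
    (hclass : regularly_homotopic (circle_map c1) (circle_map c2)) :
  agree_up_to_similarity_and_reparametrization (circle_map c1) (circle_map c2).
Proof.
have [im1 im2] : C1_immersed_circle (circle_map c1) /\ C1_immersed_circle (circle_map c2).
  have [H [<- <- Him _]] := hclass.
  by split; apply: Him; rewrite lexx ler01.
have [lam1 [A1 [e0 [e1 [X1 [Y1 [U1 [V1 [K1 [E1 [A10 ee] c1E d1E P1]]]]]]]]]] :=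
  stable_elastica_data hp hL1 hc1 hs1 im1.
have [lam2 [A2 [f0 [f1 [X2 [Y2 [U2 [V2 [K2 [E2 [A20 ff] c2E d2E P2]]]]]]]]]] :=
  stable_elastica_data hp hL2 hc2 hs2 im2.
suff [s0 uv] : exists s0 : R, forall t, U2 (t + s0) = U1 t /\ V2 (t + s0) = V1 t.
  have [w Hw] := extremal_translate E1 E2 uv.
  exact: (congruent_agree hL1 hL2 ee ff c1E c2E Hw).
have circ (lam A : R) (X Y U V K : R -> R) : extremal p 1 lam A 0 X Y U V K -> A = 0 ->
    exists2 kap : R, kap != 0 & exists al : R,
      forall t : R, U t = cos (kap * t + al) /\ V t = sin (kap * t + al).
  move=> E A0; have [kap kap0 kE] := extremal_circle hp E A0; exists kap => //.
  have Du (t : R) : is_derive t 1 U (- kap * V t) by rewrite -(kE t); exact: (ext_u E t).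
  have Dv (t : R) : is_derive t 1 V (kap * U t) by rewrite -(kE t); exact: (ext_v E t).
  exact: (circle_angle Du Dv (ext_unit E)).
have wav (lam A : R) (X Y U V K : R -> R) : extremal p 1 lam A 0 X Y U V K -> 0 < A -> unit_lift U V 0.
  move=> E A0; exact: (wave_unit_lift (is_derive_continuous (ext_u E))
    (is_derive_continuous (ext_v E)) (extremal_u_gt hp E A0) (ext_unit E) (ext_uL E) (ext_vL E)).
have rn dd1 dd2 : unit_lift U1 V1 dd1 -> unit_lift U2 V2 dd2 -> dd1 = dd2.
  move=> l1 l2; apply: (rotation_number_invariant hclass).
    exact: (unit_lift_rot hL1 ee d1E l1).
  exact: (unit_lift_rot hL2 ff d2E l2).
move: A10 A20; rewrite !le_eqVlt => /predU1P[/esym Az1|Ap1] /predU1P[/esym Az2|Ap2].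
- have [k1 k10 [al1 uv1]] := circ _ _ _ _ _ _ _ E1 Az1.
  have [k2 k20 [al2 uv2]] := circ _ _ _ _ _ _ _ E2 Az2.
  have k12 := rn _ _ (circle_unit_lift uv1) (circle_unit_lift uv2).
  exists ((al1 - al2) / k1) => t; have [-> ->] := uv2 (t + (al1 - al2) / k1).
  have [-> ->] := uv1 t; rewrite -k12.
  have -> // : k1 * (t + (al1 - al2) / k1) + al2 = k1 * t + al1.
  by field.
- have [k1 k10 [al1 uv1]] := circ _ _ _ _ _ _ _ E1 Az1.
  by have := rn _ _ (circle_unit_lift uv1) (wav _ _ _ _ _ _ _ E2 Ap2) => k1z; rewrite k1z eqxx in k10.
- have [k2 k20 [al2 uv2]] := circ _ _ _ _ _ _ _ E2 Az2.
  by have := rn _ _ (wav _ _ _ _ _ _ _ E1 Ap1) (circle_unit_lift uv2) => k2z; rewrite -k2z eqxx in k20.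
have [r r0 [s0 uv]] := wavelike_compare hp Ap1 E1 Ap2 E2.
have [r1|r1|r1] := ltgtP r 1; last first.
- by exists s0 => t; have := uv t; rewrite r1 mul1r.
- exfalso; apply: (P1 Ap1 r^-1); first by rewrite invr_gt0 r0 invf_lt1.
    move=> t; rewrite -(uv (t + r^-1)).1 -(uv t).1 mulrDr mulfV ?gt_eqF // addrAC.
    exact: (ext_uL E2).
  move=> t; rewrite -(uv (t + r^-1)).2 -(uv t).2 mulrDr mulfV ?gt_eqF // addrAC.
  exact: (ext_vL E2).
- exfalso; apply: (P2 Ap2 r); first by rewrite r0.
    move=> t; pose s := (t - s0) / r; have tE : t = r * s + s0.
      by rewrite /s mulrC divfK ?gt_eqF // subrK.
    have -> : t + r = r * (s + 1) + s0 by rewrite tE; ring.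
    by rewrite tE (uv _).1 (uv _).1 (ext_uL E1).
  move=> t; pose s := (t - s0) / r; have tE : t = r * s + s0.
    by rewrite /s mulrC divfK ?gt_eqF // subrK.
  have -> : t + r = r * (s + 1) + s0 by rewrite tE; ring.
  by rewrite tE (uv _).2 (uv _).2 (ext_vL E1).
Qed.
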